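(* Let $n\ge2$, $1<\rho<n$, $\widetilde\rho=\frac{\rho n}{\rho n+\rho-n}$, let $\Omega\in L^\rho(\mathbb S^{n-1})$ with $\int_{\mathbb S^{n-1}}\Omega\,d\sigma=0$ and $\Omega\not\equiv0$, and let $\widetilde\rho\le p<n$. Let $\Phi$ be a Young function with $1<i_\Phi\le I_\Phi<\infty$ and let $w\in A_{i_\Phi}$. Then there exist $c_0=c_0(n,p,\rho)$ and $C=C\bigl(n,p,\Phi,[w]_{A_{i_\Phi}}\bigr)$ such that, for every $f\in C_c^\infty(\mathbb R^n)$, $$\int_{\mathbb R^n}\Phi\Bigl(\frac{T^\ast_\Omega f(x)}{c_0\,\|\Omega\|_{L^\rho(\mathbb S^{n-1})}}\Bigr)w(x)\,dx\le C\int_{\mathbb R^n}\Phi\bigl(M_{1,L^p}(|\nabla f|)(x)\bigr)\,w(x)\,dx.$$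
   Context: For $f\in C_c^\infty(\mathbb R^n)$, $$T^\ast_\Omega f(x)=\sup_{\varepsilon>0}\Bigl|\int_{|y|>\varepsilon}\frac{\Omega(y/|y|)}{|y|^n}f(x-y)\,dy\Bigr|.$$ Fractional maximal operator: for $1\le p<n$, $M_{1,L^p}g(x)=\sup_{Q\ni x}\ell(Q)\bigl(\frac1{|Q|}\int_Q|g|^p\bigr)^{1/p}$, the supremum being over all cubes $Q$ (sides parallel to the axes, side length $\ell(Q)$) containing $x$. A Young function is a continuous, convex and strictly increasing function $\Phi:[0,\infty)\to[0,\infty)$ with $\Phi(0)=0$, $\lim_{t\to0^+}\Phi(t)/t=0$, $\lim_{t\to\infty}\Phi(t)/t=\infty$. Its Matuszewska–Orlicz indices are $$i_\Phi=\sup_{0<\lambda<1}\frac{\log\bigl(\sup_{t>0}\Phi(\lambda t)/\Phi(t)\bigr)}{\log\lambda},\qquad I_\Phi=\inf_{\lambda>1}\frac{\log\bigl(\sup_{t>0}\Phi(\lambda t)/\Phi(t)\bigr)}{\log\lambda}.$$ A weight is a nonnegative locally integrable function on $\mathbb R^n$. For $1<r<\infty$, a weight $w$ is in $A_r$ if $[w]_{A_r}=\sup_Q\bigl(\frac1{|Q|}\int_Qw\bigr)\bigl(\frac1{|Q|}\int_Qw^{1-r'}\bigr)^{r-1}<\infty$, where $r'=r/(r-1)$. *)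

(* Defs.v *)
From HB Require Import structures.
From mathcomp Require Import all_boot all_order all_algebra.
From mathcomp Require Import all_classical all_reals all_analysis.
From mathcomp Require Import measurable_realfun.

Set Implicit Arguments.
Unset Strict Implicit.
Unset Printing Implicit Defensive.

Import Order.TTheory GRing.Theory Num.Theory.
Import numFieldNormedType.Exports.

Local Open Scope classical_set_scope.
Local Open Scope ring_scope.

(* R^n is 'rV[R]_n, with the sigma-algebra generated by the coordinates, i.e.
   the Borel sigma-algebra of R^n (same construction as for n.-tuple T). *)
Definition rV_display : measure_display. Proof. exact. Qed.

Section rV_measurable.
Context {R : realType} {n : nat}.

Definition rV_coord (i : 'I_n) (x : 'rV[R]_n) : R := x 0 i.

Let rV_set0 : g_sigma_preimage rV_coord set0.
Proof. exact: sigma_algebra0. Qed.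

Let rV_setC A : g_sigma_preimage rV_coord A -> g_sigma_preimage rV_coord (~` A).
Proof. exact: sigma_algebraC. Qed.

Let rV_bigcup (F : (set _)^nat) : (forall i, g_sigma_preimage rV_coord (F i)) ->
  g_sigma_preimage rV_coord (\bigcup_i (F i)).
Proof. exact: sigma_algebra_bigcup. Qed.

HB.instance Definition _ := @isMeasurable.Build rV_display 'rV[R]_n
  (g_sigma_preimage rV_coord) rV_set0 rV_setC rV_bigcup.

Lemma measurable_rV_coord (i : 'I_n) : measurable_fun setT (rV_coord i).
Proof.
move=> _ Y mY; rewrite setTI; apply: sub_sigma_algebra => /=.
rewrite -bigcup_seq/=; exists i => /=; first by rewrite mem_index_enum.
by exists Y => //; rewrite setTI.
Qed.

Lemma measurable_fun_rVP d (T : measurableType d) (f : T -> 'rV[R]_n) :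
  (forall i, measurable_fun setT (fun t => f t 0 i)) -> measurable_fun setT f.
Proof.
move=> mf _ A mA; rewrite setTI.
suff : preimage_set_system setT f (g_sigma_preimage rV_coord) `<=` measurable.
  by apply; exists A => //; rewrite setTI.
rewrite -g_sigma_preimageE; apply: smallest_sub.
  exact: sigma_algebra_measurable.
move=> _ [B + <-]; rewrite -bigcup_seq => -[i _ [Y mY <-]].
rewrite !setTI.
by have := mf i measurableT Y mY; rewrite setTI.
Qed.
End rV_measurable.

Section lebesgue_rV.
Context {R : realType}.

Definition rV_cons n (p : R * 'rV[R]_n) : 'rV[R]_n.+1 :=
  row_mx (p.1)%:M p.2 : 'rV_(1 + n).

Lemma rV_consE0 n (p : R * 'rV[R]_n) : rV_cons p 0 ord0 = p.1.
Proof.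
rewrite /rV_cons (_ : ord0 = lshift n (ord0 : 'I_1)); last exact/val_inj.
by rewrite (row_mxEl (n1 := 1)) mxE eqxx mulr1n.
Qed.

Lemma rV_consES n (p : R * 'rV[R]_n) (i : 'I_n) :
  rV_cons p 0 (lift ord0 i) = p.2 0 i.
Proof.
rewrite /rV_cons (_ : lift ord0 i = rshift 1 i); last exact/val_inj.
by rewrite (row_mxEr (n1 := 1)).
Qed.

Lemma measurable_rV_cons n : measurable_fun setT (@rV_cons n).
Proof.
apply: measurable_fun_rVP => i; have [j ->|->] := unliftP ord0 i.
- under eq_fun do rewrite rV_consES.
  exact: (measurableT_comp (measurable_rV_coord j) measurable_snd).
- under eq_fun do rewrite rV_consE0.
  exact: measurable_fst.
Qed.

Definition rV_uncons n (x : 'rV[R]_n.+1) : R * 'rV[R]_n :=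
  (x 0 ord0, \row_i x 0 (lift ord0 i)).

Lemma rV_consK n : cancel (@rV_cons n) (@rV_uncons n).
Proof.
move=> p; rewrite /rV_uncons rV_consE0 [RHS]surjective_pairing; congr pair.
by apply/rowP => i; rewrite mxE rV_consES.
Qed.

Lemma measurable_rV_uncons n : measurable_fun setT (@rV_uncons n).
Proof.
apply/measurable_fun_pairP; split; first exact: measurable_rV_coord.
apply: measurable_fun_rVP => i /=.
by under eq_fun do rewrite mxE; exact: measurable_rV_coord.
Qed.

Section step.
Context (n : nat) (mu : {sigma_finite_measure set 'rV[R]_n -> \bar R}).

Definition lebesgue_rVS : set 'rV[R]_n.+1 -> \bar R :=
  pushforward (@lebesgue_measure R \x mu)%E (@rV_cons n).

Let lebesgue_rVS0 : lebesgue_rVS set0 = 0%E.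
Proof. by rewrite /lebesgue_rVS /pushforward preimage_set0 measure0. Qed.

Let lebesgue_rVS_ge0 A : (0 <= lebesgue_rVS A)%E.
Proof. by rewrite /lebesgue_rVS /pushforward measure_ge0. Qed.

Let lebesgue_rVS_sigma_additive : semi_sigma_additive lebesgue_rVS.
Proof.
exact: (@measure_semi_sigma_additive _ _ _
  (measure_function_pushforward__canonical__measure_function_Measure
    (@lebesgue_measure R \x mu)%E (measurable_rV_cons (n := n)))).
Qed.

HB.instance Definition _ := isMeasure.Build _ _ _ lebesgue_rVS
  lebesgue_rVS0 lebesgue_rVS_ge0 lebesgue_rVS_sigma_additive.
Let lebesgue_rVS_sigma_finite : sigma_finite setT lebesgue_rVS.
Proof.
have /sigma_finiteP[F [TF ndF Foo]] := sigma_finiteT (@lebesgue_measure R).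
have /sigma_finiteP[G [TG ndG Goo]] := sigma_finiteT mu.
exists (fun k => @rV_uncons n @^-1` (F k `*` G k)) => [|k].
  rewrite -preimage_bigcup (_ : \bigcup_k _ = setT) ?preimage_setT//.
  rewrite -setXTT TF TG; apply/seteqP; split=> -[x y].
    by move=> [k _ []/= ? ?]; split; exists k.
  move=> [/= [k _ Fkx] [l _ Gly]]; exists (maxn k l) => //; split.
  - by move: x Fkx; exact/subsetPset/ndF/leq_maxl.
  - by move: y Gly; exact/subsetPset/ndG/leq_maxr.
have [mF Foo'] := Foo k; have [mG Goo'] := Goo k; split.
  rewrite -[X in measurable X]setTI; apply: measurable_rV_uncons => //.
  exact: measurableX.
rewrite /lebesgue_rVS /pushforward -comp_preimage.
rewrite (_ : _ \o _ = id) ?preimage_id; last exact/funext/rV_consK.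
by rewrite product_measure1E// lte_mul_pinfty// ge0_fin_numE.
Qed.

HB.instance Definition _ := Measure_isSigmaFinite.Build _ _ _ lebesgue_rVS
  lebesgue_rVS_sigma_finite.
End step.

(* n-fold product of the Lebesgue measure of R; on R^0 it is the Dirac mass. *)
Fixpoint lebesgue_rV n : {sigma_finite_measure set 'rV[R]_n -> \bar R} :=
  match n with
  | 0%N => dirac (0 : 'rV[R]_0)
  | m.+1 => lebesgue_rVS (lebesgue_rV m)
  end.

Definition cube n (a : 'rV[R]_n) (l : R) : set 'rV[R]_n :=
  [set y | forall i, a 0 i <= y 0 i <= a 0 i + l].

Lemma measurable_cube n (a : 'rV[R]_n) l : measurable (cube a l).
Proof.
rewrite (_ : cube a l =
    \bigcap_(i in [set: 'I_n]) (rV_coord i @^-1` `[a 0 i, a 0 i + l])).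
  apply: fin_bigcap_measurable => // i _; rewrite -[X in measurable X]setTI.
  exact: measurable_rV_coord.
by apply/seteqP; split => y yl i => [_|]; have := yl i; rewrite /= in_itv/=; auto.
Qed.

Lemma lebesgue_cube n (a : 'rV[R]_n) l : 0 <= l ->
  lebesgue_rV n (cube a l) = (l ^+ n)%:E.
Proof.
move=> l0; elim: n a => [|n IH] a.
  by rewrite /= diracE mem_set// => -[].
rewrite /= /lebesgue_rVS /pushforward.
have -> : @rV_cons n @^-1` cube a l =
    `[a 0 ord0, a 0 ord0 + l] `*` cube (rV_uncons a).2 l.
  apply/seteqP; split => [p Hp|p [H0 HS] i] /=.
    split => [|i]; last by rewrite mxE -rV_consES.
    by rewrite /= in_itv /= -(rV_consE0 p).
  have [j ->|->] := unliftP ord0 i; last by rewrite rV_consE0; move: H0; rewrite /= in_itv.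
  by rewrite rV_consES; move: (HS j); rewrite mxE.
rewrite product_measure1E//; last exact: measurable_cube.
rewrite IH// [X in (X * _)%E](lebesgue_measure_itv `[_, _])/= lte_fin.
case: ltP => [_|]; first by rewrite -EFinB addrAC subrr add0r -EFinM exprS.
rewrite gerDl => l0'; have -> : l = 0 by apply/eqP; rewrite eq_le l0 l0'.
by rewrite mul0e expr0n.
Qed.
End lebesgue_rV.

Section sphere.
Context {R : realType} {n : nat}.
Implicit Types x : 'rV[R]_n.

(* the canonical norm of 'rV[R]_n is the sup norm *)
Definition enorm x : R := Num.sqrt (\sum_i x 0 i ^+ 2).

Definition direction x : 'rV[R]_n := (enorm x)^-1 *: x.

Lemma measurable_enorm : measurable_fun setT enorm.
Proof.
apply: (measurableT_comp (f := @Num.sqrt R)).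
  by apply: continuous_measurable_fun => r; exact: sqrt_continuous.
apply: measurable_sum => i; apply: measurable_funX.
exact: measurable_rV_coord.
Qed.

Lemma measurable_direction : measurable_fun setT direction.
Proof.
apply: measurable_fun_rVP => i; rewrite /direction.
under eq_fun do rewrite mxE -powR_inv1 ?sqrtr_ge0//.
apply: measurable_funM; last exact: measurable_rV_coord.
apply: (measurableT_comp (f := fun r : R => r `^ -1)) => //.
exact: measurable_enorm.
Qed.

Definition punctured_ball : set 'rV[R]_n := [set x | 0 < enorm x <= 1].

Lemma measurable_punctured_ball : measurable punctured_ball.
Proof.
rewrite (_ : punctured_ball = enorm @^-1` `]0, 1]).
  by rewrite -[X in measurable X]setTI; exact: measurable_enorm.
by apply/seteqP; split => x; rewrite /= in_itv.
Qed.

(* Surface measure of S^(n-1), by integration in polar coordinates: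
   sigma(A) = n |{x : 0 < |x| <= 1, x/|x| \in A}|. It is a measure on R^n,
   carried by the unit sphere. *)
Definition sphere_measure : set 'rV[R]_n -> \bar R :=
  pushforward
    (mscale n%:R%:nng (mrestr (lebesgue_rV n) measurable_punctured_ball))
    direction.

Let sphere_measure0 : sphere_measure set0 = 0%E.
Proof. by rewrite /sphere_measure /pushforward preimage_set0 measure0. Qed.

Let sphere_measure_ge0 A : (0 <= sphere_measure A)%E.
Proof. by rewrite /sphere_measure /pushforward measure_ge0. Qed.

Let sphere_measure_sigma_additive : semi_sigma_additive sphere_measure.
Proof.
exact: (@measure_semi_sigma_additive _ _ _
  (measure_function_pushforward__canonical__measure_function_Measure
    (mscale n%:R%:nng (mrestr (lebesgue_rV n) measurable_punctured_ball))
    measurable_direction)).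
Qed.

HB.instance Definition _ := isMeasure.Build _ _ _ sphere_measure
  sphere_measure0 sphere_measure_ge0 sphere_measure_sigma_additive.

End sphere.

(* Measurability with respect to the completion of mu. The integrals below are
   taken against Borel measures; \int[mu] (via suprema over simple functions)
   agrees on completed-measurable functions with the completed integral. *)
Definition completed_measurable_fun d (T : measurableType d) (R : realType)
    (mu : set T -> \bar R) (f : T -> R) :=
  forall B : set R, measurable B -> completed_algebra_gen mu (f @^-1` B).

Section operators.
Context {R : realType} {n : nat}.
Implicit Types (f g w Omega : 'rV[R]_n -> R) (x : 'rV[R]_n).
Local Notation leb := (lebesgue_rV n).

Definition partial (i : 'I_n) f : 'rV[R]_n -> R := fun x => 'D_(delta_mx 0 i) f x.

Definition smooth f := forall s : seq 'I_n, let g := foldr partial f s in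
  continuous g /\ forall i x, derivable g x (delta_mx 0 i).

Definition test_function f :=
  smooth f /\ compact (closure [set x | f x != 0]).

Definition grad_norm f x : R := enorm (\row_i partial i f x).

Definition maximal_singular Omega f x : \bar R :=
  ereal_sup [set (`| \int[leb]_(y in [set y | (eps < enorm y)%R])
      (Omega (direction y) / enorm y ^+ n * f (x - y))%:E |)%E |
    eps in [set eps | 0 < eps]].

Definition average (A : set 'rV[R]_n) (h : 'rV[R]_n -> \bar R) : \bar R :=
  ((\int[leb]_(y in A) h y) / leb A)%E.

(* closed cubes; l is the side length *)
Definition fractional_maximal p g x : \bar R :=
  ereal_sup [set M | exists a l, [/\ 0 < l, cube a l x &
    M = (l%:E * average (cube a l) (fun y => (`|g y| `^ p)%:E) `^ p^-1)%E]].

Definition Lsphere rho Omega :=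
  completed_measurable_fun (@sphere_measure R n) Omega /\
  finite_norm (@sphere_measure R n) rho%:E Omega.

Definition sphere_norm rho Omega : R :=
  fine ('N[@sphere_measure R n]_(rho%:E)[EFin \o Omega])%E.

Definition weight w :=
  [/\ completed_measurable_fun leb w,
      forall x, 0 <= w x &
      forall K, compact K -> (\int[leb]_(x in K) (w x)%:E < +oo)%E].

(* w^(1-r') is written (w^(r'-1))^-1 in \bar R: it is +oo where w vanishes,
   whereas powR would give 0 `^ (1 - r') = 0. *)
Definition muckenhoupt_constant r w : \bar R :=
  ereal_sup [set A | exists a l, 0 < l /\
    A = (average (cube a l) (EFin \o w) *
         average (cube a l) (fun x => ((w x `^ (r / (r - 1) - 1))%:E)^-1)
           `^ (r - 1))%E].

Definition muckenhoupt r w := weight w /\ (muckenhoupt_constant r w < +oo)%E.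

End operators.

Section young.
Context {R : realType}.
Implicit Types Phi : R -> R.

(* only the values of Phi on [0, +oo[ matter *)
Definition young_function Phi :=
  {within `[0, +oo[, continuous Phi} /\
  convex_function (`[0, +oo[%classic : set R) Phi /\
  {in `[0, +oo[ &, {homo Phi : s t / s < t}} /\
  {in `[0, +oo[, forall t, 0 <= Phi t} /\
  Phi 0 = 0 /\
  Phi t / t @[t --> 0^'+] --> 0 /\
  Phi t / t @[t --> +oo] --> +oo.

(* sup_(t > 0) Phi (lambda t) / Phi t *)
Definition dilation Phi (lambda : R) : \bar R :=
  ereal_sup [set (Phi (lambda * t) / Phi t)%:E | t in [set t | 0 < t]].

Definition lower_index Phi : \bar R :=
  ereal_sup [set (lne (dilation Phi lambda) / (ln lambda)%:E)%E |
    lambda in [set lambda | 0 < lambda < 1]].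

Definition upper_index Phi : \bar R :=
  ereal_inf [set (lne (dilation Phi lambda) / (ln lambda)%:E)%E |
    lambda in [set lambda | 1 < lambda]].

(* Phi extended to [0, +oo] *)
Definition young_ext Phi (x : \bar R) : \bar R :=
  match x with
  | r%:E => (Phi r)%:E
  | +oo%E => +oo%E
  | -oo%E => 0%E
  end.

End young.

(* Main.v *)
Require Import Defs.
From HB Require Import structures.
From mathcomp Require Import all_boot all_order all_algebra.
From mathcomp Require Import all_classical all_reals all_analysis.
From mathcomp Require Import measurable_realfun ring lra zify.

(** The maximal singular integral is controlled pointwise by a sum over dyadic
    scales, and this sum is controlled in the weighted Orlicz space by a
    maximum over the same scales, which is at most the fractional maximal
    function.

    Pointwise bound. Let [q] be the exponent whose Sobolev exponent is the
    conjugate of [rho]. Cut the truncated integral into dyadic annuli. On each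
    annulus the homogeneous kernel has mean zero ([kernel_mean_zero]), so that
    the average of [f] over the dyadic cube of [x] may be subtracted from [f].
    Pairing the difference with the kernel is a Sobolev-Poincare inequality
    ([sobolev_pairing]), in which the kernel has its [L^rho] norm and the
    gradient an average of its [q]-th power; since [q <= p], the latter is at
    most an average of the [p]-th power ([integral_ncell_power]). The annulus of
    radius [l] thus contributes at most a constant times
    [l * (average of |grad f|^p over a cube of side 3 l) ^ (1/p)], which is a
    [scale_term], and [truncated_singular_le] adds them up.

    The Sobolev-Poincare inequality is obtained by Hedberg's method. Averages of
    [f] over nested cubes differ by the integral of the gradient
    ([pair_poincare], [oscillation_telescope]); the resulting sum over scales is
    interpolated between the dyadic maximal function and a trivial bound
    ([hedberg_sum]), and the maximal function is estimated by Doob's inequality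
    ([doob_maximal]).

    From sums to maxima. This is a dyadic inequality of Muckenhoupt and Wheeden
    ([finite_sum_le_max]). Say that a scale is marked at a point if no smaller
    scale has a much larger average there. After a marked scale the terms of the
    sum decay geometrically, so that the marked terms add up to a multiple of
    the largest one ([sum_marked_le]). By the weak-type estimate
    [weak_type_cell] at least half of every dyadic cube is marked at its own
    scale, and a Muckenhoupt weight charges such a half
    ([muckenhoupt_charges_halves]); hence the unmarked terms are controlled by
    the marked ones. The convex function enters through its increments
    ([convex_telescope]) and a form of Young's inequality ([slope_young]). A
    finite upper index is the doubling condition ([young_convex_doubling]), and
    the lower index is the exponent of the Muckenhoupt condition.

    The top scale then tends to infinity and the bottom scale to zero, and
    monotone convergence gives the theorem. The maximal operators are integrated
    as arbitrary functions: the integral of a nonnegative function is monotone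
    and insensitive to null sets without any measurability
    ([le_lower_integral], [eq_lower_integral_off_null]). *)

Import Order.TTheory GRing.Theory Num.Theory.
Import numFieldNormedType.Exports.
Local Open Scope classical_set_scope.
Local Open Scope ring_scope.

Set Implicit Arguments.
Unset Strict Implicit.
Unset Printing Implicit Defensive.

(** * Integrals of functions that need not be measurable *)

Section lower_integral.
Context d (T : measurableType d) (R : realType) (mu : {measure set T -> \bar R}).
Local Open Scope ereal_scope.

Import HBNNSimple.

(** The integral of a nonnegative function is a supremum over the simple
    functions below it, so that it is monotone without any measurability. *)
Lemma le_lower_integral (f g : T -> \bar R) :
  (forall x, 0 <= f x) -> (forall x, f x <= g x) ->
  \int[mu]_x f x <= \int[mu]_x g x.
Proof.
move=> f0 fg; have g0 x : 0 <= g x by exact: le_trans (fg x).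
rewrite !ge0_integralTE//; apply: le_ereal_sup => _ [h hf <-].
by exists h => // x; exact: le_trans (fg x).
Qed.

Let ge0_le_lower_integral_off_null (N : set T) (f g : T -> \bar R) :
  measurable N -> mu N = 0 -> (forall x, 0 <= f x) -> (forall x, 0 <= g x) ->
  (forall x, ~ N x -> f x = g x) -> \int[mu]_x f x <= \int[mu]_x g x.
Proof.
move=> mN N0 f0 g0 fg; rewrite ge0_integralTE//.
apply: ge_ereal_sup => _ [h hf <-].
rewrite -integralT_nnsfun.
have mh : measurable_fun setT (fun x => (h x)%:E) by exact/measurable_EFinP.
rewrite (ge0_negligible_integral mN)//; last by move=> x _; rewrite lee_fin.
rewrite integral_mkcond; apply: le_lower_integral => x.
  by apply: erestrict_ge0 => y _; rewrite lee_fin.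
rewrite /patch; case: ifPn => // /set_mem[_ Nx].
by rewrite -fg//; exact: hf.
Qed.

(** The maximal operators are not known to be measurable, and weights and
    kernels are measurable only for the completed measure; this lemma replaces
    the latter by Borel functions inside such integrals. *)
Lemma eq_lower_integral_off_null (D N : set T) (f g : T -> \bar R) :
  measurable N -> mu N = 0 -> (forall x, D x -> ~ N x -> f x = g x) ->
  \int[mu]_(x in D) f x = \int[mu]_(x in D) g x.
Proof.
move=> mN N0 fg.
have E (u v : T -> \bar R) : (forall x, 0 <= u x) -> (forall x, 0 <= v x) ->
    (forall x, D x -> ~ N x -> u x = v x) ->
    \int[mu]_(x in D) u x = \int[mu]_(x in D) v x.
  move=> u0 v0 uv; rewrite integral_mkcond [RHS]integral_mkcond.
  have P (u' v' : T -> \bar R) : (forall x, D x -> ~ N x -> u' x = v' x) ->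
      forall x, ~ N x -> (u' \_ D) x = (v' \_ D) x.
    by move=> uv' x Nx; rewrite /patch; case: ifP => // /set_mem Dx; exact: uv'.
  have D0 (u' : T -> \bar R) : (forall x, 0 <= u' x) ->
      forall x, 0 <= (u' \_ D) x by move=> u0' x; exact: erestrict_ge0.
  by apply/eqP; rewrite eq_le; apply/andP; split;
    apply: (@ge0_le_lower_integral_off_null N (_ \_ D) (_ \_ D) mN N0);
    by [exact: D0|apply: P => // x Dx Nx; rewrite uv].
rewrite integralE [RHS]integralE; congr (_ - _); apply: E => //.
- by move=> x Dx Nx; rewrite !funeposE fg.
- by move=> x Dx Nx; rewrite !funenegE fg.
Qed.

Lemma ge0_integral_mrestr (D : set T) (mD : measurable D) (f : T -> \bar R) :
  measurable_fun setT f -> (forall x, 0 <= f x) ->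
  \int[mrestr mu mD]_x f x = \int[mu]_(x in D) f x.
Proof.
move=> mf f0; rewrite (@ge0_negligible_integral _ _ _ (mrestr mu mD) setT (~` D))//.
- rewrite setTD setCK; apply: eq_measure_integral => A mA AD.
  by rewrite /= /mrestr setIidl.
- exact: measurableC.
- by rewrite /= /mrestr setICl measure0.
Qed.

End lower_integral.

Section nonneg_real_integral.
Context d (T : measurableType d) (R : realType) (mu : {measure set T -> \bar R}).
Implicit Types f g : T -> R.

Lemma nn_integral_ge0 f : (forall x, 0 <= f x) -> (0 <= \int[mu]_x (f x)%:E)%E.
Proof. by move=> f0; apply: integral_ge0 => x _; rewrite lee_fin. Qed.

Lemma nn_integral_le f g : (forall x, 0 <= f x) -> (forall x, f x <= g x) ->
  (\int[mu]_x (f x)%:E <= \int[mu]_x (g x)%:E)%E.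
Proof.
by move=> f0 fg; apply: le_lower_integral => x; rewrite lee_fin.
Qed.

Lemma nn_integralZl k f : 0 <= k -> measurable_fun setT f ->
  (forall x, 0 <= f x) ->
  (\int[mu]_x (k * f x)%:E = k%:E * \int[mu]_x (f x)%:E)%E.
Proof.
move=> k0 mf f0; rewrite -ge0_integralZl//; first exact/measurable_EFinP.
by move=> x _; rewrite lee_fin.
Qed.

Lemma nn_integralD f g : measurable_fun setT f -> measurable_fun setT g ->
  (forall x, 0 <= f x) -> (forall x, 0 <= g x) ->
  (\int[mu]_x (f x + g x)%:E = \int[mu]_x (f x)%:E + \int[mu]_x (g x)%:E)%E.
Proof.
move=> mf mg f0 g0; rewrite -ge0_integralD//.
- by move=> x _; rewrite lee_fin.
- exact/measurable_EFinP.
- by move=> x _; rewrite lee_fin.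
- exact/measurable_EFinP.
Qed.

Lemma nn_integral_sum (I : Type) (s : seq I) (F : I -> T -> R) :
  (forall i, measurable_fun setT (F i)) -> (forall i x, 0 <= F i x) ->
  (\int[mu]_x (\sum_(i <- s) F i x)%:E = \sum_(i <- s) \int[mu]_x (F i x)%:E)%E.
Proof.
move=> mF F0; under eq_integral do rewrite -sumEFin.
rewrite ge0_integral_sum// => [i|i x _]; first exact/measurable_EFinP.
by rewrite lee_fin.
Qed.

End nonneg_real_integral.

(** A function that is measurable for the completed sigma-algebra only has to
    be changed on countably many null sets, one for each rational level. *)
Lemma completed_measurable_fun_borel d (T : measurableType d) (R : realType)
    (mu : {measure set T -> \bar R}) (f : T -> R) :
  completed_measurable_fun mu f ->
  exists (g : T -> R) (N : set T), [/\ measurable_fun setT g, measurable N,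
    mu N = 0%E, forall x, ~ N x -> g x = f x & forall x, N x -> g x = 0].
Proof.
move=> cf.
have H (q : rat) : exists N : set T, [/\ measurable N, mu N = 0%E &
    measurable ((f @^-1` `]ratr q, +oo[) `\` N)].
  have [A mA [N' [N [mN N0 N'N]] AN']] := cf _ (measurable_itv `]ratr q, +oo[).
  exists N; split => //; rewrite -AN'.
  rewrite (_ : _ `\` _ = A `\` N); first exact: measurableD.
  apply/seteqP; split => x /= [].
    by move=> [//|/N'N].
  by move=> Ax Nx; split => //; left.
have [N_ N_P] := choice H.
pose N := \bigcup_q N_ q.
have mN : measurable N by apply: bigcupT_measurable_rat => q; have [] := N_P q.
have N0 : mu N = 0%E.
  apply/negligibleP => //.
  rewrite (_ : N = \bigcup_k N_ (odflt 0 (unpickle k))); last first.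
    apply/seteqP; split => x [q _ Nq]; last by exists (odflt 0 (unpickle q)).
    by exists (pickle q); rewrite ?pickleK.
  apply: negligible_bigcup => k; have [mNk Nk0 _] := N_P (odflt 0 (unpickle k)).
  exact/negligibleP.
exists (fun x => if x \in N then 0 else f x), N; split => //.
- move=> mT; apply: (measurability _ (RGenOInfty.measurableE R)) => //.
  move=> _ [_ [r ->] <-]; rewrite setTI.
  rewrite (_ : _ @^-1` _ = (if r < 0 then N else set0) `|`
     \bigcup_q (if r < ratr q then (f @^-1` `]ratr q, +oo[) `\` N else set0)).
    apply: measurableU; first by case: ifP.
    apply: bigcupT_measurable_rat => q; case: ifP => // _.
    rewrite (_ : _ `\` N = ((f @^-1` `]ratr q, +oo[) `\` N_ q) `\` N).
      by apply: measurableD => //; have [] := N_P q.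
    rewrite setDDl (_ : N_ q `|` N = N)//.
    by apply/setUidPr => x Nx; exists q.
  apply/seteqP; split => x /=; rewrite in_itv/= andbT.
    case: ifPn => [/set_mem Nx r0|/negP Nx rf]; first by left; rewrite r0.
    right; have [q] := rat_in_itvoo rf; rewrite in_itv/= => /andP[rq qf].
    exists q => //; rewrite rq; split; first by rewrite /= in_itv/= qf.
    by move/mem_set.
  move=> [|[q _]].
    by case: ifPn => // r0 Nx; rewrite mem_set.
  case: ifPn => // rq [/=]; rewrite in_itv/= andbT => qf Nx.
  by rewrite memNset//; exact: lt_trans qf.
- by move=> x Nx; rewrite memNset.
- by move=> x Nx; rewrite mem_set.
Qed.

(** * Lebesgue measure of R^n: affine substitutions and boxes *)

Section affine_line.
Context (R : realType).
Local Notation mu := (@lebesgue_measure R).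

Let affine (a b : R) (x : measurableTypeR R) : measurableTypeR R :=
  (a * (x : R) + b)%R.

Let measurable_affine a b : measurable_fun setT (affine a b).
Proof. by apply: (@measurable_funD _ R R) => //; exact: mulrl_measurable. Qed.

Let scaled_image (a b : R) : {measure set (measurableTypeR R) -> \bar R} :=
  mscale (NngNum (normr_ge0 a))
   (measure_function_pushforward__canonical__measure_function_Measure
      mu (measurable_affine a b)).

Let scaled_imageE a b (A : set (measurableTypeR R)) : a != 0 -> measurable A ->
  mu A = scaled_image a b A.
Proof.
move=> a0; apply: lebesgue_measure_unique => _ [[c d] _ <-] /=.
rewrite /mscale /= /pushforward lebesgue_measure_itv/= lte_fin.
have [a0'|a0'|a0'] := ltgtP 0 a; last by rewrite -a0' eqxx in a0.
  rewrite (_ : _ @^-1` _ = `](c - b) / a, (d - b) / a]%classic); last first.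
    apply/seteqP; split => x; rewrite /= !in_itv/= /affine.
      by rewrite ltr_pdivrMr// ler_pdivlMr// ltrBlDr lerBrDr ![_ * a]mulrC.
    by rewrite ltr_pdivrMr// ler_pdivlMr// ltrBlDr lerBrDr ![_ * a]mulrC.
  rewrite lebesgue_measure_itv/= lte_fin ltr_pM2r ?invr_gt0// ltrD2r.
  case: ifPn => _; last by rewrite mule0.
  by rewrite -!EFinB -EFinM gtr0_norm//; congr EFin; field.
rewrite (_ : _ @^-1` _ = `[(d - b) / a, (c - b) / a[%classic); last first.
  apply/seteqP; split => x; rewrite /= !in_itv/= /affine.
    by rewrite ltr_ndivlMr// ler_ndivrMr// ltrBlDr lerBrDr ![_ * a]mulrC andbC.
  by rewrite ltr_ndivlMr// ler_ndivrMr// ltrBlDr lerBrDr ![_ * a]mulrC andbC.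
rewrite lebesgue_measure_itv/= lte_fin ltr_nM2r ?invr_lt0// ltrD2r.
case: ifPn => _; last by rewrite mule0.
by rewrite -!EFinB -EFinM ltr0_norm//; congr EFin; field.
Qed.

Lemma integral_affine_line (a b : R) (f : R -> \bar R) : a != 0 ->
  measurable_fun setT f -> (forall x, 0 <= f x)%E ->
  (\int[mu]_x f (a * x + b)%R = `|a|^-1%:E * \int[mu]_x f x)%E.
Proof.
move=> a0 mf f0.
have -> : (\int[mu]_x f x = \int[scaled_image a b]_x f x)%E.
  by apply: eq_measure_integral => A mA _; exact: scaled_imageE.
rewrite ge0_integral_mscale//= ge0_integral_pushforward// preimage_setT.
by rewrite muleA -EFinM mulVf ?normr_eq0// mul1e.
Qed.

Lemma integral_affine_line_scaled (k a b : R) (f : R -> \bar R) : 0 <= k ->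
  a != 0 -> measurable_fun setT f -> (forall x, 0 <= f x)%E ->
  (\int[mu]_x (k%:E * f (a * x + b)%R) =
   (k * `|a|^-1)%:E * \int[mu]_x f x)%E.
Proof.
move=> k0 a0 mf f0; rewrite ge0_integralZl//; last 1 first.
  exact: (measurableT_comp mf (measurable_affine a b)).
by rewrite integral_affine_line// muleA -EFinM.
Qed.

End affine_line.

Section rV_integral.
Context (R : realType).
Local Open Scope ereal_scope.

Lemma integral_lebesgue_rVS n (F : 'rV[R]_n.+1 -> \bar R) :
  measurable_fun setT F -> (forall x, 0 <= F x) ->
  \int[lebesgue_rV n.+1]_x F x =
  \int[lebesgue_measure]_t \int[lebesgue_rV n]_x F (rV_cons (t, x)).
Proof.
move=> mF F0.
transitivity (\int[pushforward (@lebesgue_measure R \x lebesgue_rV n)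
    (@rV_cons R n)]_x F x); first by [].
rewrite (@ge0_integral_pushforward _ _ (measurableTypeR R * 'rV[R]_n)%type
  'rV[R]_n.+1 R (@rV_cons R n) (measurable_rV_cons (n:=n)))//=.
rewrite preimage_setT; apply: (@fubini_tonelli1 _ _ (measurableTypeR R) 'rV[R]_n R
  lebesgue_measure (lebesgue_rV n) (F \o @rV_cons R n)) => [|x]; last exact: F0.
by apply: measurableT_comp => //; exact: measurable_rV_cons.
Qed.

Lemma measurable_rV_affine n (a : R) (v : 'rV[R]_n) :
  measurable_fun setT (fun x : 'rV[R]_n => (a *: x + v)%R).
Proof.
apply: measurable_fun_rVP => i.
under eq_fun do rewrite !mxE.
apply: measurable_funD => //; apply: measurable_funM => //.
exact: measurable_rV_coord.
Qed.

(** The affine maps [x |-> a x + v] contain the translations, the dilations and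
    the reflection; they act on each coordinate separately, which is what the
    induction on the dimension needs. *)
Lemma integral_affine n (a : R) (v : 'rV[R]_n) (F : 'rV[R]_n -> \bar R) :
  a != 0%R -> measurable_fun setT F -> (forall x, 0 <= F x) ->
  \int[lebesgue_rV n]_x F (a *: x + v)%R =
  ((`|a| ^+ n)^-1)%:E * \int[lebesgue_rV n]_x F x.
Proof.
move=> a0; elim: n v F => [|n IH] v F mF F0.
  rewrite expr0 invr1 mul1e; apply: eq_integral => x _; congr (F _).
  by apply/rowP => -[].
rewrite !integral_lebesgue_rVS//; last first.
  by apply: measurableT_comp => //; exact: measurable_rV_affine.
have mFc : measurable_fun setT (F \o @rV_cons R n).
  by apply: measurableT_comp => //; exact: measurable_rV_cons.
pose w := \row_i v 0%R (lift ord0 i).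
pose G t := \int[lebesgue_rV n]_x F (rV_cons (t, x)).
have mG : measurable_fun setT G.
  by apply: (@measurable_fun_fubini_tonelli_F _ _ (measurableTypeR R) 'rV[R]_n R
    (lebesgue_rV n) (F \o @rV_cons R n)) => [|x]; [exact: mFc|exact: F0].
have G0 t : 0 <= G t by exact: integral_ge0.
transitivity (\int[lebesgue_measure]_t
    (((`|a| ^+ n)^-1)%:E * G (a * t + v 0%R ord0)%R)).
  apply: eq_integral => t _.
  rewrite -(IH w (fun x => F (rV_cons (a * t + v 0 ord0, x)%R)))//; last first.
    apply: (measurableT_comp mFc).
    by apply: measurable_fun_pair => //; exact: measurable_cst.
  apply: eq_integral => x _; congr (F _).
  have := rV_consES (t, x); have := rV_consE0 (t, x).
  move: (rV_cons (t, x)) => c /= c0 cS; apply/rowP => i.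
  have [j ->|->] := unliftP ord0 i.
    by rewrite rV_consES/= !mxE cS.
  by rewrite rV_consE0/= !mxE c0.
have k0 : (0 <= (`|a| ^+ n)^-1)%R by rewrite invr_ge0 exprn_ge0.
rewrite (integral_affine_line_scaled _ k0 a0 mG G0).
by rewrite -invfM -exprSr.
Qed.

Lemma integral_translate n (v : 'rV[R]_n) (F : 'rV[R]_n -> \bar R) :
  measurable_fun setT F -> (forall x, 0 <= F x) ->
  \int[lebesgue_rV n]_x F (x + v)%R = \int[lebesgue_rV n]_x F x.
Proof.
move=> mF F0; have := @integral_affine n 1 v F (oner_neq0 _) mF F0.
rewrite normr1 expr1n invr1 mul1e => <-.
by apply: eq_integral => x _; rewrite scale1r.
Qed.

Lemma integral_reflect n (v : 'rV[R]_n) (F : 'rV[R]_n -> \bar R) :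
  measurable_fun setT F -> (forall x, 0 <= F x) ->
  \int[lebesgue_rV n]_x F (v - x)%R = \int[lebesgue_rV n]_x F x.
Proof.
move=> mF F0; have a0 : (-1 != 0 :> R)%R by rewrite oppr_eq0 oner_eq0.
have := @integral_affine n (-1) v F a0 mF F0.
rewrite normrN1 expr1n invr1 mul1e => <-.
by apply: eq_integral => x _; rewrite scaleN1r addrC.
Qed.

Lemma integral_dilate n (a : R) (F : 'rV[R]_n -> \bar R) : (0 < a)%R ->
  measurable_fun setT F -> (forall x, 0 <= F x) ->
  \int[lebesgue_rV n]_x F (a *: x)%R =
  ((a ^+ n)^-1)%:E * \int[lebesgue_rV n]_x F x.
Proof.
move=> a0 mF F0; have := @integral_affine n a 0%R F (lt0r_neq0 a0) mF F0.
rewrite gtr0_norm// => <-.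
by apply: eq_integral => x _; rewrite addr0.
Qed.

End rV_integral.

Section measurability.
Context d (T : measurableType d) (R : realType) (n : nat).

Lemma measurable_fun_coord (f : T -> 'rV[R]_n) i :
  measurable_fun setT f -> measurable_fun setT (fun t => f t 0 i).
Proof. by move=> mf; exact: (measurableT_comp (measurable_rV_coord i) mf). Qed.

Lemma measurable_forall_ord (P : T -> 'I_n -> bool) :
  (forall i, measurable_fun setT (P ^~ i)) ->
  measurable_fun setT (fun t => [forall i, P t i]).
Proof.
move=> mP; apply: (@measurable_fun_bool _ _ _ _ true); rewrite setTI.
rewrite (_ : _ @^-1` _ = \bigcap_(i in [set: 'I_n]) ((P ^~ i) @^-1` [set true])).
  apply: fin_bigcap_measurable => // i _.
  by rewrite -[X in measurable X]setTI; exact: mP.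
by apply/seteqP; split => t /= => [/forallP tP i _|tP]; [exact: tP|
  apply/forallP => i; exact: tP].
Qed.

Lemma measurable_bool_set (P : T -> bool) :
  measurable_fun setT P -> measurable [set t | P t].
Proof.
by move=> mP; have := mP measurableT [set true] Logic.I; rewrite setTI.
Qed.

Lemma measurable_bool_natr (P : T -> bool) :
  measurable_fun setT P -> measurable_fun setT (fun t => (P t)%:R : R).
Proof.
move=> mP; rewrite (_ : (fun t => _) = \1_(P @^-1` [set true])).
  by apply: measurable_indic; rewrite -[X in measurable X]setTI; exact: mP.
by apply/funext => t; rewrite indicE; congr (nat_of_bool _)%:R;
  apply/idP/idP => [Pt|/set_mem//]; exact/mem_set.
Qed.

Lemma measurable_rV_lincomb (f g : T -> 'rV[R]_n) (h : T -> R) :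
  measurable_fun setT f -> measurable_fun setT g -> measurable_fun setT h ->
  measurable_fun setT (fun t => f t + h t *: g t).
Proof.
move=> mf mg mh; apply: measurable_fun_rVP => i.
under eq_fun do rewrite !mxE.
apply: measurable_funD; first exact: measurable_fun_coord.
by apply: measurable_funM => //; exact: measurable_fun_coord.
Qed.

Lemma measurable_rVD (f g : T -> 'rV[R]_n) :
  measurable_fun setT f -> measurable_fun setT g ->
  measurable_fun setT (fun t => f t + g t).
Proof.
move=> mf mg; apply: measurable_fun_rVP => i.
under eq_fun do rewrite !mxE.
by apply: measurable_funD; exact: measurable_fun_coord.
Qed.

Lemma measurable_rVB (f g : T -> 'rV[R]_n) :
  measurable_fun setT f -> measurable_fun setT g ->
  measurable_fun setT (fun t => f t - g t).
Proof.
move=> mf mg; apply: measurable_fun_rVP => i.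
under eq_fun do rewrite !mxE.
by apply: measurable_funB; exact: measurable_fun_coord.
Qed.

End measurability.

Section half_open_cube.
Context (R : realType).

Lemma lebesgue_half_open_cube n (a : 'rV[R]_n) (l : R) : 0 <= l ->
  lebesgue_rV n [set y | forall i, a 0 i <= y 0 i < a 0 i + l] = (l ^+ n)%:E.
Proof.
move=> l0; elim: n a => [|n IH] a.
  by rewrite /= diracE mem_set// => -[].
rewrite /= /lebesgue_rVS /pushforward.
have -> : @rV_cons R n @^-1` [set y : 'rV[R]_n.+1 | forall i, a 0 i <= y 0 i < a 0 i + l] =
    `[a 0 ord0, a 0 ord0 + l[ `*`
    [set y : 'rV[R]_n |
      forall i, (rV_uncons a).2 0 i <= y 0 i < (rV_uncons a).2 0 i + l].
  apply/seteqP; split => [p Hp|p [H0 HS] i] /=.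
    split => [|i]; last by rewrite mxE -rV_consES.
    by rewrite /= in_itv /= -(rV_consE0 p).
  have [j ->|->] := unliftP ord0 i.
    by rewrite rV_consES; move: (HS j); rewrite mxE.
  by rewrite rV_consE0; move: H0; rewrite /= in_itv.
rewrite product_measure1E//; last first.
  rewrite (_ : [set y : 'rV[R]_n | _] = \bigcap_(i in [set: 'I_n])
      (rV_coord i @^-1` `[(rV_uncons a).2 0 i, (rV_uncons a).2 0 i + l[)).
    apply: fin_bigcap_measurable => // i _; rewrite -[X in measurable X]setTI.
    exact: measurable_rV_coord.
  apply/seteqP; split => y yl i => [_|]; have := yl i; rewrite /= in_itv/=.
    exact.
  by move=> /(_ Logic.I).
rewrite IH// [X in (X * _)%E](lebesgue_measure_itv `[_, _[)/= lte_fin.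
case: ltP => [_|]; first by rewrite -EFinB addrAC subrr add0r -EFinM exprS.
rewrite gerDl => l0'; have -> : l = 0 by apply/eqP; rewrite eq_le l0 l0'.
by rewrite mul0e expr0n.
Qed.

(** Every open set is the union of the dyadic cubes of side 2^-k, with vertices
    in 2^-k Z^n, that it contains. *)
Lemma open_measurable_rV n (U : set 'rV[R]_n) : open U -> measurable U.
Proof.
move=> oU.
pose V (k : nat * 'rV[int]_n) : set 'rV[R]_n :=
  cube (\row_i ((k.2 0 i)%:~R / 2 ^+ k.1)) (2 ^- k.1).
rewrite (_ : U = \bigcup_(k : nat * 'rV[int]_n)
    (if `[< V k `<=` U >] then V k else set0)).
  apply: countable_bigcupT_measurable; first exact: countableP.
  by move=> k; case: ifP => // _; exact: measurable_cube.
apply/seteqP; split => x; last by move=> [k _]; case: ifPn => // /asboolP; exact.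
move=> Ux; have /nbhs_ballP[e /= e0 xeU] : nbhs x U by apply: open_nbhs_nbhs.
have [N Ne] : exists N : nat, 2 ^- N < e.
  have [N N0] := ltr_add_invr (y := 0) (x := e) e0.
  exists N; apply: le_lt_trans N0; rewrite add0r lef_pV2 ?posrE// -natrX ler_nat.
  exact: ltn_expl.
pose m : 'rV[int]_n := \row_i Num.floor (x 0 i * 2 ^+ N).
have p0 : (0 : R) < 2 ^+ N by rewrite exprn_gt0.
have Vx : V (N, m) x.
  move=> i; rewrite /= !mxE; have /andP[fl fu] := floor_itv (x 0 i * 2 ^+ N).
  rewrite ler_pdivrMr// fl/= -[X in _ <= _ + X]mul1r -mulrDl ler_pdivlMr//.
  by rewrite ltW// -[1]/(1%:~R) -intrD.
have VU : V (N, m) `<=` U.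
  move=> y Vy; apply: xeU; split => //= i j; rewrite (ord1 i).
  have := Vx j; have := Vy j; rewrite /V/= !mxE -ball_normE/= => yj xj.
  by apply: le_lt_trans Ne; rewrite ler_norml; lra.
by exists (N, m) => //; rewrite asboolT.
Qed.

Lemma continuous_measurable_rV n (f : 'rV[R]_n -> R) :
  continuous f -> measurable_fun setT f.
Proof.
move=> /continuousP cf mT; apply: (measurability _ (RGenOpens.measurableE R)) => //.
move=> _ [_ [a [b ->] <-]]; rewrite setTI.
by apply: open_measurable_rV; apply: cf; exact: interval_open.
Qed.

End half_open_cube.

(** * Dyadic cubes and their threefold enlargements *)

Section dyadic_index.
Context (R : realType).
Implicit Types (l s t : R).

Definition grid l t : int := Num.floor (t / l).

Lemma grid_itv l t : 0 < l ->
  l * (grid l t)%:~R <= t < l * (grid l t)%:~R + l.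
Proof.
move=> l0; have /andP[] := floor_itv (t / l); rewrite -/(grid l t).
rewrite ler_pdivlMr// ltr_pdivrMr// intrD mulrDl mul1r.
by rewrite ![_ * l]mulrC => -> ->.
Qed.

Lemma grid_ge l t (m : int) : 0 < l -> (m <= grid l t) = (l * m%:~R <= t).
Proof. by move=> l0; rewrite floor_ge_int ler_pdivlMr// mulrC. Qed.

Lemma grid_lt l t (m : int) : 0 < l -> (grid l t < m) = (t < l * m%:~R).
Proof. by move=> l0; rewrite ltNge grid_ge// -ltNge. Qed.

Lemma grid_double l t : 0 < l ->
  grid (2 * l) t * 2 <= grid l t < grid (2 * l) t * 2 + 2.
Proof.
move=> l0; have l20 : 0 < 2 * l by rewrite mulr_gt0.
rewrite grid_ge// grid_lt//; have := grid_itv t l20.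
by rewrite !intrD !intrM/=; lra.
Qed.

Lemma gridD l t (m : int) : 0 < l -> grid l (t + l * m%:~R) = grid l t + m.
Proof.
move=> l0; apply: floor_def; rewrite mulrDl mulrAC mulfV ?lt0r_neq0// mul1r.
by have := floor_itv (t / l); rewrite -/(grid l t) !intrD; lra.
Qed.

Lemma measurable_grid d (T : measurableType d) l (f : T -> R) : 0 < l ->
  measurable_fun setT f -> measurable_fun setT (fun x => (grid l (f x))%:~R : R).
Proof.
move=> l0 mf.
have mg : measurable_fun setT (fun t => (grid l t)%:~R : R).
  apply: nondecreasing_measurable => // s t st.
  by rewrite ler_int le_floor// ler_pM2r ?invr_gt0.
exact: (measurableT_comp mg mf).
Qed.

End dyadic_index.

Section cells.
Context (R : realType) (n : nat).
Implicit Types (x y z : 'rV[R]_n) (l : R).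

(** The dyadic cube of side [l] containing [x] is encoded by the equivalence
    relation [cell l x], its threefold enlargement by [ncell l x]; both
    relations are symmetric, so that they can be integrated in either
    variable. *)
Definition cell l x y : bool :=
  [forall i, grid l (x 0 i) == grid l (y 0 i)].

Definition ncell l x y : bool :=
  [forall i, `|grid l (x 0 i) - grid l (y 0 i)| <= 1].

Lemma cellP l x y :
  reflect (forall i, grid l (x 0 i) = grid l (y 0 i)) (cell l x y).
Proof. by apply: (iffP forallP) => xy i; exact/eqP. Qed.

Lemma ncellP l x y :
  reflect (forall i, `|grid l (x 0 i) - grid l (y 0 i)| <= 1) (ncell l x y).
Proof. exact: forallP. Qed.

Lemma cell_refl l x : cell l x x. Proof. exact/cellP. Qed.

Lemma cell_sym l x y : cell l x y = cell l y x.
Proof. by apply/cellP/cellP => xy i; rewrite xy. Qed.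

Lemma cell_trans l x y z : cell l x y -> cell l y z -> cell l x z.
Proof. by move=> /cellP xy /cellP yz; apply/cellP => i; rewrite xy. Qed.

Lemma cell_ncell l x y : cell l x y -> ncell l x y.
Proof. by move=> /cellP xy; apply/ncellP => i; rewrite xy subrr normr0. Qed.

Lemma ncell_refl l x : ncell l x x. Proof. exact/cell_ncell/cell_refl. Qed.

Lemma ncell_sym l x y : ncell l x y = ncell l y x.
Proof. by apply/ncellP/ncellP => xy i; rewrite distrC. Qed.

Lemma cell_eql l x y z : cell l x y -> cell l x z = cell l y z.
Proof.
move=> xy; apply/idP/idP; first by apply: cell_trans; rewrite cell_sym.
exact: cell_trans.
Qed.

Lemma ncell_eql l x y z : cell l x y -> ncell l x z = ncell l y z.
Proof. by move=> /cellP xy; apply/ncellP/ncellP => xz i; rewrite ?xy// -xy. Qed.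

Lemma cell_double l x y : 0 < l -> cell l x y -> cell (2 * l) x y.
Proof.
move=> l0 /cellP xy; apply/cellP => i; have := xy i.
have := grid_double (x 0 i) l0; have := grid_double (y 0 i) l0; lia.
Qed.

Lemma ncell_double l x y : 0 < l -> ncell l x y -> ncell (2 * l) x y.
Proof.
move=> l0 /ncellP xy; apply/ncellP => i; have := xy i.
have := grid_double (x 0 i) l0; have := grid_double (y 0 i) l0; lia.
Qed.

Let ler_distz1 (k m : int) :
  (`|k - m| <= 1) = (k%:~R <= m%:~R + 1 :> R) && (m%:~R <= k%:~R + 1 :> R).
Proof.
have e (p : int) : p%:~R + 1 = (p + 1)%:~R :> R by rewrite intrD.
by rewrite !e !ler_int; apply/idP/idP; lia.
Qed.

Lemma ncell_dist l x y i : 0 < l -> ncell l x y -> `|x 0 i - y 0 i| < 2 * l.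
Proof.
move=> l0 /ncellP/(_ i); rewrite ler_distz1.
have := grid_itv (x 0 i) l0; have := grid_itv (y 0 i) l0.
move: (_%:~R) (_%:~R) => u v xv yu uv.
by rewrite ltr_norml; apply/andP; split; nra.
Qed.

Lemma cell_dist l x y i : 0 < l -> cell l x y -> `|x 0 i - y 0 i| < l.
Proof.
move=> l0 /cellP/(_ i) xy.
have := grid_itv (x 0 i) l0; have := grid_itv (y 0 i) l0; rewrite xy.
by rewrite ltr_norml; lra.
Qed.

Lemma dist_ncell l x y : 0 < l -> (forall i, `|x 0 i - y 0 i| <= l) ->
  ncell l x y.
Proof.
move=> l0 xy; apply/ncellP => i; have := xy i.
have /andP[y1 y2] := grid_itv (y 0 i) l0; have /andP[x1 x2] := grid_itv (x 0 i) l0.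
rewrite ler_norml => xyi.
have H (k m : int) : l * (k%:~R - m%:~R) < l * 2 -> k <= m + 1.
  by rewrite ltr_pM2l// -intrB -[2]/(2%:~R) ltr_int; lia.
have h1 : grid l (x 0 i) <= grid l (y 0 i) + 1 by apply: H; lra.
have h2 : grid l (y 0 i) <= grid l (x 0 i) + 1 by apply: H; lra.
by move: h1 h2; lia.
Qed.

Lemma cellE l x : 0 < l -> [set y | cell l x y] = [set y : 'rV[R]_n | forall i,
  (\row_j (l * (grid l (x 0 j))%:~R)) 0 i <= y 0 i <
  (\row_j (l * (grid l (x 0 j))%:~R)) 0 i + l].
Proof.
move=> l0; apply/seteqP; split => y /=.
  by move=> /cellP xy i; rewrite mxE xy grid_itv.
move=> xy; apply/cellP => i; have := xy i; rewrite mxE => /andP[xi yi].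
apply/eqP; rewrite eq_le; apply/andP; split; first by rewrite grid_ge.
by rewrite -ltzD1 grid_lt// intrD mulrDr mulr1.
Qed.

Lemma cell_cube l x y : 0 < l -> cell l x y ->
  cube (\row_j (l * (grid l (x 0 j))%:~R)) l y.
Proof.
move=> l0 xy i; have : [set z | cell l x z] y by [].
by rewrite cellE// => /(_ i)/andP[-> /ltW].
Qed.

Lemma ncell_cube l x y : 0 < l -> ncell l x y ->
  cube (\row_j (l * (grid l (x 0 j) - 1)%:~R)) (3 * l) y.
Proof.
move=> l0 /ncellP xy i; have := xy i; rewrite ler_distz1 mxE.
have := grid_itv (y 0 i) l0; rewrite rmorphB/=.
by move: (_%:~R) (_%:~R) => u v yu uv; apply/andP; split; nra.
Qed.

Lemma measurable_cell l d (T : measurableType d) (f g : T -> 'rV[R]_n) : 0 < l ->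
  measurable_fun setT f -> measurable_fun setT g ->
  measurable_fun setT (fun t => cell l (f t) (g t)).
Proof.
move=> l0 mf mg; apply: measurable_forall_ord => i /=.
under eq_fun do rewrite -(eqr_int R).
by apply: measurable_fun_eqr; apply: measurable_grid => //;
  exact: measurable_fun_coord.
Qed.

Lemma measurable_ncell l d (T : measurableType d) (f g : T -> 'rV[R]_n) : 0 < l ->
  measurable_fun setT f -> measurable_fun setT g ->
  measurable_fun setT (fun t => ncell l (f t) (g t)).
Proof.
move=> l0 mf mg; apply: measurable_forall_ord => i /=.
under eq_fun do rewrite ler_distz1.
by apply: measurable_and; apply: measurable_fun_ler;
  do ?apply: measurable_funD => //; apply: measurable_grid => //;
  exact: measurable_fun_coord.
Qed.

(** The threefold enlargement is the union of 3^n cubes; its neighbours are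
    indexed by the displacements with entries -1, 0 and 1, encoded as ternary
    digits minus one. *)
Definition displacement (k : {ffun 'I_n -> 'I_3}) : 'rV[R]_n :=
  map_mx intr (\row_i ((k i : nat)%:Z - 1)).

Lemma ncell_displacement l x y : 0 < l -> ncell l x y ->
  exists k, cell l (x + l *: displacement k) y.
Proof.
move=> l0 /ncellP xy.
pose k := [ffun i => inord `|grid l (y 0 i) - grid l (x 0 i) + 1| : 'I_3].
exists k; apply/cellP => i; rewrite !mxE gridD// ffunE inordK.
  have := xy i; move: (grid _ _) (grid _ _) => a b ab.
  by rewrite abszE ger0_norm; lia.
by have := xy i; lia.
Qed.

Lemma displacement_ncell l x y k : 0 < l -> cell l (x + l *: displacement k) y ->
  ncell l x y.
Proof.
move=> l0 /cellP xy; apply/ncellP => i; have := xy i; rewrite !mxE gridD//.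
move: (grid _ _) (grid _ _) (ltn_ord (k i)) => a b.
by case: (k i) => -[|[|[|]]]//= _; lia.
Qed.

Lemma natr_ncell_le_sum l x y : 0 < l ->
  (ncell l x y)%:R <= \sum_k (cell l (x + l *: displacement k) y)%:R :> R.
Proof.
move=> l0; have [xy|_] := boolP (ncell l x y); last by apply: sumr_ge0.
have [k ky] := ncell_displacement l0 xy.
by rewrite (bigD1 k)//= ky lerDl sumr_ge0.
Qed.

Local Notation leb := (lebesgue_rV n).

Lemma lebesgue_cell l x : 0 < l -> leb [set y | cell l x y] = (l ^+ n)%:E.
Proof. by move=> l0; rewrite cellE// lebesgue_half_open_cube// ltW. Qed.

Lemma integral_cell l x : 0 < l ->
  (\int[leb]_y (cell l x y)%:R%:E = (l ^+ n)%:E)%E.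
Proof.
move=> l0; rewrite -(lebesgue_cell x l0) -[in RHS](setIT [set y | _]).
rewrite -integral_indic//; last first.
  by apply: measurable_bool_set; apply: (@measurable_cell l _ _ (fun=> x) id).
apply: eq_integral => y _; rewrite indicE; congr (nat_of_bool _)%:R%:E.
by apply/idP/idP => [/mem_set//|/set_mem].
Qed.

Lemma card_displacement : #|{ffun 'I_n -> 'I_3}| = (3 ^ n)%N.
Proof. by rewrite card_ffun !card_ord. Qed.

Lemma integral_ncell_le l x : 0 < l ->
  (\int[leb]_y (ncell l x y)%:R%:E <= (3 ^+ n * l ^+ n)%:E)%E.
Proof.
move=> l0; apply: le_trans (_ : \int[leb]_y
  (\sum_k (cell l (x + l *: displacement k) y)%:R%:E) <= _)%E.
  apply: le_lower_integral => y; first by rewrite lee_fin.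
  by rewrite sumEFin lee_fin natr_ncell_le_sum.
rewrite ge0_integral_sum//.
  under eq_bigr do rewrite integral_cell//.
  by rewrite sumEFin lee_fin sumr_const card_displacement -[leLHS]mulr_natl natrX.
move=> k; apply/measurable_EFinP; apply: measurable_bool_natr.
by apply: (@measurable_cell l _ _ (fun=> _) id).
Qed.

End cells.

(** * Averages over dyadic cubes *)

Section averages.
Context (R : realType) (n : nat).
Local Notation leb := (lebesgue_rV n).
Implicit Types (g h : 'rV[R]_n -> R) (x y z : 'rV[R]_n) (l L : R).

Definition bounded_nonneg g :=
  measurable_fun setT g /\ exists B, forall x, 0 <= g x <= B.

(** [K] is one of the relations [cell l] and [ncell l]; in both cases the
    integral is divided by the volume [l ^+ n] of a single dyadic cube. *)
Definition kavg (K : R -> 'rV[R]_n -> 'rV[R]_n -> bool) l g x : R :=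
  fine ((l ^+ n)^-1%:E * \int[leb]_y ((K l x y)%:R * g y)%:E)%E.

Definition cavg := kavg (@cell R n).
Definition navg := kavg (@ncell R n).

Section kernel.
Context (K : R -> 'rV[R]_n -> 'rV[R]_n -> bool) (c : R).
Hypothesis mK : forall l d (T : measurableType d) (f g : T -> 'rV[R]_n), 0 < l ->
  measurable_fun setT f -> measurable_fun setT g ->
  measurable_fun setT (fun t => K l (f t) (g t)).
Hypothesis intK : forall l x, 0 < l ->
  (\int[leb]_y (K l x y)%:R%:E <= (c * l ^+ n)%:E)%E.

Lemma measurable_kernel_mul l g x : 0 < l -> measurable_fun setT g ->
  measurable_fun setT (fun y => (K l x y)%:R * g y).
Proof.
move=> l0 mg; apply: measurable_funM => //; apply: measurable_bool_natr.
exact: (@mK l _ _ (fun=> x) id).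
Qed.

Lemma kavg_bound l g x B : 0 < l -> measurable_fun setT g ->
  (forall x, 0 <= g x <= B) ->
  (0 <= (l ^+ n)^-1%:E * \int[leb]_y ((K l x y)%:R * g y)%:E <= (c * B)%:E)%E.
Proof.
move=> l0 mg gB; have ln0 : 0 < l ^+ n by rewrite exprn_gt0.
have B0 : 0 <= B by have /andP[/le_trans] := gB x; apply.
apply/andP; split.
  rewrite mule_ge0 ?lee_fin ?invr_ge0 ?(ltW ln0)// integral_ge0// => y _.
  by rewrite lee_fin mulr_ge0//; have /andP[] := gB y.
apply: le_trans (_ : ((l ^+ n)^-1%:E * \int[leb]_y (B%:E * (K l x y)%:R%:E))%E <= _)%E.
  rewrite lee_pmul2l ?lte_fin ?invr_gt0//; apply: le_lower_integral => y.
    by rewrite lee_fin mulr_ge0//; have /andP[] := gB y.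
  rewrite -EFinM lee_fin mulrC ler_wpM2r//; by have /andP[] := gB y.
rewrite ge0_integralZl ?lee_fin//; last first.
  by apply/measurable_EFinP/measurable_bool_natr; exact: (@mK l _ _ (fun=> x) id).
rewrite muleCA mulrC EFinM; apply: lee_wpmul2l; first by rewrite lee_fin.
rewrite muleC lee_pdivrMr// -EFinM; exact: intK.
Qed.

Lemma kavgE l g x : 0 < l -> bounded_nonneg g ->
  ((l ^+ n)^-1%:E * \int[leb]_y ((K l x y)%:R * g y)%:E = (kavg K l g x)%:E)%E.
Proof.
move=> l0 [mg [B gB]]; have /andP[k0 kB] := kavg_bound x l0 mg gB.
by rewrite /kavg fineK// ge0_fin_numE// (le_lt_trans kB)// ltry.
Qed.

Lemma integral_kernelE l g x : 0 < l -> bounded_nonneg g ->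
  (\int[leb]_y ((K l x y)%:R * g y)%:E = (l ^+ n * kavg K l g x)%:E)%E.
Proof.
move=> l0 bg; rewrite EFinM -kavgE// muleA -EFinM mulfV ?mul1e//.
by rewrite lt0r_neq0// exprn_gt0.
Qed.

Lemma kavg_ge0 l g x : 0 < l -> bounded_nonneg g -> 0 <= kavg K l g x.
Proof.
move=> l0 bg; have [mg [B gB]] := bg; rewrite -lee_fin -kavgE//.
by have /andP[] := kavg_bound x l0 mg gB.
Qed.

Lemma kavg_le l g B x : 0 < l -> measurable_fun setT g ->
  (forall x, 0 <= g x <= B) -> kavg K l g x <= c * B.
Proof.
move=> l0 mg gB; rewrite -lee_fin -kavgE//; last by split => //; exists B.
by have /andP[] := kavg_bound x l0 mg gB.
Qed.

Lemma measurable_kavg l g : 0 < l -> bounded_nonneg g ->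
  measurable_fun setT (kavg K l g).
Proof.
move=> l0 bg; apply: (measurableT_comp (f := fine)) => //.
apply: emeasurable_funM => //.
apply: (@measurable_fun_fubini_tonelli_F _ _ 'rV[R]_n 'rV[R]_n R leb
  (fun p => ((K l p.1 p.2)%:R * g p.2)%:E)) => [|p].
  apply/measurable_EFinP; apply: measurable_funM.
    by apply: measurable_bool_natr; exact: (@mK l _ _ fst snd).
  by apply: (measurableT_comp bg.1).
by rewrite lee_fin mulr_ge0//; have [_ [B /(_ p.2)/andP[]]] := bg.
Qed.

End kernel.

Let mcell := @measurable_cell R n.
Let mncell := @measurable_ncell R n.
Let intcell l x : 0 < l ->
  (\int[leb]_y (cell l x y)%:R%:E <= (1 * l ^+ n)%:E)%E.
Proof. by move=> l0; rewrite integral_cell// mul1r. Qed.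
Let intncell := @integral_ncell_le R n.
Lemma integral_cellE l g x : 0 < l -> bounded_nonneg g ->
  (\int[leb]_y ((cell l x y)%:R * g y)%:E = (l ^+ n * cavg l g x)%:E)%E.
Proof. by move=> *; apply: (integral_kernelE mcell intcell). Qed.

Lemma integral_ncellE l g x : 0 < l -> bounded_nonneg g ->
  (\int[leb]_y ((ncell l x y)%:R * g y)%:E = (l ^+ n * navg l g x)%:E)%E.
Proof. by move=> *; apply: (integral_kernelE mncell intncell). Qed.

Lemma cavgE l g x : 0 < l -> bounded_nonneg g ->
  ((l ^+ n)^-1%:E * \int[leb]_y ((cell l x y)%:R * g y)%:E = (cavg l g x)%:E)%E.
Proof. by move=> *; apply: (kavgE mcell intcell). Qed.

Lemma cavg_ge0 l g x : 0 < l -> bounded_nonneg g -> 0 <= cavg l g x.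
Proof. by move=> *; apply: (kavg_ge0 mcell intcell). Qed.

Lemma navg_ge0 l g x : 0 < l -> bounded_nonneg g -> 0 <= navg l g x.
Proof. by move=> *; apply: (kavg_ge0 mncell intncell). Qed.

Lemma measurable_cavg l g : 0 < l -> bounded_nonneg g ->
  measurable_fun setT (cavg l g).
Proof. by move=> *; apply: (measurable_kavg mcell). Qed.

Lemma measurable_navg l g : 0 < l -> bounded_nonneg g ->
  measurable_fun setT (navg l g).
Proof. by move=> *; apply: (measurable_kavg mncell). Qed.

Lemma navg_le l g B x : 0 < l -> measurable_fun setT g ->
  (forall x, 0 <= g x <= B) -> navg l g x <= 3 ^+ n * B.
Proof. by move=> *; apply: (kavg_le mncell intncell). Qed.

Lemma cavg_le l g B x : 0 < l -> measurable_fun setT g ->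
  (forall x, 0 <= g x <= B) -> cavg l g x <= B.
Proof. by move=> l0 mg gB; rewrite -[B]mul1r; exact: (kavg_le mcell intcell). Qed.

Lemma cavg_eql l g x y : cell l x y -> cavg l g x = cavg l g y.
Proof.
move=> xy; rewrite /cavg /kavg; congr (fine (_ * _)%E).
by apply: eq_integral => z _; rewrite (cell_eql _ xy).
Qed.

Lemma navg_eql l g x y : cell l x y -> navg l g x = navg l g y.
Proof.
move=> xy; rewrite /navg /kavg; congr (fine (_ * _)%E).
by apply: eq_integral => z _; rewrite (ncell_eql _ xy).
Qed.

(** The defining property of the conditional expectation on the dyadic cubes of
    side [l], by exchanging the order of integration. *)
Lemma integral_cell_average l (F w : 'rV[R]_n -> \bar R) : 0 < l ->
  measurable_fun setT F -> measurable_fun setT w ->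
  (forall x, 0 <= F x)%E -> (forall x, 0 <= w x)%E ->
  (forall x y, cell l x y -> F x = F y) ->
  (\int[leb]_x (F x * w x) =
   \int[leb]_x (F x * ((l ^+ n)^-1%:E * \int[leb]_y ((cell l x y)%:R%:E * w y))))%E.
Proof.
move=> l0 mF mw F0 w0 Fcell; have ln0 : 0 < (l ^+ n)^-1 by rewrite invr_gt0 exprn_gt0.
have mc d (T : measurableType d) (f g : T -> 'rV[R]_n) :
    measurable_fun setT f -> measurable_fun setT g ->
    measurable_fun setT (fun t => (cell l (f t) (g t))%:R%:E : \bar R).
  by move=> mf mg; apply/measurable_EFinP/measurable_bool_natr; exact: mcell.
pose f (p : 'rV[R]_n * 'rV[R]_n) : \bar R :=
  (F p.1 * ((l ^+ n)^-1%:E * ((cell l p.1 p.2)%:R%:E * w p.2)))%E.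
have mf : measurable_fun setT f.
  apply: emeasurable_funM; first exact: (measurableT_comp mF).
  apply: emeasurable_funM => //; apply: emeasurable_funM.
    exact: mc.
  exact: (measurableT_comp mw).
have f0 p : (0 <= f p)%E by rewrite !mule_ge0// lee_fin ltW.
transitivity (\int[leb]_x \int[leb]_y f (x, y))%E; last first.
  apply: eq_integral => x _; rewrite /f/=.
  have mx : measurable_fun setT (fun y => ((cell l x y)%:R%:E * w y)%E).
    by apply: emeasurable_funM => //; exact: (mc _ _ (fun=> x) id).
  rewrite ge0_integralZl//.
  - by rewrite ge0_integralZl ?lee_fin ?ltW// => y _; rewrite mule_ge0.
  - by apply: emeasurable_funM.
  - by move=> y _; rewrite !mule_ge0// lee_fin ltW.
rewrite (@fubini_tonelli _ _ _ _ _ leb leb f mf f0).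
apply: eq_integral => y _; rewrite /f/=.
transitivity (\int[leb]_x ((F y * w y * (l ^+ n)^-1%:E) * (cell l y x)%:R%:E))%E; last first.
  apply: eq_integral => x _; rewrite cell_sym.
  have [xy|_] := boolP (cell l x y); last by rewrite mul0e !mule0.
  by rewrite mule1 mul1e (Fcell _ _ xy) muleA muleAC.
rewrite ge0_integralZl//.
- by rewrite integral_cell// -muleA -EFinM mulVf ?mule1// lt0r_neq0// exprn_gt0.
- exact: (mc _ _ (fun=> y) id).
- by rewrite !mule_ge0// lee_fin ltW.
Qed.

(** Replacing a function by its averages does not change its integral against
    [F], so that estimates on the single cubes can be integrated. *)
Lemma le_integral_cell l C (F w w' : 'rV[R]_n -> \bar R) : 0 < l -> 0 <= C ->
  measurable_fun setT F -> measurable_fun setT w -> measurable_fun setT w' ->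
  (forall x, 0 <= F x)%E -> (forall x, 0 <= w x)%E -> (forall x, 0 <= w' x)%E ->
  (forall x y, cell l x y -> F x = F y) ->
  (forall x, \int[leb]_y ((cell l x y)%:R%:E * w y) <=
     C%:E * \int[leb]_y ((cell l x y)%:R%:E * w' y))%E ->
  (\int[leb]_x (F x * w x) <= C%:E * \int[leb]_x (F x * w' x))%E.
Proof.
move=> l0 C0 mF mw mw' F0 w0 w'0 Fcell ww'.
have ln0 : 0 < (l ^+ n)^-1 by rewrite invr_gt0 exprn_gt0.
have mCw : measurable_fun setT (fun x => C%:E * w' x)%E.
  exact: emeasurable_funM.
have Cw0 x : (0 <= C%:E * w' x)%E by rewrite mule_ge0.
have -> : (C%:E * \int[leb]_x (F x * w' x) = \int[leb]_x (F x * (C%:E * w' x)))%E.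
  rewrite -ge0_integralZl//; first by apply: eq_integral => x _; rewrite muleCA.
  - exact: emeasurable_funM.
  - by move=> x _; rewrite mule_ge0.
have -> := @integral_cell_average l F w l0 mF mw F0 w0 Fcell.
have -> := @integral_cell_average l F _ l0 mF mCw F0 Cw0 Fcell.
apply: le_lower_integral => x.
  rewrite mule_ge0// mule_ge0// ?lee_fin ?(ltW ln0)// integral_ge0// => y _.
  by rewrite mule_ge0.
rewrite lee_wpmul2l// lee_wpmul2l// ?lee_fin ?(ltW ln0)//.
apply: le_trans (ww' x) _; rewrite -ge0_integralZl//.
- by apply: le_lower_integral => y; rewrite ?mule_ge0// muleCA.
- apply: emeasurable_funM => //; apply/measurable_EFinP/measurable_bool_natr.
  exact: (@mcell l _ _ (fun=> x) id).
- by move=> y _; rewrite mule_ge0.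
Qed.

Lemma nn_le_integral_cell l C (F w w' : 'rV[R]_n -> R) : 0 < l -> 0 <= C ->
  measurable_fun setT F -> measurable_fun setT w -> measurable_fun setT w' ->
  (forall x, 0 <= F x) -> (forall x, 0 <= w x) -> (forall x, 0 <= w' x) ->
  (forall x y, cell l x y -> F x = F y) ->
  (forall x, \int[leb]_y ((cell l x y)%:R * w y)%:E <=
     C%:E * \int[leb]_y ((cell l x y)%:R * w' y)%:E)%E ->
  (\int[leb]_x (F x * w x)%:E <= C%:E * \int[leb]_x (F x * w' x)%:E)%E.
Proof.
move=> l0 C0 mF mw mw' F0 w0 w'0 Fcell ww'.
have E (u v : 'rV[R]_n -> R) : (\int[leb]_x (u x * v x)%:E =
    \int[leb]_x ((EFin \o u) x * (EFin \o v) x))%E.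
  by apply: eq_integral => x _; rewrite EFinM.
rewrite !E; apply: (le_integral_cell l0 C0).
- exact/measurable_EFinP.
- exact/measurable_EFinP.
- exact/measurable_EFinP.
- by move=> x; rewrite lee_fin.
- by move=> x; rewrite lee_fin.
- by move=> x; rewrite lee_fin.
- by move=> x y xy; rewrite /= (Fcell _ _ xy).
- by move=> x; have := ww' x; rewrite !E.
Qed.

Lemma integral_cavg_mul l (F g : 'rV[R]_n -> R) : 0 < l ->
  measurable_fun setT F -> (forall x, 0 <= F x) -> bounded_nonneg g ->
  (forall x y, cell l x y -> F x = F y) ->
  (\int[leb]_x (F x * cavg l g x)%:E = \int[leb]_x (F x * g x)%:E)%E.
Proof.
move=> l0 mF F0 bg Fcell; have [mg [B gB]] := bg; apply/esym.
rewrite (@integral_cell_average l (EFin \o F) (EFin \o g))//=.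
- apply: eq_integral => x _; rewrite EFinM -cavgE//.
- exact/measurable_EFinP.
- exact/measurable_EFinP.
- by move=> x; rewrite lee_fin; have /andP[] := gB x.
- by move=> x y /Fcell ->.
Qed.

End averages.

Section dyadic_scales.
Context (R : realType).

Definition scale (L : R) (i : nat) : R := L / 2 ^+ i.

Lemma scale_gt0 L i : 0 < L -> 0 < scale L i.
Proof. by move=> L0; rewrite divr_gt0// exprn_gt0. Qed.

Lemma scale0 L : scale L 0 = L.
Proof. by rewrite /scale expr0 divr1. Qed.

Lemma scaleS L i : 2 * scale L i.+1 = scale L i.
Proof. by rewrite /scale exprS; field; rewrite expf_neq0. Qed.

Lemma cell_scale n L i j (x y : 'rV[R]_n) : 0 < L -> (i <= j)%N ->
  cell (scale L j) x y -> cell (scale L i) x y.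
Proof.
move=> L0 /subnK <-; elim: (j - i)%N => // k IH xy; apply: IH.
by rewrite -scaleS; apply: cell_double => //; exact: scale_gt0.
Qed.

Lemma ncell_scale n L i j (x y : 'rV[R]_n) : 0 < L -> (i <= j)%N ->
  ncell (scale L j) x y -> ncell (scale L i) x y.
Proof.
move=> L0 /subnK <-; elim: (j - i)%N => // k IH xy; apply: IH.
by rewrite -scaleS; apply: ncell_double => //; exact: scale_gt0.
Qed.

End dyadic_scales.

(** * The dyadic maximal function *)

Lemma absorb_half (R : realType) (X Y : \bar R) : (0 <= X)%E -> (0 <= Y)%E ->
  (X < +oo)%E -> (X <= 2^-1%:E * X + Y)%E -> (X <= 2%:E * Y)%E.
Proof.
case: X => [x| |]//; case: Y => [y| |]// x0 y0 _; last first.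
  by rewrite mulry gtr0_sg// mul1e leey.
by rewrite -EFinM -EFinD -EFinM !lee_fin; lra.
Qed.

Section doob.
Context (R : realType) (n : nat) (L : R) (g : 'rV[R]_n -> R).
Hypotheses (L0 : 0 < L) (bg : bounded_nonneg g).
Local Notation leb := (lebesgue_rV n).
Local Notation v := (fun i => cavg (scale L i) g).

Fixpoint dyadic_max (J : nat) (x : 'rV[R]_n) : R :=
  if J is j.+1 then Num.max (dyadic_max j x) (v j.+1 x) else v 0 x.

Let v0 i x : 0 <= v i x. Proof. by apply: cavg_ge0 => //; exact: scale_gt0. Qed.

Lemma le_dyadic_max i J x : (i <= J)%N -> v i x <= dyadic_max J x.
Proof.
elim: J => [|J IH]; first by rewrite leqn0 => /eqP ->.
rewrite leq_eqVlt => /orP[/eqP ->|]; first by rewrite /= le_max lexx orbT.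
by rewrite ltnS => /IH viM; rewrite /= le_max viM.
Qed.

Lemma dyadic_max_ge0 J x : 0 <= dyadic_max J x.
Proof. exact: le_trans (v0 0 x) (le_dyadic_max x (leq0n J)). Qed.

Lemma measurable_dyadic_max J : measurable_fun setT (dyadic_max J).
Proof.
elim: J => [|J IH] /=; first by apply: measurable_cavg => //; exact: scale_gt0.
apply: measurable_maxr => //; apply: measurable_cavg => //; exact: scale_gt0.
Qed.

Lemma dyadic_max_eql J x y : cell (scale L J) x y -> dyadic_max J x = dyadic_max J y.
Proof.
elim: J => [|J IH] xy /=; first exact: cavg_eql.
by rewrite (cavg_eql _ xy) IH//; exact: cell_scale xy.
Qed.

Lemma dyadic_max_le J x B : (forall x, 0 <= g x <= B) -> dyadic_max J x <= B.
Proof.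
move=> gB; have vB i : v i x <= B by apply: cavg_le gB => //; [exact: scale_gt0|exact: bg.1].
by elim: J => //= J IH; rewrite ge_max IH vB.
Qed.

Variables q q' : R.
Hypotheses (q1 : 1 < q) (qq' : q' * (q - 1) = q).

Let q0 : 0 < q. Proof. exact: lt_trans q1. Qed.
Let q10 : 0 < q - 1. Proof. by rewrite subr_gt0. Qed.
Let q'1 : 1 < q'. Proof. by rewrite -(ltr_pM2r q10) qq' mul1r gtrBl. Qed.
Let q'0 : 0 < q'. Proof. exact: lt_trans q'1. Qed.
Let q'E : q' = q / (q - 1).
Proof. by apply: (canRL (mulfK _)) qq'; rewrite gt_eqF. Qed.
Let conj_qq' : q^-1 + q'^-1 = 1.
Proof.
by rewrite q'E; field; rewrite !gt_eqF.
Qed.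

Let mulr_powR_pred (c : R) : 0 <= c -> c * c `^ (q - 1) = c `^ q.
Proof.
move=> c0; rewrite -{1}[c]powRr1// -powRD; last by rewrite addrC subrK gt_eqF.
by rewrite addrC subrK.
Qed.

(** Young's inequality in the form that makes the increments of the [q]-th power
    of the maximal function telescope. *)
Let powR_increment (a b : R) : 0 <= b <= a ->
  a `^ q - b `^ q <= q' * (a * (a `^ (q - 1) - b `^ (q - 1))).
Proof.
move=> /andP[b0 ba]; have a0 := le_trans b0 ba.
have : a * b `^ (q - 1) <= a `^ q / q + (b `^ (q - 1)) `^ q' / q'.
  by apply: conjugate_powR => //; exact: powR_ge0.
rewrite -powRrM [(q - 1) * q']mulrC qq'.
rewrite mulrBr mulr_powR_pred// => Y.
have := ler_wpM2l (ltW q'0) Y.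
rewrite mulrDr [q' * (b `^ q / q')]mulrCA mulfV ?lt0r_neq0// mulr1.
have -> : q' * (a `^ q / q) = q' * a `^ q - a `^ q.
  by rewrite q'E; field; rewrite !gt_eqF.
by rewrite mulrBr; lra.
Qed.

(** The maximal function increases between consecutive scales only where it
    equals the new average, which may then be replaced by [g] because the
    increment is constant on the new cubes. *)
Let doob_step J : (\int[leb]_x (dyadic_max J x `^ q)%:E <=
  q'%:E * \int[leb]_x (g x * dyadic_max J x `^ (q - 1))%:E)%E.
Proof.
have q'0' := ltW q'0.
have g0 x : 0 <= g x by have [_ [B /(_ x)/andP[]]] := bg.
have mM j : measurable_fun setT (dyadic_max j) by exact: measurable_dyadic_max.
have mP r j : measurable_fun setT (fun x => dyadic_max j x `^ r).
  by apply: (measurableT_comp (measurable_powR _)).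
have mv i : measurable_fun setT (v i).
  by apply: measurable_cavg => //; exact: scale_gt0.
elim: J => [|J IH].
  under [in leRHS]eq_integral do rewrite mulrC.
  have <- := @integral_cavg_mul _ _ _ (fun x => dyadic_max 0 x `^ (q - 1)) g
    (scale_gt0 0 L0) (mP _ _) (fun=> powR_ge0 _ _) bg
    (fun x y xy => congr1 (@powR R ^~ _) (dyadic_max_eql xy)).
  rewrite -nn_integralZl//; [|exact: measurable_funM|by move=> x; rewrite mulr_ge0// powR_ge0].
  apply: nn_integral_le => x; first exact: powR_ge0.
  rewrite /= [X in _ * X]mulrC mulr_powR_pred//.
  by rewrite ler_peMl ?powR_ge0// ltW.
pose D x := dyadic_max J.+1 x `^ (q - 1) - dyadic_max J x `^ (q - 1).
have MM x : dyadic_max J x <= dyadic_max J.+1 x by rewrite /= le_max lexx.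
have D0 x : 0 <= D x.
  by rewrite subr_ge0 ge0_ler_powR// ?nnegrE ?dyadic_max_ge0// ltW.
have mD : measurable_fun setT D by apply: measurable_funB.
apply: le_trans (_ : (\int[leb]_x (dyadic_max J x `^ q)%:E +
    q'%:E * \int[leb]_x (D x * v J.+1 x)%:E <= _))%E.
  rewrite -nn_integralZl//; [|exact: measurable_funM|by move=> x; rewrite mulr_ge0].
  rewrite -nn_integralD//; last 3 first.
  - by do 2 apply: measurable_funM => //.
  - by move=> x; exact: powR_ge0.
  - by move=> x; rewrite mulr_ge0// mulr_ge0.
  apply: nn_integral_le => x; first exact: powR_ge0.
  rewrite -lerBlDl.
  have [Mv|vM] := leP (dyadic_max J x) (v J.+1 x).
    have := @powR_increment (dyadic_max J.+1 x) (dyadic_max J x).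
    rewrite dyadic_max_ge0 MM => /(_ isT)/le_trans; apply.
    by rewrite /D /= (max_idPr Mv) [X in _ * X]mulrC.
  rewrite /D /= (max_idPl (ltW vM)) !subrr mul0r mulr0//.
have Dcell x y : cell (scale L J.+1) x y -> D x = D y.
  move=> xy; rewrite /D (dyadic_max_eql xy) (@dyadic_max_eql J x y)//.
  exact: cell_scale xy.
have -> := @integral_cavg_mul _ _ _ D g (scale_gt0 J.+1 L0) mD D0 bg Dcell.
apply: le_trans (leeD2r _ IH) _.
rewrite -ge0_muleDr; last 2 first.
- by apply: nn_integral_ge0 => x; rewrite mulr_ge0// powR_ge0.
- by apply: nn_integral_ge0 => x; rewrite mulr_ge0.
rewrite lee_wpmul2l ?lee_fin// -nn_integralD//.
- apply: nn_integral_le => x; first by rewrite addr_ge0 ?mulr_ge0// powR_ge0.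
  by rewrite [D x * _]mulrC -mulrDr /D addrC subrK.
- by apply: measurable_funM => //; exact: bg.1.
- by apply: measurable_funM => //; exact: bg.1.
- by move=> x; rewrite mulr_ge0// powR_ge0.
- by move=> x; rewrite mulr_ge0.
Qed.

(** Doob's maximal inequality: in [doob_step] the factor [g] is either much
    smaller than the maximal function, and that part is absorbed, or comparable
    to it. *)
Lemma doob_maximal J : (\int[leb]_x (dyadic_max J x `^ q)%:E < +oo)%E ->
  (\int[leb]_x (dyadic_max J x `^ q)%:E <=
   (2 * (q' * (2 * q') `^ (q - 1)))%:E * \int[leb]_x (g x `^ q)%:E)%E.
Proof.
move=> Moo; have g0 x : 0 <= g x by have [_ [B /(_ x)/andP[]]] := bg.
have mP r : measurable_fun setT (fun x => dyadic_max J x `^ r).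
  by apply: (measurableT_comp (measurable_powR _)); exact: measurable_dyadic_max.
have mg : measurable_fun setT (fun x => g x `^ q).
  by apply: (measurableT_comp (measurable_powR _)); exact: bg.1.
pose k := 2 * q'; have k0 : 0 < k by rewrite mulr_gt0.
have H x : g x * dyadic_max J x `^ (q - 1) <=
    k^-1 * dyadic_max J x `^ q + k `^ (q - 1) * g x `^ q.
  have M0 := dyadic_max_ge0 J x.
  have [gM|Mg] := leP (k * g x) (dyadic_max J x).
    apply: ler_wpDr; first by rewrite mulr_ge0// powR_ge0.
    by rewrite -mulr_powR_pred// mulrA ler_wpM2r ?powR_ge0// ler_pdivlMl.
  apply: ler_wpDl; first by rewrite mulr_ge0 ?invr_ge0 ?powR_ge0// ltW.
  rewrite -(mulr_powR_pred (g0 x)) mulrCA ler_wpM2l// -powRM ?(ltW k0)//.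
  by apply: ge0_ler_powR; rewrite ?nnegrE ?mulr_ge0 ?(ltW k0)// ltW.
rewrite EFinM -muleA; apply: absorb_half => //.
- by apply: nn_integral_ge0 => x; exact: powR_ge0.
- rewrite mule_ge0// ?lee_fin ?mulr_ge0 ?powR_ge0// ?(ltW q'0)//.
  by apply: nn_integral_ge0 => x; exact: powR_ge0.
apply: le_trans (doob_step J) _.
have mgM : measurable_fun setT (fun x => g x * dyadic_max J x `^ (q - 1)).
  by apply: measurable_funM => //; exact: bg.1.
rewrite -nn_integralZl ?(ltW q'0)//; last by move=> x; rewrite mulr_ge0// powR_ge0.
have c0 : 0 <= q' * k `^ (q - 1) by rewrite mulr_ge0 ?powR_ge0// ltW.
rewrite -!nn_integralZl//; try by move=> x; exact: powR_ge0.
rewrite -nn_integralD//; try by move=> x; rewrite mulr_ge0// powR_ge0.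
- apply: nn_integral_le => x; first by rewrite mulr_ge0 ?(ltW q'0)// mulr_ge0// powR_ge0.
  have := ler_wpM2l (ltW q'0) (H x); rewrite mulrDr !mulrA.
  by rewrite (_ : q' * k^-1 = 2^-1)// /k; field; rewrite gt_eqF.
- exact: measurable_funM.
- exact: measurable_funM.
Qed.

End doob.

(** * Weak-type estimate on one dyadic cube *)

Lemma ler_term_sum (R : numDomainType) (I : finType) (i : I) (F : I -> R) :
  (forall i, 0 <= F i) -> F i <= \sum_i F i.
Proof. by move=> F0; rewrite (bigD1 i)//= lerDl sumr_ge0. Qed.

Section weak_type.
Context (R : realType) (n : nat) (L : R) (h : 'rV[R]_n -> R) (x0 : 'rV[R]_n).
Hypotheses (L0 : 0 < L) (bh : bounded_nonneg h).
Local Notation leb := (lebesgue_rV n).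
Local Notation l := (scale L).

Let h0 x : 0 <= h x. Proof. by have [_ [B /(_ x)/andP[]]] := bh. Qed.
Let l0 i : 0 < l i. Proof. exact: scale_gt0. Qed.

Let hloc x : R := (ncell L x0 x)%:R * h x.

Let bhloc : bounded_nonneg hloc.
Proof.
have [mh [B hB]] := bh; split.
  by apply: (@measurable_kernel_mul _ _ (@ncell R n) (@measurable_ncell R n)).
exists B => x; rewrite /hloc; have /andP[? ?] := hB x.
by case: ncell; rewrite ?mul1r ?hB// mul0r lexx (le_trans (h0 x)).
Qed.

Let hloc0 x : 0 <= hloc x. Proof. by have [_ [B /(_ x)/andP[]]] := bhloc. Qed.

Let U := navg L h x0.

Let U0 : 0 <= U. Proof. exact: navg_ge0. Qed.

Let int_hloc : (\int[leb]_x (hloc x)%:E = (L ^+ n * U)%:E)%E.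
Proof. exact: integral_ncellE. Qed.

Let navg_hloc i y : cell L x0 y -> navg (l i) h y = navg (l i) hloc y.
Proof.
move=> x0y; rewrite /navg /kavg; congr (fine (_ * _)%E).
apply: eq_integral => z _; rewrite /hloc; congr (_%:E).
have [yz|_] := boolP (ncell (l i) y z); last by rewrite !mul0r.
have := ncell_scale L0 (leq0n i) yz; rewrite scale0 -(ncell_eql _ x0y) => ->.
by rewrite !mul1r.
Qed.

Let navg_le_sum i y :
  navg (l i) hloc y <= \sum_k cavg (l i) hloc (y + l i *: displacement R k).
Proof.
have ln0 : 0 < l i ^+ n by rewrite exprn_gt0.
rewrite -(ler_pM2l ln0) -lee_fin -integral_ncellE// mulr_sumr -sumEFin.
under [leRHS]eq_bigr do rewrite -integral_cellE//.
rewrite -nn_integral_sum//.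
- apply: nn_integral_le => z; first by rewrite mulr_ge0.
  by rewrite -mulr_suml ler_wpM2r// natr_ncell_le_sum.
- move=> k; apply: (@measurable_kernel_mul _ _ (@cell R n) (@measurable_cell R n)) => //.
  exact: bhloc.1.
- by move=> k z; rewrite mulr_ge0.
Qed.

Variable J : nat.

(** The first passage above the level [lam], coming from the large cubes. It is
    decided by the cube of side [l i] alone, and the passages at different
    scales are disjoint. *)
Let first_exceed lam (i : 'I_J.+1) z : bool :=
  (lam < cavg (l i) hloc z) && [forall j : 'I_J.+1, (j < i)%N ==> (cavg (l j) hloc z <= lam)].

Let measurable_first_exceed lam i : measurable_fun setT (first_exceed lam i).
Proof.
have mc j : measurable_fun setT (cavg (l j) hloc) by exact: measurable_cavg.
apply: measurable_and; first exact: measurable_fun_ltr.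
apply: measurable_forall_ord => j /=; case: (j < i)%N => //=.
exact: measurable_fun_ler.
Qed.

Let first_exceed_eql lam (i : 'I_J.+1) x y : cell (l i) x y -> first_exceed lam i x -> first_exceed lam i y.
Proof.
move=> xy /andP[lx /forallP fx]; apply/andP; split; first by rewrite -(cavg_eql _ xy).
apply/forallP => j; apply/implyP => ji; have := fx j; rewrite ji/=.
by rewrite -(cavg_eql _ (cell_scale L0 (ltnW ji) xy)).
Qed.

Let sum_first_exceed lam z : \sum_i (first_exceed lam i z)%:R <= 1 :> R.
Proof.
have [i fi|nf] := pickP (first_exceed lam ^~ z); last first.
  by rewrite big1// => i _; rewrite nf.
rewrite (bigD1 i)//= fi big1 ?addr0// => j ji.
case fj: (first_exceed lam j z) => //; exfalso.
move: ji; rewrite -val_eqE/= neq_ltn => /orP[ji|ij].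
  have /andP[_ /forallP/(_ j)] := fi; rewrite ji/= leNgt.
  by have /andP[->] := fj.
have /andP[_ /forallP/(_ i)] := fj; rewrite ij/= leNgt.
by have /andP[->] := fi.
Qed.

(** A large average over a threefold cube forces a large average over one of its
    3^n cubes, hence a first passage above the level at some larger scale near
    that cube. *)
Let exceed_cover lam y (i : 'I_J.+1) : cell L x0 y ->
  3 ^+ n * lam < navg (l i) h y ->
  exists (j : 'I_J.+1) k, first_exceed lam j (y + l j *: displacement R k).
Proof.
move=> x0y; rewrite navg_hloc// => /lt_le_trans/(_ (navg_le_sum _ _)) S.
have [k lk] : exists k, lam < cavg (l i) hloc (y + l i *: displacement R k).
  apply/existsP; apply: contraLR S; rewrite negb_exists -leNgt => /forallP H.
  apply: (@le_trans _ _ (\sum_(k : {ffun 'I_n -> 'I_3}) lam)).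
    by apply: ler_sum => k _; rewrite leNgt.
  by rewrite sumr_const card_displacement -[leLHS]mulr_natl natrX.
set z := y + _ in lk.
have yz : ncell (l i) y z by apply: displacement_ncell (cell_refl _ _); exact: l0.
pose P j := (j < J.+1)%N && (lam < cavg (l j) hloc z).
have exP : exists j, P j by exists i; rewrite /P ltn_ord.
case: (ex_minnP exP) => j /andP[jJ lj] jmin.
have ji : (j <= i)%N by apply: jmin; rewrite /P ltn_ord.
have [k' yk'z] := ncell_displacement (l0 j) (ncell_scale L0 ji yz).
exists (Ordinal jJ), k'; apply: (@first_exceed_eql _ _ z).
  by rewrite cell_sym.
rewrite /first_exceed/= lj/=; apply/forallP => j'; apply/implyP => j'j.
rewrite leNgt; apply/negP => lj'; move: j'j; rewrite ltnNge => /negP; apply.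
by apply: jmin; rewrite /P ltn_ord.
Qed.

Let K : R := 2 * 9 ^+ n.

Definition exceeding y := cell L x0 y && [exists i : 'I_J.+1, K * U < navg (l i) h y].

Lemma measurable_exceeding : measurable_fun setT exceeding.
Proof.
apply: measurable_and; first exact: (@measurable_cell _ _ L _ _ (fun=> x0) id).
rewrite (_ : (fun y => _) = (fun y => ~~ [forall i : 'I_J.+1, navg (l i) h y <= K * U])).
  apply: measurableT_comp; first by [].
  apply: measurable_forall_ord => i; apply: measurable_fun_ler => //.
  exact: measurable_navg.
apply/funext => y; rewrite negb_forall; apply: eq_existsb => i.
by rewrite -ltNge.
Qed.

(** The first passages have total measure at most [int h / lam]; the 3^n
    displacements and the 3^n cubes of [ncell] account for [9 ^ n] in [K]. *)
Lemma weak_type_cell : (\int[leb]_y (exceeding y)%:R%:E <= (L ^+ n / 2)%:E)%E.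
Proof.
have [U00|Upos] := eqVneq U 0.
  rewrite integral0_eq ?lee_fin ?divr_ge0 ?exprn_ge0 ?(ltW L0)// => y _.
  rewrite /exceeding; case: (boolP (cell L x0 y)) => //= x0y.
  rewrite (_ : [exists i, _] = false)//; apply/existsP => -[i].
  rewrite U00 mulr0 navg_hloc// ltNge => /negP; apply.
  have : (0 < l i ^+ n) by rewrite exprn_gt0.
  move=> /ler_pM2l <-; rewrite mulr0 -lee_fin -integral_ncellE//.
  apply: le_trans (_ : \int[leb]_x (hloc x)%:E <= _)%E.
    apply: nn_integral_le => z; first by rewrite mulr_ge0.
    by case: ncell; rewrite ?mul1r// mul0r.
  by rewrite int_hloc U00 mulr0.
have {}Upos : 0 < U by rewrite lt_neqAle eq_sym Upos.
pose lam := 2 * 3 ^+ n * U.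
have lam0 : 0 < lam by rewrite !mulr_gt0// exprn_gt0.
have KE : K * U = 3 ^+ n * lam.
  by rewrite /K /lam (_ : 9 = 3 * 3 :> R) ?exprMn; [ring|ring].
have mf i k : measurable_fun setT
    (fun y : 'rV[R]_n => (first_exceed lam i (y + l i *: displacement R k))%:R : R).
  apply: measurable_bool_natr; apply: (measurableT_comp (measurable_first_exceed lam i)).
  exact: measurable_rVD.
apply: le_trans (_ : \int[leb]_y (\sum_i \sum_k
    (first_exceed lam i (y + l i *: displacement R k))%:R)%:E <= _)%E.
  apply: nn_integral_le => // y; rewrite /exceeding.
  case: (boolP (cell L x0 y)) => [x0y|_]; last by do 2 apply: sumr_ge0 => ? _.
  case: existsP => [[i]|_]; last by do 2 apply: sumr_ge0 => ? _.
  rewrite KE => /(exceed_cover x0y)[j [k jk]].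
  have P i' k' : 0 <= (first_exceed lam i' (y + l i' *: displacement R k'))%:R :> R.
    exact: ler0n.
  have Pk i' : 0 <= \sum_k (first_exceed lam i' (y + l i' *: displacement R k))%:R :> R.
    by apply: sumr_ge0 => k' _; exact: P.
  apply: le_trans (ler_term_sum j Pk); apply: le_trans (ler_term_sum k (P j)).
  by rewrite jk.
rewrite nn_integral_sum => [|i|i y]; last 2 first.
- by apply: measurable_sum => k; exact: mf.
- by apply: sumr_ge0 => k _; exact: ler0n.
apply: le_trans (_ : \sum_i (3 ^+ n / lam)%:E *
    \int[leb]_y ((first_exceed lam i y)%:R * hloc y)%:E <= _)%E.
  apply: lee_sum => i _; rewrite nn_integral_sum//.
  have mfi : measurable_fun setT (fun y => (first_exceed lam i y)%:R : R).
    exact: measurable_bool_natr.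
  have T k : (\int[leb]_y (first_exceed lam i (y + l i *: displacement R k))%:R%:E =
      \int[leb]_y (first_exceed lam i y)%:R%:E)%E.
    apply: (@integral_translate _ _ _ (fun y => (first_exceed lam i y)%:R%:E)).
      exact/measurable_EFinP.
    by move=> y; rewrite lee_fin.
  under eq_bigr => k _ do rewrite T.
  have -> : (\sum_(k : {ffun 'I_n -> 'I_3}) \int[leb]_y (first_exceed lam i y)%:R%:E =
      (3 ^+ n)%:E * \int[leb]_y (first_exceed lam i y)%:R%:E)%E.
    transitivity ((\sum_(k : {ffun 'I_n -> 'I_3}) 1%:E) *
        \int[leb]_y (first_exceed lam i y)%:R%:E)%E.
      by rewrite ge0_sume_distrl//; apply: eq_bigr => k _; rewrite mul1e.
    by rewrite sumEFin sumr_const card_displacement natrX.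
  rewrite EFinM -muleA lee_wpmul2l ?lee_fin ?exprn_ge0//.
  have Fcell x y : cell (l i) x y ->
      (first_exceed lam i x)%:R = (first_exceed lam i y)%:R :> R.
    move=> xy; congr (nat_of_bool _)%:R; apply/idP/idP.
      exact: first_exceed_eql.
    by apply: first_exceed_eql; rewrite cell_sym.
  have <- := @integral_cavg_mul _ _ _ _ hloc (l0 i) mfi (fun=> ler0n _ _) bhloc Fcell.
  have mc : measurable_fun setT (cavg (l i) hloc) by exact: measurable_cavg.
  have c0 y : 0 <= cavg (l i) hloc y by exact: cavg_ge0.
  rewrite -nn_integralZl//; last 3 first.
  - by rewrite invr_ge0 ltW.
  - exact: measurable_funM.
  - by move=> y; rewrite mulr_ge0.
  apply: nn_integral_le => // y; case E : (first_exceed lam i y); last first.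
    by rewrite mul0r mulr0.
  by move: E => /andP[lc _]; rewrite mul1r ler_pdivlMl// mulr1 ltW.
have mfh i : measurable_fun setT (fun y => (first_exceed lam i y)%:R * hloc y).
  apply: measurable_funM; last exact: bhloc.1.
  exact: measurable_bool_natr.
have fh0 i y : 0 <= (first_exceed lam i y)%:R * hloc y by rewrite mulr_ge0.
rewrite -ge0_sume_distrr//; last by move=> i _; exact: nn_integral_ge0.
rewrite -nn_integral_sum//.
apply: le_trans (_ : (3 ^+ n / lam)%:E * \int[leb]_y (hloc y)%:E <= _)%E.
  rewrite lee_wpmul2l ?lee_fin ?divr_ge0 ?exprn_ge0 ?(ltW lam0)//.
  apply: nn_integral_le => y; first by apply: sumr_ge0 => i _.
  by rewrite -mulr_suml ler_piMl// sum_first_exceed.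
rewrite int_hloc -EFinM lee_fin /lam.
rewrite le_eqVlt; apply/orP; left; apply/eqP; field.
by rewrite (lt0r_neq0 Upos) expf_neq0.
Qed.

End weak_type.

(** * Muckenhoupt weights charge every large part of a cube *)

Section muckenhoupt_weights.
Context (R : realType) (n : nat).
Local Notation leb := (lebesgue_rV n).
Implicit Types (w W : 'rV[R]_n -> R).

Lemma measurable_inve d (T : measurableType d) (f : T -> R) :
  (forall x, 0 <= f x) ->
  measurable_fun setT f -> measurable_fun setT (fun x => ((f x)%:E)^-1%E).
Proof.
move=> f0 mf; rewrite (_ : (fun x => _) =
  (fun x => if f x == 0 then +oo%E else (f x `^ (-1))%:E)); last first.
  by apply/funext => x; rewrite inver powR_inv1.
apply: measurable_fun_ifT => //.
- exact: measurable_fun_eqr.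
- by apply/measurable_EFinP; exact: (measurableT_comp (measurable_powR _)).
Qed.

Variables (r : R) (W : 'rV[R]_n -> R) (A : R).
Hypotheses (r1 : 1 < r) (mW : measurable_fun setT W) (W0 : forall x, 0 <= W x).
Hypothesis WA : (muckenhoupt_constant r W <= A%:E)%E.

Let s := r / (r - 1) - 1.
Let sigma x : \bar R := ((W x `^ s)%:E)^-1%E.

Let sE : s * (r - 1) = 1.
Proof. by rewrite /s mulrBl mul1r divfK ?gt_eqF ?subr_gt0// opprB addrC subrK. Qed.

Let r10 : 0 < r - 1. Proof. by rewrite subr_gt0. Qed.

Let s0 : 0 < s.
Proof. by rewrite -(pmulr_lgt0 _ r10) sE. Qed.

Let sigma_ge0 x : (0 <= sigma x)%E.
Proof. by rewrite inve_ge0 lee_fin powR_ge0. Qed.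

Let measurable_sigma : measurable_fun setT sigma.
Proof.
apply: measurable_inve => [x|]; first exact: powR_ge0.
exact: (measurableT_comp (measurable_powR _)).
Qed.

(** Whatever the parameter [t], one of the two terms is at least 1; this
    replaces the use of Hoelder's inequality between [W] and its dual weight. *)
Let one_le t x : 0 < t ->
  (1 <= (t * W x)%:E + (t `^ (- s))%:E * sigma x)%E.
Proof.
move=> t0; have ts0 : 0 < t `^ (- s) by exact: powR_gt0.
have [tW|Wt] := leP 1 (t * W x).
  by rewrite -[leLHS]adde0 leeD ?lee_fin// mule_ge0 ?lee_fin ?(ltW ts0).
rewrite -[leLHS]add0e leeD ?lee_fin ?mulr_ge0 ?(ltW t0)// /sigma inver.
case: ifPn => [_|W0']; first by rewrite gt0_muley ?lte_fin// leey.
have Wx0 : 0 < W x `^ s by rewrite lt_neqAle eq_sym W0' powR_ge0.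
rewrite -EFinM lee_fin ler_pdivlMr// mul1r powRN -(ler_pM2l (@powR_gt0 _ t s t0)).
rewrite mulfV ?gt_eqF ?powR_gt0// -powRM ?(ltW t0)//.
rewrite -[leRHS](_ : 1 `^ s = 1); last by rewrite powR1.
by apply: ge0_ler_powR; rewrite ?nnegrE ?mulr_ge0// ltW.
Qed.

Variables (l : R) (x0 : 'rV[R]_n) (E : 'rV[R]_n -> bool).
Hypotheses (l0 : 0 < l) (mE : measurable_fun setT E).
Hypothesis Ecell : forall y, E y -> cell l x0 y.
Hypothesis Ehalf : ((l ^+ n / 2)%:E <= \int[leb]_y (E y)%:R%:E)%E.

Let a : 'rV[R]_n := \row_j (l * (grid l (x0 0 j))%:~R).
Let V := l ^+ n.
Let V0 : 0 < V. Proof. exact: exprn_gt0. Qed.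

Let u := (\int[leb]_(y in cube a l) (W y)%:E)%E.
Let v := (\int[leb]_(y in cube a l) sigma y)%E.
Let e := (\int[leb]_y ((E y)%:R * W y)%:E)%E.

Hypothesis uoo : (u < +oo)%E.

Let u0 : (0 <= u)%E. Proof. by apply: integral_ge0 => y _; rewrite lee_fin. Qed.
Let v0 : (0 <= v)%E. Proof. exact: integral_ge0. Qed.
Let mEr : measurable_fun setT (fun y => (E y)%:R : R).
Proof. exact: measurable_bool_natr. Qed.
Let mEW : measurable_fun setT (fun y => (E y)%:R * W y).
Proof. exact: measurable_funM. Qed.
Let e0 : (0 <= e)%E. Proof. by apply: nn_integral_ge0 => y; rewrite mulr_ge0. Qed.

Let eu : (e <= u)%E.
Proof.
rewrite /u integral_mkcond; apply: le_lower_integral => y.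
  by rewrite lee_fin mulr_ge0.
rewrite /patch; case: ifPn => [_|]; first by rewrite lee_fin; case: (E y); rewrite ?mul1r// mul0r.
by move/negP; case Ey: (E y); rewrite ?mul0r// => -[]; exact/mem_set/(cell_cube l0)/Ecell.
Qed.

Let AQ : ((u / V%:E) * (v / V%:E) `^ (r - 1) <= A%:E)%E.
Proof.
apply: le_trans WA; apply: ereal_sup_ubound; exists a, l; split => //.
by rewrite /average lebesgue_cube// ltW.
Qed.

Let split_volume t : 0 < t ->
  ((V / 2)%:E <= t%:E * e + (t `^ (- s))%:E * v)%E.
Proof.
move=> t0; apply: le_trans Ehalf _.
have mv : measurable_fun setT (sigma \_ (cube a l)).
  apply/(measurable_restrictT _ _).1; first exact: measurable_cube.
  exact: measurable_funS measurable_sigma.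
have v0' y : (0 <= (sigma \_ (cube a l)) y)%E by exact: erestrict_ge0.
have -> : v = (\int[leb]_y (sigma \_ (cube a l)) y)%E by rewrite /v integral_mkcond.
rewrite /e -nn_integralZl ?(ltW t0)//; last first.
  by move=> y; rewrite mulr_ge0.
have ts0 : 0 < t `^ (- s) by exact: powR_gt0.
rewrite -ge0_integralZl ?lee_fin ?(ltW ts0)//.
rewrite -ge0_integralD//; last 4 first.
- by move=> y _; rewrite lee_fin !mulr_ge0// ltW.
- by apply/measurable_EFinP; exact: measurable_funM.
- by move=> y _; rewrite mule_ge0// lee_fin ltW.
- exact: emeasurable_funM.
apply: le_lower_integral => y; first by rewrite lee_fin.
case Ey: (E y); last first.
  by rewrite mul0r mulr0 adde_ge0// mule_ge0// lee_fin ltW.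
rewrite mul1r /patch mem_set; last exact/(cell_cube l0)/Ecell.
exact: one_le.
Qed.

(** Integrating [one_le] over [E] bounds the volume by [int_E W] and the dual
    integral. For the [t] that makes the first term a quarter of the volume, the
    dual integral is bounded below, and the Muckenhoupt condition turns this
    into the claim. *)
Lemma muckenhoupt_doubling : (u <= (4 `^ r * A)%:E * e)%E.
Proof.
have ufin : u \is a fin_num by rewrite ge0_fin_numE.
have efin : e \is a fin_num by rewrite ge0_fin_numE// (le_lt_trans eu).
have Vi : (V%:E^-1 = V^-1%:E)%E by rewrite inver gt_eqF.
have Vi0 : 0 < V^-1 by rewrite invr_gt0.
have A0 : 0 <= A.
  by rewrite -lee_fin (le_trans _ AQ)// mule_ge0 ?poweR_ge0// Vi mule_ge0// lee_fin ltW.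
have [u00|un0] := eqVneq u 0%E.
  by rewrite u00 mule_ge0// lee_fin mulr_ge0// powR_ge0.
have upos : (0 < u)%E by rewrite lt_neqAle eq_sym un0.
have voo : (v < +oo)%E.
  rewrite ltey; apply/eqP => vE; have := AQ; rewrite Vi vE gt0_mulye ?lte_fin//.
  by rewrite poweRyr ?gt_eqF// gt0_muley// mule_gt0// lte_fin.
have vfin : v \is a fin_num by rewrite ge0_fin_numE.
have := AQ; have := split_volume; move: u0 v0 e0 upos; rewrite Vi.
rewrite -(fineK ufin) -(fineK vfin) -(fineK efin).
move: (fine u) (fine v) (fine e) => {ufin vfin efin voo un0} ur vr er.
rewrite !lee_fin lte_fin => ur0 vr0 er0 urpos sv.
move=> uvA.
(* The number [d] stands for [int_E W], which might vanish. *)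
have main d : er < d -> ur <= 4 `^ r * A * d.
  move=> ed; have d0 : 0 < d := le_lt_trans er0 ed.
  pose t := V / (4 * d); have t0 : 0 < t by rewrite divr_gt0// mulr_gt0.
  have tE : t * d = V / 4 by rewrite /t; field; rewrite gt_eqF.
  have tE' : t `^ (- s) = (4 * d / V) `^ s.
    by rewrite powRN -powR_inv1 ?powR_ge0// powRAC powR_inv1 ?ltW// /t invf_div.
  have q1 : V / 4 <= (4 * d / V) `^ s * vr.
    have := sv t t0; rewrite -!EFinM -EFinD lee_fin tE'.
    have : t * er <= V / 4 by rewrite -tE ler_pM2l// ltW.
    by lra.
  have dV : 0 <= 4 * d / V by rewrite divr_ge0 ?mulr_ge0 ?ltW.
  have q2 : (V / 4) `^ (r - 1) <= (4 * d / V) * vr `^ (r - 1).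
    have -> : 4 * d / V * vr `^ (r - 1) = ((4 * d / V) `^ s * vr) `^ (r - 1).
      by rewrite powRM ?powR_ge0// -powRrM sE powRr1.
    apply: ge0_ler_powR; rewrite ?nnegrE//; first exact: ltW.
      by rewrite divr_ge0// ltW.
    by rewrite mulr_ge0// powR_ge0.
  have V40 : 0 < (V / 4) `^ (r - 1) by apply: powR_gt0; rewrite divr_gt0.
  have q3 : ur * (V / 4) `^ (r - 1) <= 4 * d * (A * V `^ (r - 1)).
    apply: le_trans (ler_wpM2l ur0 q2) _.
    have : ur / V * (vr / V) `^ (r - 1) * V `^ (r - 1) <= A * V `^ (r - 1).
      by rewrite ler_wpM2r// powR_ge0.
    rewrite -mulrA -powRM ?divr_ge0 ?(ltW V0)// divfK ?gt_eqF// => H.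
    rewrite (_ : ur * _ = 4 * d * (ur / V * vr `^ (r - 1))).
      by rewrite ler_wpM2l// mulr_ge0// ltW.
    by field; rewrite gt_eqF.
  rewrite -(ler_pM2r V40); apply: le_trans q3 _.
  have -> : 4 `^ r = 4 * 4 `^ (r - 1).
    rewrite -[X in X * _](@powRr1 _ 4)// -powRD; last by rewrite addrC subrK gt_eqF// (lt_trans ltr01).
    by rewrite addrC subrK.
  have -> : V `^ (r - 1) = 4 `^ (r - 1) * (V / 4) `^ (r - 1).
    by rewrite -powRM// ?divr_ge0 ?(ltW V0)// mulrC divfK.
  by rewrite le_eqVlt; apply/orP; left; apply/eqP; ring.
apply/ler_addgt0Pr => d d0.
pose B := 4 `^ r * A; have B0 : 0 <= B by rewrite mulr_ge0// powR_ge0.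
have B10 : 0 < B + 1 by rewrite ltr_wpDl.
have := main (er + d / (B + 1)); rewrite ltrDl divr_gt0// => /(_ isT)/le_trans; apply.
rewrite -/B mulrDr lerD2l mulrCA ler_piMr ?(ltW d0)// ler_pdivrMr// mul1r.
by rewrite lerDl.
Qed.

End muckenhoupt_weights.

(** * From maximal functions to sums over all scales *)

Section growth.
Context (R : realType).
Implicit Types (Phi : R -> R) (s t a : R).

Definition convex_doubling Phi (D : R) := [/\ Phi 0 = 0,
  forall s t, 0 <= s -> s <= t -> Phi s <= Phi t,
  forall x y c, 0 <= x -> 0 <= y -> 0 <= c <= 1 ->
    Phi (c * x + (1 - c) * y) <= c * Phi x + (1 - c) * Phi y &
  1 <= D /\ forall t, 0 <= t -> Phi (2 * t) <= D * Phi t].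

Variables (Phi : R -> R) (D : R).
Hypothesis PhiD : convex_doubling Phi D.

Let Phi0 : Phi 0 = 0. Proof. by have [] := PhiD. Qed.
Let Phi_le s t : 0 <= s -> s <= t -> Phi s <= Phi t.
Proof. by have [_ + _ _] := PhiD; exact. Qed.
Let D1 : 1 <= D. Proof. by have [_ _ _ []] := PhiD. Qed.
Let Phi2 t : 0 <= t -> Phi (2 * t) <= D * Phi t.
Proof. by have [_ _ _ [_]] := PhiD; exact. Qed.
Let D0 : 0 <= D. Proof. exact: le_trans D1. Qed.

Lemma convex_doubling_ge0 t : 0 <= t -> 0 <= Phi t.
Proof. by move=> t0; rewrite -Phi0; exact: Phi_le. Qed.

(** [slope] plays the role of the derivative of [Phi]. *)
Definition slope t := D * Phi t / t.

Lemma slope_ge0 t : 0 <= t -> 0 <= slope t.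
Proof. by move=> t0; rewrite divr_ge0// mulr_ge0// convex_doubling_ge0. Qed.

Lemma slope_le s t : 0 <= s -> s <= t -> slope s <= slope t.
Proof.
rewrite le_eqVlt => /orP[/eqP <- t0|s0 st].
  by rewrite {1}/slope invr0 mulr0 slope_ge0.
have t0 := lt_le_trans s0 st.
rewrite /slope ler_pdivrMr// mulrAC ler_pdivlMr// -!mulrA ler_wpM2l//.
have [_ _ + _] := PhiD; move=> /(_ t 0 (s / t) (ltW t0) (lexx _)).
rewrite Phi0 !mulr0 !addr0 divfK ?gt_eqF//.
rewrite ler_pdivrMr// mul1r st divr_ge0 ?(ltW s0) ?(ltW t0)// => /(_ isT).
by rewrite mulrAC ler_pdivlMr// [X in _ <= X]mulrC.
Qed.

(** A convex function lies below its chord between [s] and [2 (s + a)]. *)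
Lemma convex_increment s a : 0 <= s -> 0 <= a ->
  Phi (s + a) - Phi s <= a * slope (s + a).
Proof.
move=> s0; rewrite le_eqVlt => /orP[/eqP <-|a0].
  by rewrite addr0 subrr mul0r.
set t := s + a; have t0 : 0 < t by rewrite ltr_wpDl.
have ta0 : 0 < t + a by rewrite addr_gt0.
have [_ _ + _] := PhiD.
move=> /(_ s (2 * t) (t / (t + a)) s0 (mulr_ge0 (ler0n _ _) (ltW t0))).
have -> : t / (t + a) * s + (1 - t / (t + a)) * (2 * t) = t.
  by move: ta0; rewrite /t => ta0; field; rewrite gt_eqF.
have c01 : 0 <= t / (t + a) <= 1.
  by rewrite divr_ge0 ?(ltW t0) ?(ltW ta0)//= ler_pdivrMr// mul1r lerDl ltW.
move=> /(_ c01) H.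
have {}H : Phi t * (t + a) <= t * Phi s + a * Phi (2 * t).
  have := ler_wpM2r (ltW ta0) H; rewrite (_ : (_ + _) * (t + a) =
    t * Phi s + a * Phi (2 * t))//.
  by field; rewrite gt_eqF.
rewrite /slope mulrA ler_pdivlMr//.
have := Phi2 (ltW t0); have := convex_doubling_ge0 (ltW t0).
move: (Phi t) (Phi s) (Phi (2 * t)) H => A B C H A0 CD.
have : a * C <= a * (D * A) by rewrite ler_wpM2l// ltW.
have : 0 <= a * A by rewrite mulr_ge0// ltW.
by lra.
Qed.

Lemma convex_telescope (b : nat -> R) J : (forall i, 0 <= b i) ->
  Phi (\sum_(i < J.+1) b i) <=
  \sum_(j < J.+1) b j * slope (\sum_(i < j.+1) b i).
Proof.
move=> b0; elim: J => [|J IH].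
  rewrite !big_ord_recl !big_ord0 !addr0.
  by have := convex_increment (lexx 0) (b0 0%N); rewrite add0r Phi0 subr0.
rewrite [leRHS]big_ord_recr/= big_ord_recr/=.
have S0 : 0 <= \sum_(i < J.+1) b i by exact: sumr_ge0.
have := convex_increment S0 (b0 J.+1).
by move: IH; lra.
Qed.

Lemma doubling_iter m t : 0 <= t -> Phi (2 ^+ m * t) <= D ^+ m * Phi t.
Proof.
move=> t0; elim: m => [|m IH]; first by rewrite !expr0 !mul1r.
rewrite exprS -mulrA; apply: le_trans (Phi2 _) _.
  by rewrite mulr_ge0// exprn_ge0.
by rewrite exprS -mulrA ler_wpM2l.
Qed.

Lemma doubling_scale c : exists2 E, 0 < E & forall t, 0 <= t -> 0 <= c ->
  Phi (c * t) <= E * Phi t.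
Proof.
have [m cm] : exists m, c <= 2 ^+ m.
  exists (Num.truncn c).+1; apply: le_trans (ltW (truncnS_gt c)) _.
  by rewrite -natrX ler_nat ltnW// ltn_expl.
exists (D ^+ m); first by rewrite exprn_gt0// (lt_le_trans ltr01).
move=> t t0 c0; apply: le_trans (doubling_iter m t0).
by apply: Phi_le; rewrite ?mulr_ge0// ler_wpM2r.
Qed.

(** A form of Young's inequality: either [A] is at most [delta * S], or [S] is
    controlled by [A] and doubling applies. *)
Lemma slope_young delta E A S : 0 < delta ->
  (forall t, 0 <= t -> Phi (delta^-1 * t) <= E * Phi t) -> 0 <= A -> 0 <= S ->
  A * slope S <= delta * D * Phi S + delta * D * E * Phi A.
Proof.
move=> d0 PE A0 S0.
have dD : 0 <= delta * D by rewrite mulr_ge0// ltW.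
have EA : 0 <= E * Phi A.
  apply: le_trans (PE _ A0); apply: convex_doubling_ge0.
  by rewrite mulr_ge0// invr_ge0 ltW.
have [AS|SA] := leP A (delta * S).
  apply: ler_wpDr; first by rewrite -mulrA mulr_ge0.
  have [S00|Sn0] := eqVneq S 0.
    by rewrite S00 /slope invr0 !mulr0 Phi0 mulr0.
  have Spos : 0 < S by rewrite lt_neqAle eq_sym Sn0.
  apply: le_trans (ler_wpM2r (slope_ge0 S0) AS) _.
  by have -> : delta * S * slope S = delta * D * Phi S by rewrite /slope; field.
apply: ler_wpDl; first by rewrite mulr_ge0// convex_doubling_ge0.
have SA' : S <= delta^-1 * A by rewrite ler_pdivlMl// ltW.
have Apos : 0 < A by apply: le_lt_trans SA; rewrite mulr_ge0// ltW.
apply: le_trans (ler_wpM2l A0 (slope_le S0 SA')) _.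
have -> : A * slope (delta^-1 * A) = delta * D * Phi (delta^-1 * A).
  by rewrite /slope; field; rewrite !gt_eqF.
by rewrite -[leRHS]mulrA ler_wpM2l// PE.
Qed.

End growth.

Section geometric_domination.
Context (R : realType).

Lemma sum_geometric_tail j0 m :
  \sum_(j < m | (j0 <= j)%N) (2^-1 : R) ^+ (j - j0) <= 2.
Proof.
suff: \sum_(j < m | (j0 <= j)%N) (2^-1 : R) ^+ (j - j0) = 2 - 2 * 2^-1 ^+ (m - j0).
  by move=> ->; rewrite gerBl mulr_ge0// exprn_ge0// invr_ge0.
elim: m => [|m IH]; first by rewrite big_ord0 sub0n expr0 mulr1 subrr.
rewrite big_mkcond big_ord_recr/= -big_mkcond/= IH; case: leqP => jm.
  by rewrite subSn// exprS; field.
by rewrite (eqP (jm : (m.+1 - j0 == 0)%N)) (eqP (ltnW jm : (m - j0 == 0)%N)) addr0.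
Qed.

(** Only the first marked term matters: all later terms are dominated by a
    geometric sequence started there. *)
Lemma sum_marked_le (b : nat -> R) (G : nat -> bool) (k A : R) J :
  1 <= k -> (forall j, 0 <= b j) -> (forall j, (j < J)%N -> b j <= A) ->
  (forall i j, (j < i < J)%N -> G j -> b i <= k * 2^-1 ^+ (i - j) * b j) ->
  0 <= A -> \sum_(j < J) b j * (G j)%:R <= 2 * k * A.
Proof.
move=> k1 b0 bA bG A0; have k0 : 0 <= k by exact: le_trans k1.
have [[j0 Gj0]|nG] := pselect (exists j, (j < J)%N && G j); last first.
  rewrite big1 ?mulr_ge0// => j _; case Gj: (G j); last by rewrite mulr0.
  by exfalso; apply: nG; exists j; rewrite ltn_ord.
have exG : exists j, (j < J)%N && G j by exists j0.
case: (ex_minnP exG) => {Gj0 exG}j0 /andP[j0J Gj0] jmin.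
apply: (@le_trans _ _ (\sum_(j < J | (j0 <= j)%N) k * A * 2^-1 ^+ (j - j0))).
  rewrite [leRHS]big_mkcond; apply: ler_sum => j _.
  case: (leqP j0 j) => [jj|jj]; last first.
    case Gj: (G j); last by rewrite mulr0.
    by have := jmin j; rewrite Gj ltn_ord => /(_ isT); rewrite leqNgt jj.
  apply: (@le_trans _ _ (b j)).
    by case: (G j); rewrite ?mulr1// mulr0.
  move: jj; rewrite leq_eqVlt => /orP[/eqP <-|jj].
    by rewrite subnn expr0 mulr1; apply: le_trans (bA _ j0J) _; rewrite ler_peMl.
  apply: le_trans (bG _ _ _ Gj0) _; first by rewrite jj ltn_ord.
  by rewrite mulrAC ler_wpM2r ?exprn_ge0 ?invr_ge0// ler_wpM2l// bA.
rewrite -mulr_sumr -[leRHS]mulrA [leRHS]mulrC ler_wpM2l ?mulr_ge0//.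
exact: sum_geometric_tail.
Qed.

End geometric_domination.

(** * A finite inequality of Muckenhoupt-Wheeden type *)

Section finite_scales.
Context (R : realType) (n : nat).
Local Notation leb := (lebesgue_rV n).

Fixpoint running_max (b : nat -> R) (J : nat) : R :=
  if J is j.+1 then Num.max (running_max b j) (b j.+1) else b 0.

Lemma le_running_max (b : nat -> R) i J : (i <= J)%N -> b i <= running_max b J.
Proof.
elim: J => [|J IH]; first by rewrite leqn0 => /eqP ->.
rewrite leq_eqVlt => /orP[/eqP ->|]; first by rewrite /= le_max lexx orbT.
by rewrite ltnS => /IH biM; rewrite /= le_max biM.
Qed.

Lemma running_max_attained (b : nat -> R) J :
  exists2 i, (i <= J)%N & running_max b J = b i.
Proof.
elim: J => [|J [i iJ IH]]; first by exists 0%N.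
rewrite /=; case: (leP (running_max b J) (b J.+1)) => _; first by exists J.+1.
by exists i => //; exact: ltnW.
Qed.

(** The form in which the Muckenhoupt condition enters: every half of a dyadic
    cube carries at least the fraction [Cw^-1] of its weight. *)
Definition charges_halves (w : 'rV[R]_n -> R) (Cw : R) :=
  forall l (x0 : 'rV[R]_n) (E : 'rV[R]_n -> bool), 0 < l ->
    measurable_fun setT E -> (forall y, E y -> cell l x0 y) ->
    ((l ^+ n / 2)%:E <= \int[leb]_y (E y)%:R%:E)%E ->
    (\int[leb]_y ((cell l x0 y)%:R * w y)%:E <=
     Cw%:E * \int[leb]_y ((E y)%:R * w y)%:E)%E.

Context (L : R) (h w : 'rV[R]_n -> R) (Phi : R -> R) (D Cw p : R) (J : nat).
Hypotheses (L0 : 0 < L) (bh : bounded_nonneg h).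
Hypotheses (mw : measurable_fun setT w) (w0 : forall x, 0 <= w x).
Hypotheses (PhiD : convex_doubling Phi D) (mPhi : measurable_fun setT Phi).
Hypotheses (wC : charges_halves w Cw) (Cw0 : 0 < Cw) (p1 : 1 <= p).
Local Notation l := (scale L).

(** [l * navg l h x `^ p^-1] is, up to constants, one of the quantities whose
    supremum is the fractional maximal function. *)
Definition scale_term (l : R) x : R := l * navg l h x `^ p^-1.
Definition scale_sum j x : R := \sum_(i < j.+1) scale_term (l i) x.
Let b j x := scale_term (l j) x.
Let S j x := scale_sum j x.

Let l0 i : 0 < l i. Proof. exact: scale_gt0. Qed.
Let b0 j x : 0 <= b j x. Proof. by rewrite mulr_ge0 ?powR_ge0// ltW. Qed.
Let S0 j x : 0 <= S j x. Proof. by apply: sumr_ge0 => i _; exact: b0. Qed.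

Let mb j : measurable_fun setT (b j).
Proof.
apply: measurable_funM => //; apply: (measurableT_comp (measurable_powR _)).
exact: measurable_navg.
Qed.

Lemma measurable_scale_term l : 0 < l -> measurable_fun setT (scale_term l).
Proof.
move=> l0'; apply: measurable_funM => //; apply: (measurableT_comp (measurable_powR _)).
exact: measurable_navg.
Qed.

Lemma measurable_scale_sum j : measurable_fun setT (scale_sum j).
Proof. by apply: measurable_sum => i; exact: mb. Qed.

Let b_eql i j x y : (i <= j)%N -> cell (l j) x y -> b i x = b i y.
Proof.
by move=> ij xy; rewrite /b /scale_term (navg_eql _ (cell_scale L0 ij xy)).
Qed.

Let S_eql j x y : cell (l j) x y -> S j x = S j y.
Proof.
move=> xy; apply: eq_bigr => i _; apply: (@b_eql i j) => //.
by rewrite -ltnS ltn_ord.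
Qed.

Let F j x := b j x * slope Phi D (S j x).

Let F_ge0 j x : 0 <= F j x.
Proof. by rewrite mulr_ge0// (slope_ge0 PhiD). Qed.

Let mslope (f : 'rV[R]_n -> R) : (forall x, 0 <= f x) -> measurable_fun setT f ->
  measurable_fun setT (fun x => slope Phi D (f x)).
Proof.
move=> f0 mf; rewrite (_ : (fun x => _) =
    (fun x => D * Phi (f x) * f x `^ (-1))); last first.
  by apply/funext => x; rewrite powR_inv1.
apply: measurable_funM; last exact: (measurableT_comp (measurable_powR _)).
by apply: measurable_funM => //; exact: (measurableT_comp mPhi).
Qed.

Let mF j : measurable_fun setT (F j).
Proof.
by apply: measurable_funM => //; apply: mslope => //; exact: measurable_scale_sum.
Qed.

Let K : R := 2 * 9 ^+ n.
Let K1 : 1 <= K.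
Proof. by rewrite /K mulr_ege1 ?ler1n// exprn_ege1// ler1n. Qed.

(** The scale [j] is marked at [x] when no smaller scale has a much larger
    average. By the weak-type estimate at least half of each cube of side [l j]
    is marked. *)
Let marked j x := [forall i : 'I_J.+1, (j < i)%N ==> (navg (l i) h x <= K * navg (l j) h x)].

Let mmarked j : measurable_fun setT (marked j).
Proof.
apply: measurable_forall_ord => i; case: (j < i)%N => //=.
apply: measurable_fun_ler; first exact: measurable_navg.
by apply: measurable_funM => //; exact: measurable_navg.
Qed.

Let scaleD i j : scale (l j) i = l (j + i).
Proof. by rewrite /scale exprD; field; rewrite !expf_neq0. Qed.

Let cell_marked j x0 :
  (\int[leb]_y ((cell (l j) x0 y)%:R * w y)%:E <=
   Cw%:E * \int[leb]_y ((cell (l j) x0 y)%:R * ((marked j y)%:R * w y))%:E)%E.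
Proof.
pose X := exceeding (l j) h x0 J.
pose E y := cell (l j) x0 y && ~~ X y.
have mc : measurable_fun setT (cell (l j) x0).
  exact: (@measurable_cell _ _ (l j) _ _ (fun=> x0) id).
have mX : measurable_fun setT X by exact: measurable_exceeding.
have mE : measurable_fun setT E.
  by apply: measurable_and => //; exact: measurableT_comp.
have Ehalf : ((l j ^+ n / 2)%:E <= \int[leb]_y (E y)%:R%:E)%E.
  have H : ((l j ^+ n)%:E <= \int[leb]_y (E y)%:R%:E + (l j ^+ n / 2)%:E)%E.
    rewrite -(integral_cell x0 (l0 j)).
    apply: le_trans (leeD2l _ (weak_type_cell x0 (l0 j) bh J)).
    rewrite -nn_integralD//; last 2 first.
    - exact: measurable_bool_natr.
    - exact: measurable_bool_natr.
    apply: nn_integral_le => // y; rewrite /E -/(X y).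
    case: (cell _ _ _); case: (X y) => /=; rewrite ?addr0 ?add0r;
      [exact: lexx|exact: lexx|exact: ler01|exact: lexx].
  have := nn_integral_ge0 leb (fun y => ler0n R (E y)); move: H.
  case: (\int[leb]_y _)%E => [r H _|_ _|_]//; last by rewrite leey.
  by move: H; rewrite -EFinD !lee_fin; lra.
have Ecell y : E y -> cell (l j) x0 y by move=> /andP[].
apply: le_trans (wC (l0 j) mE Ecell Ehalf) _.
rewrite lee_wpmul2l ?lee_fin ?(ltW Cw0)//; apply: nn_integral_le => y.
  by rewrite mulr_ge0.
rewrite /E; case: (boolP (cell _ _ _)) => [x0y|_]; last by rewrite !mul0r.
rewrite /= mul1r ler_wpM2r//; case: (boolP (X y)) => //= nX.
suff -> : marked j y by [].
apply/forallP => i; apply/implyP => ji; rewrite leNgt; apply: contra nX => Ki.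
rewrite /X /exceeding x0y; apply/existsP.
have iJ : (i - j < J.+1)%N by rewrite (leq_ltn_trans (leq_subr _ _)).
exists (Ordinal iJ); rewrite /= scaleD subnKC ?(ltnW ji)//.
by rewrite (navg_eql _ x0y).
Qed.

Let F_marked j : (\int[leb]_x (F j x * w x)%:E <=
  Cw%:E * \int[leb]_x (F j x * ((marked j x)%:R * w x))%:E)%E.
Proof.
have mmw : measurable_fun setT (fun x => (marked j x)%:R * w x).
  by apply: measurable_funM => //; exact: measurable_bool_natr.
have mw0 x : 0 <= (marked j x)%:R * w x by rewrite mulr_ge0.
have Fcell x y : cell (l j) x y -> F j x = F j y.
  by move=> xy; rewrite /F (b_eql (leqnn j) xy) (S_eql xy).
exact: (@nn_le_integral_cell R n (l j) Cw (F j) w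
  (fun x => (marked j x)%:R * w x) (l0 j) (ltW Cw0) (mF j) mw mmw (F_ge0 j) w0
  mw0 Fcell (cell_marked j)).
Qed.

Let k := K `^ p^-1.
Let p0 : 0 < p. Proof. exact: lt_le_trans p1. Qed.
Let k1 : 1 <= k.
Proof. by rewrite /k -{1}(powRr0 K) ler_powR// invr_ge0 ltW. Qed.

Let A x := running_max (b ^~ x) J.

Let A0 x : 0 <= A x.
Proof. exact: le_trans (b0 0 x) (le_running_max (b ^~ x) (leq0n J)). Qed.

Let mA : measurable_fun setT A.
Proof.
rewrite /A; elim: J => [|m IH] /=; first exact: mb.
exact: measurable_maxr.
Qed.

Let sum_marked x : \sum_(j < J.+1) b j x * (marked j x)%:R <= 2 * k * A x.
Proof.
apply: (@sum_marked_le _ (b ^~ x) (marked ^~ x)) => //.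
  by move=> j jJ; apply: (le_running_max (b ^~ x)).
move=> i j /andP[ji iJ] /forallP/(_ (Ordinal iJ)); rewrite ji/= => uK.
have lij : l i = l j * 2^-1 ^+ (i - j).
  by rewrite -[in LHS](subnKC (ltnW ji)) -scaleD /scale exprVn.
have K0 : 0 <= K by exact: le_trans K1.
have uk : navg (l i) h x `^ p^-1 <= k * navg (l j) h x `^ p^-1.
  rewrite /k -powRM ?navg_ge0//.
  apply: ge0_ler_powR; rewrite ?nnegrE ?navg_ge0 ?invr_ge0 ?(ltW p0)//.
  by rewrite mulr_ge0 ?navg_ge0.
rewrite /b /scale_term {1}lij.
have -> : k * 2^-1 ^+ (i - j) * (l j * navg (l j) h x `^ p^-1) =
  l j * 2^-1 ^+ (i - j) * (k * navg (l j) h x `^ p^-1) by ring.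
have c0 : 0 <= l j * 2^-1 ^+ (i - j).
  apply: mulr_ge0; first exact: ltW.
  by apply: exprn_ge0; rewrite invr_ge0.
exact: (ler_wpM2l c0 uk).
Qed.

Variables (delta E : R).
Hypotheses (delta0 : 0 < delta) (E0 : 0 < E) (deltaE : 4 * k * Cw * (delta * D) = 1).
Hypothesis PhiE : forall t, 0 <= t -> Phi (delta^-1 * t) <= E * Phi t.

Let Phi0 x : 0 <= x -> 0 <= Phi x. Proof. by move=> x0; exact: (convex_doubling_ge0 PhiD x0). Qed.

(** Sum over the scales of the increments of [Phi], bound each increment by its
    integral over the marked part of the cubes, and use that the marked terms
    add up to a multiple of the maximal one. *)
Let sum_le_max_slope : (\int[leb]_x (Phi (S J x) * w x)%:E <=
  (2 * k * Cw)%:E * \int[leb]_x (A x * slope Phi D (S J x) * w x)%:E)%E.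
Proof.
have mmr j : measurable_fun setT (fun x => (marked j x)%:R : R).
  exact: measurable_bool_natr.
have mmw j : measurable_fun setT (fun x => (marked j x)%:R * w x).
  exact: measurable_funM.
have mFw j : measurable_fun setT (fun x => F j x * w x) by exact: measurable_funM.
have mFm j : measurable_fun setT (fun x => F j x * ((marked j x)%:R * w x)).
  exact: measurable_funM.
have Fm0 j x : 0 <= F j x * ((marked j x)%:R * w x) by apply: mulr_ge0 => //; exact: mulr_ge0.
apply: (@le_trans _ _ (\sum_(j < J.+1) \int[leb]_x (F j x * w x)%:E)%E).
  have <- := @nn_integral_sum _ _ _ leb _ (index_enum 'I_J.+1)
    (fun (j : 'I_J.+1) x => F j x * w x) (fun j => mFw j)
    (fun j x => mulr_ge0 (F_ge0 j x) (w0 x)).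
  apply: nn_integral_le => x; first by rewrite mulr_ge0// Phi0.
  rewrite -mulr_suml ler_wpM2r//.
  exact: (convex_telescope PhiD J (fun i => b0 i x)).
apply: (@le_trans _ _ (\sum_(j < J.+1)
    Cw%:E * \int[leb]_x (F j x * ((marked j x)%:R * w x))%:E)%E).
  by apply: lee_sum => j _; exact: F_marked.
rewrite -ge0_sume_distrr//; last first.
  by move=> j _; apply: nn_integral_ge0 => x; exact: Fm0.
have <- := @nn_integral_sum _ _ _ leb _ (index_enum 'I_J.+1)
    (fun (j : 'I_J.+1) x => F j x * ((marked j x)%:R * w x)) (fun j => mFm j)
    (fun j x => Fm0 j x).
have mAS : measurable_fun setT (fun x => A x * slope Phi D (S J x) * w x).
  apply: measurable_funM => //; apply: measurable_funM => //.
  by apply: mslope => //; exact: measurable_scale_sum.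
have AS0 x : 0 <= A x * slope Phi D (S J x) * w x.
  by apply: mulr_ge0 => //; apply: mulr_ge0 => //; exact: (slope_ge0 PhiD).
have k0 : 0 <= k by exact: le_trans k1.
rewrite mulrC EFinM -muleA lee_wpmul2l ?lee_fin ?(ltW Cw0)//.
rewrite -nn_integralZl ?mulr_ge0//.
apply: nn_integral_le => x; first by apply: sumr_ge0 => j _; exact: Fm0.
have SJ j : (j < J.+1)%N -> S j x <= S J x.
  move=> jJ; rewrite /S /scale_sum -!(big_mkord xpredT (fun i => scale_term (l i) x)).
  by rewrite [leRHS](@big_cat_nat _ _ _ j.+1)//= lerDl sumr_ge0// => i _; exact: b0.
apply: (@le_trans _ _ (\sum_(j < J.+1)
    (b j x * (marked j x)%:R) * (slope Phi D (S J x) * w x))).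
  apply: ler_sum => j _.
  have -> : F j x * ((marked j x)%:R * w x) =
    b j x * (marked j x)%:R * (slope Phi D (S j x) * w x) by rewrite /F; ring.
  have bm0 : 0 <= b j x * (marked j x)%:R by apply: mulr_ge0.
  apply: (ler_wpM2l bm0); apply: (ler_wpM2r (w0 x)).
  by apply: (slope_le PhiD); [exact: S0|exact: SJ].
rewrite -mulr_suml.
have -> : 2 * k * (A x * slope Phi D (S J x) * w x) =
  2 * k * A x * (slope Phi D (S J x) * w x) by ring.
have sw0 : 0 <= slope Phi D (S J x) * w x.
  by apply: mulr_ge0 => //; exact: (slope_ge0 PhiD).
exact: (ler_wpM2r sw0 (sum_marked x)).
Qed.

(** In [sum_le_max_slope] the right-hand side still contains the sum; the choice
    of [delta] allows to absorb it, which is why its integral has to be finite. *)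
Lemma finite_sum_le_max : (\int[leb]_x (Phi (scale_sum J x) * w x)%:E < +oo)%E ->
  (\int[leb]_x (Phi (scale_sum J x) * w x)%:E <=
   E%:E * \int[leb]_x (Phi (running_max (fun j => scale_term (l j) x) J) * w x)%:E)%E.
Proof.
move=> Soo.
have mPS : measurable_fun setT (fun x => Phi (S J x) * w x).
  apply: measurable_funM => //; apply: (measurableT_comp mPhi).
  exact: measurable_scale_sum.
have mPA : measurable_fun setT (fun x => Phi (A x) * w x).
  by apply: measurable_funM => //; exact: (measurableT_comp mPhi).
have PS0 x : 0 <= Phi (S J x) * w x by rewrite mulr_ge0// Phi0.
have PA0 x : 0 <= Phi (A x) * w x by rewrite mulr_ge0// Phi0.
have c0 : 0 <= 2 * k * Cw.
  by apply: mulr_ge0; [apply: mulr_ge0 => //; exact: le_trans k1|exact: ltW].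
have half : 2 * k * Cw * (delta * D) = 2^-1.
  have H (x y z : R) : 4 * x * y * z = 1 -> 2 * x * y * z = 2^-1.
    by move=> xyz; lra.
  exact: H deltaE.
have -> : E = 2 * (2^-1 * E) by field.
rewrite EFinM -muleA; apply: absorb_half => //.
- exact: nn_integral_ge0.
- by apply: mule_ge0; [rewrite lee_fin mulr_ge0// ltW|exact: nn_integral_ge0].
apply: le_trans sum_le_max_slope _.
have E20 : 0 <= 2^-1 * E by rewrite mulr_ge0// ltW.
rewrite -[X in (_ <= X + _)%E]nn_integralZl// -[X in (_ <= _ + X)%E]nn_integralZl//.
have mAS : measurable_fun setT (fun x => A x * slope Phi D (S J x) * w x).
  apply: measurable_funM => //; apply: measurable_funM => //.
  by apply: mslope => //; exact: measurable_scale_sum.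
have AS0 x : 0 <= A x * slope Phi D (S J x) * w x.
  by apply: mulr_ge0 => //; apply: mulr_ge0 => //; exact: (slope_ge0 PhiD).
rewrite -nn_integralZl//.
have mX : measurable_fun setT (fun x => 2^-1 * (Phi (S J x) * w x)).
  exact: measurable_funM.
have mY : measurable_fun setT (fun x => 2^-1 * E * (Phi (A x) * w x)).
  exact: measurable_funM.
have X0 x : 0 <= 2^-1 * (Phi (S J x) * w x) by apply: mulr_ge0.
have Y0 x : 0 <= 2^-1 * E * (Phi (A x) * w x) by apply: mulr_ge0.
rewrite -(nn_integralD leb mX mY X0 Y0).
apply: nn_integral_le => x; first exact: mulr_ge0.
have := ler_wpM2l c0 (slope_young PhiD delta0 PhiE (A0 x) (S0 J x)).
move=> /(ler_wpM2r (w0 x)) H; rewrite [leLHS]mulrA; apply: le_trans H _.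
have -> : 2 * k * Cw * (delta * D * Phi (S J x) + delta * D * E * Phi (A x)) * w x =
  (2 * k * Cw * (delta * D)) * (Phi (S J x) * w x) +
  (2 * k * Cw * (delta * D)) * E * (Phi (A x) * w x) by ring.
by rewrite half.
Qed.

End finite_scales.

(** * Poincare inequality for pairs of points in a box *)

Section line_derivative.
Context (R : realType) (n : nat).
Local Notation leb := (lebesgue_rV n).
Implicit Types (f g : 'rV[R]_n -> R) (z : 'rV[R]_n).

Definition unit_vector (i : 'I_n) : 'rV[R]_n := delta_mx 0 i.

Definition gradient_bound f g := forall i,
  [/\ continuous (partial i f), forall x, derivable f x (unit_vector i) &
      forall x, `|partial i f x| <= g x].

Let continuous_line z i : continuous (fun s : R => z + s *: unit_vector i).
Proof.
move=> s; apply: cvgD; first exact: cvg_cst.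
by apply: cvgZr_tmp; exact: cvg_id.
Qed.

Lemma line_increment f g z i (a b : R) : gradient_bound f g -> a < b ->
  measurable_fun setT g ->
  (`|f (z + b *: unit_vector i) - f (z + a *: unit_vector i)|%:E <=
   \int[lebesgue_measure]_s ((a <= s <= b)%R%:R * g (z + s *: unit_vector i))%:E)%E.
Proof.
move=> fg ab mg; have [cf df fgi] := fg i.
pose psi s := f (z + s *: unit_vector i).
pose dpsi s := partial i f (z + s *: unit_vector i).
have E (s : R) : (fun h : R => h^-1 *: ((psi \o shift s) (h *: (1 : R)) - psi s)) =
  (fun h : R => h^-1 *: ((f \o shift (z + s *: unit_vector i)) (h *: unit_vector i) -
     f (z + s *: unit_vector i))).
  apply/funext => h; rewrite /psi/=; congr (_ *: (f _ - _)).
  by rewrite scalerDl addrCA [h *: 1]mulr1.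
have dps s : derivable psi s 1 by rewrite /derivable E; exact: df.
have Dps s : psi^`()%classic s = dpsi s.
  by rewrite derive1E /derive E.
have cdpsi : continuous dpsi.
  by move=> s; apply: continuous_comp; [exact: continuous_line|exact: cf].
have cpsi s : {for s, continuous psi}.
  by apply: differentiable_continuous; apply/derivable1_diffP.
have dpsiab : derivable_oo_LRcontinuous psi a b.
  split.
  - by move=> s _; apply: dps.
  - by apply: cvg_at_right_filter; exact: cpsi.
  - by apply: cvg_at_left_filter; exact: cpsi.
have FTC := @continuous_FTC2 R dpsi psi a b ab (continuous_subspaceT cdpsi)
  dpsiab (fun s _ => Dps s).
have -> : (`|f (z + b *: unit_vector i) - f (z + a *: unit_vector i)|%:E =
    `|\int[lebesgue_measure]_(s in `[a, b]) (dpsi s)%:E|)%E by rewrite FTC.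
have mdpsi : measurable_fun setT (EFin \o dpsi).
  by apply/measurable_EFinP; exact: continuous_measurable_fun.
have mab : measurable (`[a, b]%classic : set R) by exact: measurable_itv.
apply: (le_trans (le_abse_integral lebesgue_measure mab _)).
  exact: measurable_funS mdpsi.
rewrite integral_mkcond; apply: le_lower_integral => s.
  by apply: erestrict_ge0.
rewrite /patch; case: ifPn => [/set_mem|_].
  by rewrite /= in_itv/= => ->; rewrite mul1r lee_fin fgi.
by rewrite lee_fin mulr_ge0// (le_trans (normr_ge0 _) (fgi _)).
Qed.

Definition between (c s : R) : bool := Num.min 0 c <= s <= Num.max 0 c.

Lemma segment_increment f g z i c : gradient_bound f g -> measurable_fun setT g ->
  (`|f (z + c *: unit_vector i) - f z|%:E <=
   \int[lebesgue_measure]_s ((between c s)%:R * g (z + s *: unit_vector i))%:E)%E.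
Proof.
move=> fg mg; rewrite /between; have [c0|c0|<-] := ltgtP 0 c.
- by have := line_increment z i fg c0 mg; rewrite scale0r addr0.
- by have := line_increment z i fg c0 mg; rewrite scale0r addr0 distrC.
- rewrite scale0r addr0 subrr normr0; apply: integral_ge0 => s _.
  rewrite lee_fin mulr_ge0//; have [_ _ fgi] := fg i.
  by rewrite (le_trans (normr_ge0 _) (fgi _)).
Qed.

Lemma integral_between c :
  (\int[lebesgue_measure]_s (between c s)%:R%:E = `|c|%:E)%E.
Proof.
transitivity (\int[@lebesgue_measure R]_s
    (\1_(`[Num.min 0 c, Num.max 0 c]%classic) s)%:E)%E.
  apply: eq_integral => s _; rewrite indicE; congr (nat_of_bool _)%:R%:E.
  by apply/idP/idP => [h|/set_mem//]; apply/mem_set.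
rewrite integral_indic//.
rewrite setIT [LHS](lebesgue_measure_itv `[_, _])/= lte_fin.
have [c0|c0|<-] := ltgtP 0 c.
- by rewrite c0 -EFinB subr0 gtr0_norm.
- by rewrite c0 -EFinB sub0r ltr0_norm.
- by rewrite ltxx normr0.
Qed.

Lemma measurable_between d (T : measurableType d) (c : R) (h : T -> R) :
  measurable_fun setT h -> measurable_fun setT (fun t => between c (h t)).
Proof. by move=> mh; apply: measurable_and; apply: measurable_fun_ler. Qed.

Lemma integral_between_scaled (k : \bar R) c : (0 <= k)%E ->
  (\int[lebesgue_measure]_s (k * (between c s)%:R%:E) = k * `|c|%:E)%E.
Proof.
move=> k0; rewrite ge0_integralZl//; first by rewrite integral_between.
apply/measurable_EFinP; apply: measurable_bool_natr.
exact: measurable_between.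
Qed.

End line_derivative.

Section box_poincare.
Context (R : realType) (n : nat).
Local Notation leb := (lebesgue_rV n).
Local Notation mu := (@lebesgue_measure R).

(** Boxes with sides parallel to the axes, characterised by the property that
    the coordinatewise segments between their points stay inside. *)
Definition coordinate_convex (U : 'rV[R]_n -> bool) :=
  forall x y z : 'rV[R]_n, U x -> U y ->
  (forall i, Num.min (x 0 i) (y 0 i) <= z 0 i <= Num.max (x 0 i) (y 0 i)) -> U z.

Context (f g : 'rV[R]_n -> R) (U : 'rV[R]_n -> bool) (d : R).
Hypotheses (fg : gradient_bound f g) (mf : measurable_fun setT f).
Hypotheses (mg : measurable_fun setT g) (g0 : forall x, 0 <= g x).
Hypotheses (mU : measurable_fun setT U) (cU : coordinate_convex U) (d0 : 0 <= d).
Hypothesis Ud : forall x y i, U x -> U y -> `|x 0 i - y 0 i| <= d.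

Let IU := (\int[leb]_x ((U x)%:R * g x)%:E)%E.

Let path (v : 'rV[R]_n) (i : nat) : 'rV[R]_n :=
  \row_k (if (k < i)%N then v 0 k else 0).

Let path0 v : path v 0 = 0.
Proof. by apply/rowP => k; rewrite !mxE. Qed.

Let pathn v : path v n = v.
Proof. by apply/rowP => k; rewrite !mxE ltn_ord. Qed.

Let pathS v (i : 'I_n) : path v i.+1 = path v i + v 0 i *: unit_vector R i.
Proof.
apply/rowP => k; rewrite !mxE eqxx/=.
have [ki|ik|/val_inj ->] := ltngtP k i.
- by rewrite ltnS (ltnW ki) (_ : k == i = false) ?mulr0 ?addr0//; apply/eqP => ?; subst; rewrite ltnn in ki.
- by rewrite ltnS leqNgt ik (_ : k == i = false) ?mulr0 ?addr0//; apply/eqP => ?; subst; rewrite ltnn in ik.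
- by rewrite ltnSn eqxx mulr1 add0r.
Qed.

Let mgU : measurable_fun setT (fun x => (U x)%:R * g x).
Proof. by apply: measurable_funM => //; exact: measurable_bool_natr. Qed.

Let gU0 x : 0 <= (U x)%:R * g x. Proof. by rewrite mulr_ge0. Qed.

(** One leg of the coordinate path from [z] to [z + v]. *)
Let leg (v : 'rV[R]_n) (i : 'I_n) z s : R :=
  (between (v 0 i) s)%:R * ((U (z + (path v i + s *: unit_vector R i)))%:R *
    g (z + (path v i + s *: unit_vector R i))).

Let leg0 v i z s : 0 <= leg v i z s. Proof. by rewrite mulr_ge0. Qed.

Let mleg v i d' (T : measurableType d') (a : T -> 'rV[R]_n) (b : T -> R) :
  measurable_fun setT a -> measurable_fun setT b ->
  measurable_fun setT (fun t => leg v i (a t) (b t)).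
Proof.
move=> ma mb; apply: measurable_funM.
  by apply: measurable_bool_natr; exact: measurable_between.
apply: (measurableT_comp mgU).
by apply: measurable_rVD => //; apply: measurable_rV_lincomb.
Qed.

Let increment_le_legs v z : U z -> U (z + v) ->
  (`|f (z + v) - f z|%:E <= \sum_(i < n) \int[mu]_s (leg v i z s)%:E)%E.
Proof.
move=> Uz Uzv.
apply: (@le_trans _ _ (\sum_(i < n) `|f (z + path v i.+1) - f (z + path v i)|%:E)%E).
  rewrite sumEFin lee_fin.
  have -> : f (z + v) - f z = \sum_(i < n) (f (z + path v i.+1) - f (z + path v i)).
    rewrite -(big_mkord xpredT (fun i => f (z + path v i.+1) - f (z + path v i))).
    by rewrite telescope_sumr// pathn path0 addr0.
  exact: ler_norm_sum.
apply: lee_sum => i _; rewrite pathS addrA.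
apply: le_trans (segment_increment (z + path v i) i (v 0 i) fg mg) _.
apply: nn_integral_le => s; first by rewrite mulr_ge0.
rewrite /leg; case: (boolP (between _ _)) => [sv|_]; last by rewrite !mul0r.
rewrite addrA (_ : U _ = true) ?mul1r//.
apply: (cU Uz Uzv) => k; rewrite !mxE eqxx/=.
move: sv; rewrite /between => sv.
have [->|ki] := eqVneq k i.
  by rewrite ltnn addr0 mulr1 -[X in Num.min X]addr0 -[X in Num.max X]addr0
    -addr_minr -addr_maxr !lerD2l.
rewrite mulr0 addr0; case: ifP => _; rewrite ?addr0.
  by rewrite ge_min lexx orbT le_max lexx orbT.
by rewrite ge_min lexx le_max lexx.
Qed.

Let integral_leg v i : (\int[leb]_z \int[mu]_s (leg v i z s)%:E = `|v 0 i|%:E * IU)%E.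
Proof.
have mf2 : measurable_fun setT (fun p : 'rV[R]_n * R => (leg v i p.1 p.2)%:E).
  by apply/measurable_EFinP; exact: mleg.
rewrite (@fubini_tonelli _ _ 'rV[R]_n (measurableTypeR R) R leb mu
  (fun p => (leg v i p.1 p.2)%:E) mf2) => [|p]; last by rewrite lee_fin.
transitivity (\int[mu]_s (IU * (between (v 0 i) s)%:R%:E))%E.
  apply: eq_integral => s _ /=; rewrite /leg nn_integralZl//.
  - rewrite muleC; congr (_ * _)%E.
    apply: (@integral_translate _ _ _ (fun z => ((U z)%:R * g z)%:E)) => [|x].
      exact/measurable_EFinP.
    by rewrite lee_fin.
  - apply: (measurableT_comp mgU); exact: measurable_rVD.
rewrite integral_between_scaled; first by rewrite muleC.
by apply: nn_integral_ge0 => x.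
Qed.

Let pair (v z : 'rV[R]_n) : R := (U z)%:R * ((U (z + v))%:R * `|f (z + v) - f z|).

(** Write [y = x + v], go from [x] to [x + v] along the coordinate directions
    inside the box, and translate each leg back to the box. *)
Lemma pair_poincare :
  (\int[leb]_x \int[leb]_y ((U x)%:R * ((U y)%:R * `|f y - f x|))%:E <=
   ((2 * d) ^+ n * (n%:R * d))%:E * \int[leb]_x ((U x)%:R * g x)%:E)%E.
Proof.
have IU0 : (0 <= IU)%E by exact: nn_integral_ge0.
pose C := cube (\row_(j < n) (- d)) (2 * d).
have mC : measurable C by exact: measurable_cube.
have pair0 v z : 0 <= pair v z by rewrite !mulr_ge0.
have mpair : measurable_fun setT (fun p : 'rV[R]_n * 'rV[R]_n => (pair p.2 p.1)%:E).
  have mD : measurable_fun setT (fun p : 'rV[R]_n * 'rV[R]_n => p.1 + p.2).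
    exact: measurable_rVD.
  apply/measurable_EFinP; apply: measurable_funM.
    by apply: measurable_bool_natr; exact: (measurableT_comp mU).
  apply: measurable_funM.
    by apply: measurable_bool_natr; exact: (measurableT_comp mU).
  apply: measurableT_comp => //; apply: measurable_funB.
    exact: (measurableT_comp mf).
  exact: (measurableT_comp mf).
have -> : (\int[leb]_x \int[leb]_y ((U x)%:R * ((U y)%:R * `|f y - f x|))%:E =
    \int[leb]_x \int[leb]_v (pair v x)%:E)%E.
  apply: eq_integral => x _.
  rewrite -(@integral_translate _ _ x (fun y => ((U x)%:R * ((U y)%:R * `|f y - f x|))%:E)).
  - by apply: eq_integral => v _; rewrite /pair [v + x]addrC.
  - apply/measurable_EFinP; apply: measurable_funM => //; apply: measurable_funM.
      exact: measurable_bool_natr.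
    by apply: measurableT_comp => //; exact: measurable_funB.
  - by move=> y; rewrite lee_fin !mulr_ge0.
rewrite (@fubini_tonelli _ _ _ _ _ leb leb _ mpair) => [|p]; last by rewrite lee_fin.
apply: (@le_trans _ _ (\int[leb]_v (((n%:R * d)%:E * IU) * (\1_C v)%:E))%E).
  apply: le_lower_integral => v; first exact: nn_integral_ge0.
  rewrite /= indicE; have [/set_mem Cv|nC] := boolP (v \in C); last first.
    rewrite mule0 integral0_eq// => z _; rewrite /pair.
    case Uz: (U z); rewrite ?mul0r//; case Uzv: (U (z + v)); rewrite ?mul0r ?mulr0//.
    exfalso; move/negP: nC; apply; apply/mem_set => i; rewrite mxE.
    have := Ud i Uz Uzv; rewrite !mxE opprD addNKr normrN ler_norml.
    by move=> /andP[? ?]; apply/andP; split; lra.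
  rewrite mule1.
  apply: (@le_trans _ _ (\sum_(i < n) `|v 0 i|%:E * IU)%E); last first.
    rewrite -ge0_sume_distrl// lee_wpmul2r// sumEFin lee_fin.
    apply: (@le_trans _ _ (\sum_(i < n) d)); last by rewrite sumr_const card_ord mulr_natl.
    apply: ler_sum => i _; have := Cv i; rewrite mxE => /andP[? ?].
    by rewrite ler_norml; apply/andP; split; lra.
  under eq_bigr do rewrite -integral_leg.
  rewrite -ge0_integral_sum//.
  - apply: le_lower_integral => z; first by rewrite lee_fin.
    rewrite /pair; case Uz: (U z); last first.
      by rewrite mul0r sume_ge0// => i _; exact: nn_integral_ge0.
    case Uzv: (U (z + v)); last first.
      by rewrite mul0r mulr0 sume_ge0// => i _; exact: nn_integral_ge0.
    by rewrite !mul1r; exact: increment_le_legs.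
  - move=> i; apply: (@measurable_fun_fubini_tonelli_F _ _ 'rV[R]_n (measurableTypeR R)
      R mu (fun p => (leg v i p.1 p.2)%:E)) => [|p]; last by rewrite lee_fin.
    by apply/measurable_EFinP; exact: mleg.
  - by move=> i z _; exact: nn_integral_ge0.
rewrite ge0_integralZl//.
- rewrite integral_indic// setIT.
  rewrite [X in (_ * X <= _)%E](_ : _ = ((2 * d) ^+ n)%:E); last first.
    by apply: lebesgue_cube; rewrite mulr_ge0.
  by rewrite muleAC -EFinM mulrC.
- by apply/measurable_EFinP; exact: measurable_indic.
- by rewrite mule_ge0// lee_fin mulr_ge0.
Qed.

Lemma increment_bound G z v : (forall x, g x <= G) -> U z -> U (z + v) ->
  `|f (z + v) - f z| <= \sum_(i < n) `|v 0 i| * G.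
Proof.
move=> gG Uz Uzv; rewrite -lee_fin; apply: le_trans (increment_le_legs Uz Uzv) _.
rewrite -sumEFin; apply: lee_sum => i _.
have G0 : 0 <= G by exact: le_trans (gG z).
rewrite mulrC EFinM -integral_between_scaled ?lee_fin//.
apply: le_lower_integral => s; first by rewrite lee_fin.
rewrite -EFinM lee_fin /leg mulrC ler_wpM2r//.
by case: (U _); rewrite ?mul1r// mul0r.
Qed.

End box_poincare.

(** * Oscillation of a function over dyadic cubes *)

Section cell_boxes.
Context (R : realType) (n : nat).
Implicit Types (x y z : 'rV[R]_n) (l : R).

Let grid_between l (s t u : R) : 0 < l -> Num.min s t <= u <= Num.max s t ->
  (grid l s <= grid l u <= grid l t) || (grid l t <= grid l u <= grid l s).
Proof.
move=> l0; have mono a b : a <= b -> grid l a <= grid l b.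
  by move=> ab; rewrite le_floor// ler_pM2r// invr_gt0.
by case: (leP s t) => _ /andP[/mono -> /mono ->]; rewrite ?orbT.
Qed.

Lemma coordinate_convex_cell l x : 0 < l -> coordinate_convex (cell l x).
Proof.
move=> l0 y y' z /cellP xy /cellP xy' yz; apply/cellP => i.
have := grid_between l0 (yz i); rewrite -xy -xy'.
by move: (grid _ _) (grid _ _) => a b; lia.
Qed.

Lemma coordinate_convex_ncell l x : 0 < l -> coordinate_convex (ncell l x).
Proof.
move=> l0 y y' z /ncellP xy /ncellP xy' yz; apply/ncellP => i.
have := grid_between l0 (yz i); have := xy i; have := xy' i.
by move: (grid _ _) (grid _ _) (grid _ _) (grid _ _) => a b c e; lia.
Qed.

Lemma cell_diam l x y y' i : 0 < l -> cell l x y -> cell l x y' ->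
  `|y 0 i - y' 0 i| <= l.
Proof.
move=> l0 xy xy'; apply: ltW; apply: cell_dist => //.
by rewrite -(cell_eql _ xy).
Qed.

Lemma ncell_diam l x y y' i : 0 < l -> ncell l x y -> ncell l x y' ->
  `|y 0 i - y' 0 i| <= 3 * l.
Proof.
move=> l0 /(ncell_cube l0)/(_ i) yi /(ncell_cube l0)/(_ i) y'i.
by move: yi y'i; rewrite ler_norml => /andP[? ?] /andP[? ?]; apply/andP; split; lra.
Qed.

End cell_boxes.

Section oscillation.
Context (R : realType) (n : nat).
Local Notation leb := (lebesgue_rV n).
Context (f g : 'rV[R]_n -> R) (G : R).
Hypotheses (bf : bounded_nonneg f) (fg : gradient_bound f g).
Hypotheses (mg : measurable_fun setT g) (gG : forall x, 0 <= g x <= G).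
Implicit Types (x y z : 'rV[R]_n) (l d : R).

Let f0 x : 0 <= f x. Proof. by have [_ [B /(_ x)/andP[]]] := bf. Qed.
Let g0 x : 0 <= g x. Proof. by have /andP[] := gG x. Qed.
Let bg : bounded_nonneg g. Proof. by split => //; exists G. Qed.

Let mcell l x : 0 < l -> measurable_fun setT (cell l x).
Proof. by move=> l0; exact: (@measurable_cell _ _ l _ _ (fun=> x) id). Qed.

Let mcell_mul l x (h : 'rV[R]_n -> R) : 0 < l -> measurable_fun setT h ->
  measurable_fun setT (fun y => (cell l x y)%:R * h y).
Proof.
by move=> l0 mh; apply: measurable_funM => //; apply: measurable_bool_natr; exact: mcell.
Qed.

Let pair_integral l1 l2 x1 x2 :=
  (\int[leb]_y \int[leb]_y' ((cell l1 x1 y)%:R * ((cell l2 x2 y')%:R * `|f y' - f y|))%:E)%E.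

Let cavg_sub_le l1 l2 x1 x2 : 0 < l1 -> 0 < l2 ->
  ((l1 ^+ n * l2 ^+ n * cavg l1 f x1)%:E <=
   (l1 ^+ n * l2 ^+ n * cavg l2 f x2)%:E + pair_integral l1 l2 x1 x2)%E.
Proof.
move=> l10 l20; have mf := bf.1.
have l2n : 0 <= l2 ^+ n by rewrite exprn_ge0// ltW.
have m2 (h : 'rV[R]_n -> R) : measurable_fun setT h -> (forall y, 0 <= h y) -> forall y,
    (\int[leb]_y' ((cell l1 x1 y)%:R * ((cell l2 x2 y')%:R * h y'))%:E =
     (cell l1 x1 y)%:R%:E * \int[leb]_y' ((cell l2 x2 y')%:R * h y')%:E)%E.
  move=> mh h0 y; rewrite nn_integralZl//; first exact: mcell_mul.
  by move=> y'; rewrite mulr_ge0.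
have -> : ((l1 ^+ n * l2 ^+ n * cavg l1 f x1)%:E =
    \int[leb]_y \int[leb]_y' ((cell l1 x1 y)%:R * ((cell l2 x2 y')%:R * f y))%:E)%E.
  transitivity (\int[leb]_y (l2 ^+ n * ((cell l1 x1 y)%:R * f y))%:E)%E.
    rewrite nn_integralZl//; last by move=> y; rewrite mulr_ge0.
      by rewrite integral_cellE// -EFinM; congr EFin; ring.
    exact: mcell_mul.
  apply: eq_integral => y _.
  transitivity (\int[leb]_y' ((cell l1 x1 y)%:R * f y * (cell l2 x2 y')%:R)%:E)%E.
    rewrite nn_integralZl//.
    - by rewrite integral_cell// -EFinM mulrC.
    - by rewrite mulr_ge0.
    - by apply: measurable_bool_natr; exact: mcell.
  by apply: eq_integral => y' _; congr EFin; ring.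
have -> : ((l1 ^+ n * l2 ^+ n * cavg l2 f x2)%:E =
    \int[leb]_y \int[leb]_y' ((cell l1 x1 y)%:R * ((cell l2 x2 y')%:R * f y'))%:E)%E.
  transitivity (\int[leb]_y (l2 ^+ n * cavg l2 f x2 * (cell l1 x1 y)%:R)%:E)%E.
    rewrite nn_integralZl//.
    - by rewrite integral_cell// -EFinM; congr EFin; ring.
    - by rewrite mulr_ge0// cavg_ge0.
    - by apply: measurable_bool_natr; exact: mcell.
  apply: eq_integral => y _.
  by rewrite (m2 f)// integral_cellE// -EFinM mulrC.
have mK (h : 'rV[R]_n * 'rV[R]_n -> R) : measurable_fun setT h ->
   measurable_fun setT (fun p : 'rV[R]_n * 'rV[R]_n =>
     ((cell l1 x1 p.1)%:R * ((cell l2 x2 p.2)%:R * h p))%:E).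
  move=> mh; apply/measurable_EFinP; apply: measurable_funM.
    by apply: measurable_bool_natr; exact: (measurableT_comp (mcell x1 l10)).
  apply: measurable_funM => //.
  by apply: measurable_bool_natr; exact: (measurableT_comp (mcell x2 l20)).
have mI (h : 'rV[R]_n * 'rV[R]_n -> R) : measurable_fun setT h -> (forall p, 0 <= h p) ->
   measurable_fun setT (fun y => \int[leb]_y'
     ((cell l1 x1 y)%:R * ((cell l2 x2 y')%:R * h (y, y')))%:E)%E.
  move=> mh h0; apply: (measurable_fun_fubini_tonelli_F _ (mK _ mh)) => p.
  by rewrite lee_fin !mulr_ge0.
have mdiff : measurable_fun setT (fun p : 'rV[R]_n * 'rV[R]_n => `|f p.2 - f p.1|).
  apply: measurableT_comp => //.
  by apply: measurable_funB; exact: (measurableT_comp mf).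
rewrite /pair_integral -ge0_integralD//; last 4 first.
- by move=> y _; apply: nn_integral_ge0 => y'; rewrite !mulr_ge0.
- by apply: (mI (fun p => f p.2)) => //; exact: (measurableT_comp mf).
- by move=> y _; apply: nn_integral_ge0 => y'; rewrite !mulr_ge0.
- exact: (mI (fun p => `|f p.2 - f p.1|)).
apply: le_lower_integral => y.
  by apply: nn_integral_ge0 => y'; rewrite !mulr_ge0.
rewrite -nn_integralD//.
- apply: nn_integral_le => y'; first by rewrite !mulr_ge0.
  rewrite -!mulrDr; do 2 (rewrite ler_wpM2l//).
  by rewrite -lerBlDl -normrN opprB ler_norm.
- by apply: measurable_funM => //; exact: mcell_mul.
- apply: measurable_funM => //; apply: mcell_mul => //.
  by apply: measurableT_comp => //; exact: measurable_funB.
- by move=> y'; rewrite !mulr_ge0.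
Qed.

(** The difference of the averages is at most the mean of [`|f y' - f y|] over
    both cubes, to which [pair_poincare] applies in the box [U]. *)
Lemma cavg_diff l1 l2 x1 x2 (U : 'rV[R]_n -> bool) d : 0 < l1 -> 0 < l2 -> 0 <= d ->
  measurable_fun setT U -> coordinate_convex U ->
  (forall x y i, U x -> U y -> `|x 0 i - y 0 i| <= d) ->
  (forall y, cell l1 x1 y -> U y) -> (forall y, cell l2 x2 y -> U y) ->
  ((l1 ^+ n * l2 ^+ n * `|cavg l1 f x1 - cavg l2 f x2|)%:E <=
   ((2 * d) ^+ n * (n%:R * d))%:E * \int[leb]_x ((U x)%:R * g x)%:E)%E.
Proof.
move=> l10 l20 d0 mU cU Ud U1 U2.
have P := pair_poincare fg bf.1 mg g0 mU cU d0 Ud.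
have one a b x x' : 0 < a -> 0 < b -> (forall y, cell a x y -> U y) ->
    (forall y, cell b x' y -> U y) ->
    ((a ^+ n * b ^+ n * (cavg a f x - cavg b f x'))%:E <=
     ((2 * d) ^+ n * (n%:R * d))%:E * \int[leb]_x ((U x)%:R * g x)%:E)%E.
  move=> a0 b0 Ua Ub; apply: le_trans P.
  apply: (@le_trans _ _ (pair_integral a b x x')).
    have := cavg_sub_le x x' a0 b0; rewrite mulrBr EFinB leeBlDl//.
  apply: le_lower_integral => y.
    by apply: nn_integral_ge0 => y'; rewrite !mulr_ge0.
  apply: nn_integral_le => y'; first by rewrite !mulr_ge0.
  case: (boolP (cell a x y)) => [/Ua ->|_]; last by rewrite mul0r !mulr_ge0.
  by case: (boolP (cell b x' y')) => [/Ub ->|_]; rewrite ?mul0r ?mul1r// mulr_ge0.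
have [_|_] := lerP (cavg l2 f x2) (cavg l1 f x1); first exact: one.
by rewrite mulrC [l1 ^+ n * _]mulrC mulrC; exact: one.
Qed.

Lemma cavg_oscillation l z : 0 < l -> `|f z - cavg l f z| <= n%:R * l * G.
Proof.
move=> l0; have mf := bf.1.
have ln0 : 0 < l ^+ n by rewrite exprn_gt0.
have G0 : 0 <= G by have /andP[/le_trans] := gG z; apply.
have osc y : cell l z y -> `|f y - f z| <= n%:R * l * G.
  move=> zy; have zyz : cell l z (z + (y - z)) by rewrite addrC subrK.
  have gG' x : g x <= G by have /andP[] := gG x.
  have := @increment_bound R n f g (cell l z) fg mg g0
    (@coordinate_convex_cell R n l z l0) G z (y - z) gG' (cell_refl l z) zyz.
  rewrite [z + _]addrC subrK => /le_trans; apply.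
  rewrite -mulr_suml ler_wpM2r//.
  apply: (@le_trans _ _ (\sum_(i < n) l)); last by rewrite sumr_const card_ord mulr_natl.
  by apply: ler_sum => i _; rewrite !mxE distrC; apply: ltW; exact: cell_dist.
set e := n%:R * l * G in osc *.
have e0 : 0 <= e by rewrite !mulr_ge0// ltW.
have mc : measurable_fun setT (fun y => (cell l z y)%:R : R).
  by apply: measurable_bool_natr; exact: mcell.
have C (k : R) : 0 <= k -> (\int[leb]_y ((cell l z y)%:R * k)%:E = (l ^+ n * k)%:E)%E.
  move=> k0; under eq_integral do rewrite mulrC.
  by rewrite nn_integralZl// integral_cell// -EFinM mulrC.
have up : l ^+ n * cavg l f z <= l ^+ n * (f z + e).
  rewrite -lee_fin -integral_cellE// -C ?addr_ge0//.
  apply: nn_integral_le => y; first by rewrite mulr_ge0.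
  case: (boolP (cell l z y)) => [/osc|_]; last by rewrite !mul0r.
  by rewrite !mul1r ler_distl => /andP[_].
have dn : l ^+ n * f z <= l ^+ n * (cavg l f z + e).
  rewrite mulrDr -lee_fin EFinD -integral_cellE// -!C// -nn_integralD//.
  - apply: nn_integral_le => y; first by rewrite mulr_ge0.
    case: (boolP (cell l z y)) => [/osc|_]; last by rewrite !mul0r addr0.
    by rewrite !mul1r ler_distl => /andP[]; rewrite lerBlDr.
  - exact: mcell_mul.
  - by apply: measurable_funM.
  - by move=> y; rewrite mulr_ge0.
  - by move=> y; rewrite mulr_ge0.
move: up dn; rewrite !ler_pM2l// => up dn.
by rewrite ler_norml; apply/andP; split; lra.
Qed.

(** Telescoping from the cube of side [L] down to the scale [J]. *)
Lemma oscillation_telescope L x z J : 0 < L -> ncell L x z ->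
  `|f z - cavg L f x| <= n%:R * scale L J * G +
    (\sum_(j < J) 4 ^+ n * n%:R * (scale L j * cavg (scale L j) g z) +
     6 ^+ n * (3 * n%:R) * (L * navg L g x)).
Proof.
move=> L0 xz; have l0 j : 0 < scale L j by exact: scale_gt0.
have Ln0 : 0 < L ^+ n by rewrite exprn_gt0.
have top : `|cavg L f z - cavg L f x| <= 6 ^+ n * (3 * n%:R) * (L * navg L g x).
  have mU : measurable_fun setT (ncell L x).
    exact: (@measurable_ncell _ _ L _ _ (fun=> x) id).
  have d0 : 0 <= 3 * L by rewrite mulr_ge0// ltW.
  have Uz y : cell L z y -> ncell L x y.
    by move=> zy; rewrite ncell_sym -(ncell_eql _ zy) ncell_sym.
  have := @cavg_diff L L z x (ncell L x) (3 * L) L0 L0 d0 mU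
    (@coordinate_convex_ncell R n L x L0)
    (fun y y' i => @ncell_diam R n L x y y' i L0) Uz
    (fun y => @cell_ncell _ _ L x y).
  rewrite integral_ncellE// -EFinM lee_fin => H.
  rewrite -(ler_pM2l (mulr_gt0 Ln0 Ln0)); apply: le_trans H _.
  rewrite le_eqVlt; apply/orP; left; apply/eqP.
  by rewrite !exprMn (_ : 6 = 2 * 3 :> R) ?exprMn; ring.
have step j : `|cavg (scale L j.+1) f z - cavg (scale L j) f z| <=
    4 ^+ n * n%:R * (scale L j * cavg (scale L j) g z).
  have lj := l0 j; have lj1 := l0 j.+1.
  have := @cavg_diff (scale L j.+1) (scale L j) z z (cell (scale L j) z) (scale L j)
     lj1 lj (ltW lj) (mcell z lj) (@coordinate_convex_cell R n (scale L j) z lj)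
     (fun y y' i => @cell_diam R n (scale L j) z y y' i lj)
     (fun y => @cell_scale R n L j j.+1 z y L0 (leqnSn j)) (fun y => id).
  rewrite integral_cellE// -EFinM lee_fin -(scaleS L j); move: (scale L j.+1) lj1 => l l1 H.
  have ln : 0 < l ^+ n by rewrite exprn_gt0.
  have l2n : 0 < (2 * l) ^+ n by rewrite exprn_gt0// mulr_gt0.
  rewrite -(ler_pM2l (mulr_gt0 ln l2n)); apply: le_trans H _.
  rewrite le_eqVlt; apply/orP; left; apply/eqP.
  by rewrite !exprMn (_ : 4 = 2 * 2 :> R) ?exprMn; ring.
have tele : `|cavg (scale L J) f z - cavg L f z| <=
    \sum_(j < J) 4 ^+ n * n%:R * (scale L j * cavg (scale L j) g z).
  elim: J => [|J IH]; first by rewrite scale0 subrr normr0 big_ord0.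
  rewrite big_ord_recr/= addrC.
  have -> : cavg (scale L J.+1) f z - cavg L f z =
    (cavg (scale L J.+1) f z - cavg (scale L J) f z) +
    (cavg (scale L J) f z - cavg L f z) by ring.
  by apply: le_trans (ler_normD _ _) _; exact: lerD.
have -> : f z - cavg L f x = (f z - cavg (scale L J) f z) +
   ((cavg (scale L J) f z - cavg L f z) + (cavg L f z - cavg L f x)) by ring.
apply: le_trans (ler_normD _ _) _; apply: lerD; first exact: cavg_oscillation.
by apply: le_trans (ler_normD _ _) _; exact: lerD.
Qed.

End oscillation.

(** * Hedberg's interpolation over dyadic scales *)

Section hedberg.
Context (R : realType).

(** Both sides of the peak are geometric series of ratio [rho]. The induction
    needs the bound [B], which keeps track of the side. *)
Lemma sum_geometric_min (rho t : R) J : 0 < rho < 1 -> 0 < t ->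
  \sum_(j < J) Num.min (t * rho ^+ j) (t * rho ^+ j)^-1 <= 2 / (1 - rho).
Proof.
move=> /andP[r0 r1].
have r10 : 0 < 1 - rho by rewrite subr_gt0.
pose B t := if t <= 1 then t / (1 - rho) else (2 - t^-1) / (1 - rho).
suff H u : 0 < u -> \sum_(j < J) Num.min (u * rho ^+ j) (u * rho ^+ j)^-1 <= B u.
  move=> t0; apply: le_trans (H t t0) _; rewrite /B; case: ifP => t1.
    by rewrite ler_pM2r ?invr_gt0// (le_trans t1)// ler1n.
  by rewrite ler_pM2r ?invr_gt0// gerBl invr_ge0 ltW.
elim: J u => [|J IH] u u0.
  rewrite big_ord0 /B; case: ifP => u1; first by rewrite divr_ge0 ?ltW.
  move/negbT: u1; rewrite -ltNge => u1.
  have ui : u^-1 <= 1 by rewrite invf_le1// ltW.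
  by rewrite divr_ge0 ?(ltW r10)//; lra.
rewrite big_ord_recl expr0 mulr1.
have ur0 : 0 < u * rho by rewrite mulr_gt0.
under eq_bigr => j _ do rewrite /= exprS mulrA.
have := IH (u * rho) ur0; set X := \sum_(j < J) _ => HX.
have u1 : u^-1 * u = 1 by rewrite mulVf// gt_eqF.
have [ul|ul] := leP u 1.
  have um : u <= u^-1 by rewrite -(ler_pM2r u0) u1 -expr2 expr_le1// ltW.
  rewrite (min_idPl um) /B ul; move: HX; rewrite /B.
  have -> : u * rho <= 1 by rewrite mulr_ile1// ltW.
  move=> HX; apply: le_trans (lerD (lexx u) HX) _.
  by rewrite le_eqVlt; apply/orP; left; apply/eqP; field; rewrite gt_eqF.
have um : u^-1 <= u by rewrite -(ler_pM2r u0) u1 -expr2 expr_ge1// ltW.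
rewrite (min_idPr um) /B (leNgt u 1) ul/=.
apply: le_trans (lerD (lexx _) HX) _; rewrite /B.
have ui1 : u^-1 <= 1 by rewrite invf_le1// ltW.
rewrite ler_pdivlMr// mulrDl; case: ifP => [url|/negbT]; rewrite divfK ?gt_eqF//.
  suff : 0 <= u * (2 - u^-1 - (u^-1 * (1 - rho) + u * rho)).
    by rewrite pmulr_rge0//; lra.
  have -> : u * (2 - u^-1 - (u^-1 * (1 - rho) + u * rho)) =
      2 * u - u^-1 * u - (u^-1 * u * (1 - rho) + u * u * rho) by ring.
  by rewrite u1; nra.
move=> _; rewrite invfM.
have ri : rho^-1 * rho = 1 by rewrite mulVf// gt_eqF.
have ri1 : 1 <= rho^-1 by rewrite invf_ge1// ltW.
have ui0 : 0 < u^-1 by rewrite invr_gt0.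
have : 0 <= u^-1 * ((1 - rho) * (rho^-1 - 1)).
  by rewrite mulr_ge0 ?(ltW ui0)// mulr_ge0 ?(ltW r10)// subr_ge0.
have -> : (1 - rho) * (rho^-1 - 1) = rho^-1 - 1 - rho^-1 * rho + rho by ring.
by rewrite ri; lra.
Qed.

Context (L M X beta : R) (v : nat -> R).
Hypotheses (L0 : 0 < L) (M0 : 0 <= M) (X0 : 0 < X) (beta0 : 0 < beta).
Local Notation l := (scale L).

Definition hedberg_const : R := 2 / (1 - 2 `^ (- Num.min 1 beta)).

Let ratio_lt1 : 2 `^ (- Num.min 1 beta) < 1 :> R.
Proof.
have b0 : 0 < Num.min 1 beta by rewrite lt_min ltr01 beta0.
rewrite powRN invf_lt1 ?powR_gt0//.
have /(_ _ _ (ltr1n R 2))/= := gt0_ltr_powR b0 (_ : 1 \in Num.nneg) (_ : 2 \in Num.nneg).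
by rewrite powR1; apply; rewrite nnegrE.
Qed.

Lemma hedberg_const_ge0 : 0 <= hedberg_const.
Proof. by rewrite divr_ge0// subr_ge0 ltW// ratio_lt1. Qed.

(** The sum is governed by the scale at which the two bounds on the terms
    coincide. *)
Lemma hedberg_sum J : (forall j, (j < J)%N -> l j * v j <= l j * M) ->
  (forall j, (j < J)%N -> l j * v j <= l j `^ (- beta) * X) ->
  \sum_(j < J) l j * v j <=
  hedberg_const * (M `^ (beta / (1 + beta)) * X `^ (1 / (1 + beta))).
Proof.
move=> vM vX.
have [M00|Mn0] := eqVneq M 0.
  rewrite M00 powR0 ?gt_eqF ?divr_gt0 ?addr_gt0// mul0r mulr0.
  by apply: sumr_le0 => j _; have := vM j (ltn_ord j); rewrite M00 mulr0.
have Mpos : 0 < M by rewrite lt_neqAle eq_sym Mn0.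
have b10 : 0 < 1 + beta by rewrite addr_gt0.
pose rs := (X / M) `^ (1 / (1 + beta)).
have XM0 : 0 < X / M by rewrite divr_gt0.
have rs0 : 0 < rs by exact: powR_gt0.
have rsb : rs `^ (1 + beta) = X / M.
  by rewrite /rs -powRrM div1r mulVf ?gt_eqF// powRr1// ltW.
pose Z := rs * M; have Z0 : 0 < Z by rewrite mulr_gt0.
have ZE : Z = M `^ (beta / (1 + beta)) * X `^ (1 / (1 + beta)).
  rewrite /Z /rs powRM ?(ltW X0) ?invr_ge0//.
  rewrite -(powR_inv1 M0) -powRrM mulN1r.
  have -> : beta / (1 + beta) = - (1 / (1 + beta)) + 1 by field; rewrite gt_eqF.
  by rewrite powRD ?Mn0 ?implybT// powRr1//; ring.
have ZX : rs `^ (- beta) * X = Z.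
  have XE : X = rs * rs `^ beta * M.
    by rewrite -{1}[X](divfK Mn0) -rsb powRD ?gt_eqF ?implybT// powRr1 ?(ltW rs0).
  rewrite /Z powRN {1}XE; field.
  by rewrite gt_eqF// powR_gt0.
pose b := Num.min 1 beta.
have b0 : 0 < b by rewrite lt_min ltr01 beta0.
pose rho := (2 : R) `^ (- b).
have r0 : 0 < rho by exact: powR_gt0.
have r1 : rho < 1 by exact: ratio_lt1.
pose t := (L / rs) `^ b.
have t0 : 0 < t by rewrite powR_gt0// divr_gt0.
have lt j : (l j / rs) `^ b = t * rho ^+ j.
  rewrite /scale mulrAC powRM ?divr_ge0 ?invr_ge0 ?exprn_ge0 ?(ltW L0) ?(ltW rs0)//; congr (_ * _).
  rewrite -(powR_mulrn j (ler0n R 2)) -powRN -powRrM.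
  rewrite -(powR_mulrn j (powR_ge0 2 (- b))) -powRrM.
  by congr (_ `^ _); ring.
rewrite -ZE /hedberg_const -/b -/rho mulrC.
apply: (@le_trans _ _ (\sum_(j < J) Z * Num.min (t * rho ^+ j) (t * rho ^+ j)^-1)); last first.
  rewrite -mulr_sumr ler_pM2l//; apply: sum_geometric_min => //.
  by rewrite r0 r1.
apply: ler_sum => j _.
have lj : 0 < l j by exact: scale_gt0.
pose r := l j / rs; have r_0 : 0 < r by rewrite divr_gt0.
have ljE : l j = r * rs by rewrite /r divfK// gt_eqF.
rewrite -lt -/r -powRN.
have H1 : l j * v j <= Z * r.
  have -> : Z * r = l j * M by rewrite /Z /r; field; rewrite gt_eqF.
  exact: vM.
have H2 : l j * v j <= Z * r `^ (- beta).
  apply: le_trans (vX _ (ltn_ord j)) _.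
  by rewrite [in leLHS]ljE powRM ?(ltW r_0) ?(ltW rs0)// -mulrA ZX mulrC.
have bb : b <= beta by rewrite ge_min lexx orbT.
have b1 : b <= 1 by rewrite ge_min lexx.
have [rl|rg] := leP r 1.
  rewrite (_ : Num.min _ _ = r `^ b).
    apply: le_trans H1 _; rewrite ler_pM2l//.
    rewrite -{1}[r]powRr1 ?(ltW r_0)//; apply: ger_powR => //; exact/andP.
  apply/min_idPl; apply: ger_powR; first exact/andP.
  by rewrite (le_trans _ (ltW b0))// oppr_le0 ltW.
rewrite (_ : Num.min _ _ = r `^ (- b)).
  apply: le_trans H2 _; rewrite ler_pM2l// ler_powR ?(ltW rg)// lerN2.
  exact: bb.
apply/min_idPr; apply: ler_powR; first exact: ltW.
by rewrite (le_trans _ (ltW b0))// oppr_le0 ltW.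
Qed.

End hedberg.

(** * A Sobolev-Poincare inequality in bilinear form *)

Section elementary_hoelder.
Context d (T : measurableType d) (R : realType) (mu : {measure set T -> \bar R}).
Context (k : T -> bool).
Hypothesis mk : measurable_fun setT k.

Let mkr : measurable_fun setT (fun x => (k x)%:R : R).
Proof. exact: measurable_bool_natr. Qed.

Lemma nn_integral_kpow_measurable (h : T -> R) p : measurable_fun setT h ->
  measurable_fun setT (fun x => (k x)%:R * h x `^ p).
Proof.
by move=> mh; apply: measurable_funM => //; exact: (measurableT_comp (measurable_powR _)).
Qed.

(** Jensen's inequality up to a constant, at an arbitrary level [s]. *)
Lemma power_mean (h : T -> R) (q s m Y : R) : 1 <= q -> 0 < s ->
  measurable_fun setT h -> (forall x, 0 <= h x) ->
  (\int[mu]_x (k x)%:R%:E <= m%:E)%E ->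
  (\int[mu]_x ((k x)%:R * h x `^ q)%:E <= Y%:E)%E ->
  (\int[mu]_x ((k x)%:R * h x)%:E <= (s * m + s `^ (1 - q) * Y)%:E)%E.
Proof.
move=> q1 s0 mh h0 km hY.
have H x : h x <= s + s `^ (1 - q) * h x `^ q.
  have [hs|sh] := leP (h x) s.
    by rewrite ler_wpDr// mulr_ge0 ?powR_ge0.
  have hx0 := lt_trans s0 sh.
  rewrite ler_wpDl ?(ltW s0)//.
  have -> : 1 - q = - (q - 1) by ring.
  rewrite powRN ler_pdivlMl ?powR_gt0//.
  apply: (@le_trans _ _ (h x `^ (q - 1) * h x)).
    rewrite ler_wpM2r//; apply: ge0_ler_powR; rewrite ?nnegrE ?subr_ge0//; exact: ltW.
  rewrite -{2}[h x]powRr1// -powRD ?(gt_eqF hx0) ?implybT//.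
  by rewrite subrK.
have E x : (k x)%:R * h x <= s * (k x)%:R + s `^ (1 - q) * ((k x)%:R * h x `^ q).
  apply: le_trans (ler_wpM2l (ler0n _ _) (H x)) _.
  by rewrite le_eqVlt; apply/orP; left; apply/eqP; ring.
apply: (@le_trans _ _ (\int[mu]_x (s * (k x)%:R + s `^ (1 - q) * ((k x)%:R * h x `^ q))%:E)%E).
  by apply: nn_integral_le => // x; rewrite mulr_ge0.
have mkq := nn_integral_kpow_measurable q mh.
have kq0 x : 0 <= (k x)%:R * h x `^ q by rewrite mulr_ge0// powR_ge0.
rewrite nn_integralD//.
- rewrite !nn_integralZl ?(ltW s0) ?powR_ge0// EFinD !EFinM.
  by apply: leeD; rewrite lee_wpmul2l// lee_fin ?powR_ge0// ltW.
- exact: measurable_funM.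
- exact: measurable_funM.
- by move=> x; rewrite mulr_ge0// ltW.
- by move=> x; rewrite mulr_ge0// powR_ge0.
Qed.

(** Young's inequality for [w / N] and [b / X]. *)
Lemma conjugate_pairing (w b : T -> R) (rho r N X Y : R) :
  1 < rho -> 1 < r -> rho^-1 + r^-1 = 1 -> 0 < N -> 0 < X ->
  measurable_fun setT w -> measurable_fun setT b ->
  (forall x, 0 <= w x) -> (forall x, 0 <= b x) ->
  (\int[mu]_x ((k x)%:R * w x `^ rho)%:E <= (N `^ rho)%:E)%E ->
  (\int[mu]_x ((k x)%:R * b x `^ r)%:E <= (Y * X `^ r)%:E)%E ->
  (\int[mu]_x ((k x)%:R * (w x * b x))%:E <= (N * X * (1 + Y))%:E)%E.
Proof.
move=> rho1 r1 conj N0 X0 mw mb w0 b0 wN bX.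
have Np : 0 < N `^ rho by exact: powR_gt0.
have Xp : 0 < X `^ r by exact: powR_gt0.
have rho0 : 0 < rho by exact: lt_trans rho1.
have r0 : 0 < r by exact: lt_trans r1.
have NX0 : 0 <= N * X by rewrite mulr_ge0// ltW.
pose c1 := N * X / N `^ rho; pose c2 := N * X / X `^ r.
have c10 : 0 <= c1 by rewrite divr_ge0// ltW.
have c20 : 0 <= c2 by rewrite divr_ge0// ltW.
have H x : (k x)%:R * (w x * b x) <=
    c1 * ((k x)%:R * w x `^ rho) + c2 * ((k x)%:R * b x `^ r).
  have wN0 : 0 <= w x / N by rewrite divr_ge0// ltW.
  have bX0 : 0 <= b x / X by rewrite divr_ge0// ltW.
  have := conjugate_powR wN0 bX0 rho0 r0 conj.
  rewrite !powRM ?invr_ge0 ?(ltW N0) ?(ltW X0)//.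
  have inv (c p : R) : 0 < c -> c^-1 `^ p = (c `^ p)^-1.
    by move=> c0; rewrite -(powR_inv1 (ltW c0)) -powRrM mulN1r powRN.
  rewrite !inv// => H.
  have {}H : w x / N * (b x / X) <= w x `^ rho / N `^ rho + b x `^ r / X `^ r.
    apply: le_trans H _; apply: lerD.
      by rewrite ler_pdivrMr// ler_peMr ?(ltW rho1)// divr_ge0 ?powR_ge0.
    by rewrite ler_pdivrMr// ler_peMr ?(ltW r1)// divr_ge0 ?powR_ge0.
  have := ler_wpM2l NX0 H.
  have -> : N * X * (w x / N * (b x / X)) = w x * b x.
    by field; rewrite !gt_eqF.
  move=> /(ler_wpM2l (ler0n R (k x)))/le_trans; apply.
  by rewrite le_eqVlt; apply/orP; left; apply/eqP; rewrite /c1 /c2; ring.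
apply: (@le_trans _ _ (\int[mu]_x (c1 * ((k x)%:R * w x `^ rho) +
    c2 * ((k x)%:R * b x `^ r))%:E)%E).
  by apply: nn_integral_le => // x; rewrite mulr_ge0// mulr_ge0.
have mW := nn_integral_kpow_measurable rho mw.
have mB := nn_integral_kpow_measurable r mb.
have W0 x : 0 <= (k x)%:R * w x `^ rho by rewrite mulr_ge0// powR_ge0.
have B0 x : 0 <= (k x)%:R * b x `^ r by rewrite mulr_ge0// powR_ge0.
rewrite nn_integralD//.
- rewrite !nn_integralZl//.
  have -> : N * X * (1 + Y) = c1 * N `^ rho + c2 * (Y * X `^ r).
    by rewrite /c1 /c2; field; rewrite !gt_eqF.
  by rewrite EFinD !EFinM; apply: leeD; rewrite lee_wpmul2l// lee_fin.
- exact: measurable_funM.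
- exact: measurable_funM.
- by move=> x; rewrite mulr_ge0.
- by move=> x; rewrite mulr_ge0.
Qed.

End elementary_hoelder.

Section sobolev_poincare.
Context (R : realType) (n : nat).
Local Notation leb := (lebesgue_rV n).
Context (f g : 'rV[R]_n -> R) (G : R).
Hypotheses (n0 : (0 < n)%N) (bf : bounded_nonneg f) (fg : gradient_bound f g).
Hypotheses (mg : measurable_fun setT g) (gG : forall x, 0 <= g x <= G).

(** The exponents: [r] is the Sobolev exponent of [q], and [rho] is conjugate
    to [r]. *)
Context (q r rho : R).
Hypotheses (q1 : 1 < q) (r1 : 1 < r) (rho1 : 1 < rho).
Hypotheses (rho_r : rho^-1 + r^-1 = 1) (q_r : n%:R / q = n%:R / r + 1).

Context (L X : R) (x : 'rV[R]_n).
Hypotheses (L0 : 0 < L) (X0 : 0 < X).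
Hypothesis gX : (\int[leb]_y ((ncell L x y)%:R * g y `^ q)%:E <= (X `^ q)%:E)%E.
Local Notation l := (scale L).

Let l0 j : 0 < l j. Proof. exact: scale_gt0. Qed.
Let G0 : 0 <= G. Proof. by have /andP[/le_trans] := gG x; apply. Qed.
Let q0 : 0 < q. Proof. exact: lt_trans q1. Qed.
Let r0 : 0 < r. Proof. exact: lt_trans r1. Qed.
Let nR0 : 0 < n%:R :> R. Proof. by rewrite ltr0n. Qed.
Let beta := n%:R / r.
Let beta0 : 0 < beta. Proof. exact: divr_gt0. Qed.
Let b10 : 0 < 1 + beta. Proof. exact: addr_gt0. Qed.
Let theta := beta / (1 + beta).
Let theta_r : theta * r = q.
Proof.
have nq : n%:R = (1 + beta) * q.
  by rewrite addrC -q_r divfK// gt_eqF.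
have nr : n%:R = beta * r by rewrite divfK// gt_eqF.
rewrite /theta mulrAC -nr nq mulrAC mulfV ?mul1r// gt_eqF//.
Qed.

Let gU y : R := (ncell L x y)%:R * g y.

Let mncellx : measurable_fun setT (ncell L x).
Proof. exact: (@measurable_ncell _ _ L _ _ (fun=> x) id). Qed.
Let mcellz (l : R) (z : 'rV[R]_n) : 0 < l -> measurable_fun setT (cell l z).
Proof. by move=> l1; exact: (@measurable_cell _ _ l _ _ (fun=> z) id). Qed.

Let gUG y : 0 <= gU y <= G.
Proof.
by rewrite /gU; case: ncell; rewrite ?mul1r ?mul0r ?lexx ?G0// gG.
Qed.
Let gU0 y : 0 <= gU y. Proof. by have /andP[] := gUG y. Qed.

Let bgU : bounded_nonneg gU.
Proof.
split; last by exists G.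
by apply: measurable_funM => //; exact: measurable_bool_natr.
Qed.

Let bg : bounded_nonneg g. Proof. by split => //; exists G. Qed.

Let gU_pow y : gU y `^ q = (ncell L x y)%:R * g y `^ q.
Proof.
by rewrite /gU; case: ncell; rewrite ?mul1r// !mul0r powR0// gt_eqF.
Qed.

(** By Hoelder's inequality, the averages of [gU] over cubes of side [l] are at
    most of this size. *)
Let level l := l `^ (- (n%:R / q)) * X.

Let level0 l : 0 < l -> 0 < level l.
Proof. by move=> l1; rewrite mulr_gt0// powR_gt0. Qed.

Let levelE l : 0 < l -> level l `^ (1 - q) * X `^ q = l ^+ n * level l.
Proof.
move=> l1; have s0 := level0 l1.
rewrite powRD ?(gt_eqF s0) ?implybT// powRr1 ?(ltW s0)// powRN.
have -> : level l `^ q = (l ^+ n)^-1 * X `^ q.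
  rewrite /level powRM ?powR_ge0 ?(ltW X0)//; congr (_ * _).
  rewrite -powRrM (_ : - (n%:R / q) * q = - n%:R); last first.
    by field; rewrite gt_eqF.
  by rewrite powRN powR_mulrn// ltW.
by field; rewrite !gt_eqF ?powR_gt0 ?exprn_gt0.
Qed.

Let kgX (k : 'rV[R]_n -> bool) :
  (\int[leb]_y ((k y)%:R * gU y `^ q)%:E <= (X `^ q)%:E)%E.
Proof.
apply: le_trans gX; apply: nn_integral_le => y; first by rewrite mulr_ge0// powR_ge0.
rewrite gU_pow; case: (k y); rewrite ?mul1r// mul0r mulr_ge0// powR_ge0//.
Qed.

Let cavg_gU_le l1 z : 0 < l1 -> cavg l1 gU z <= 2 * level l1.
Proof.
move=> l10; have ln0 : 0 < l1 ^+ n by rewrite exprn_gt0.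
rewrite -(ler_pM2l ln0) -lee_fin -integral_cellE//.
have := @power_mean _ _ _ leb (cell l1 z) (mcellz z l10) gU q (level l1) (l1 ^+ n)
  (X `^ q) (ltW q1) (level0 l10) bgU.1 gU0.
rewrite integral_cell// lexx => /(_ isT (kgX _))/le_trans; apply.
by rewrite lee_fin levelE// le_eqVlt; apply/orP; left; apply/eqP; ring.
Qed.

Let navg_g_le : navg L g x <= (3 ^+ n + 1) * level L.
Proof.
have Ln0 : 0 < L ^+ n by rewrite exprn_gt0.
rewrite -(ler_pM2l Ln0) -lee_fin -integral_ncellE//.
have := @power_mean _ _ _ leb (ncell L x) mncellx gU q (level L) (3 ^+ n * L ^+ n)
  (X `^ q) (ltW q1) (level0 L0) bgU.1 gU0 (integral_ncell_le x L0) (kgX _).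
rewrite levelE// => H; apply: (le_trans _ (le_trans H _)).
  apply: nn_integral_le => y; first by rewrite mulr_ge0//; have /andP[] := gG y.
  by rewrite /gU; case: ncell; rewrite ?mul1r// !mul0r.
by rewrite lee_fin le_eqVlt; apply/orP; left; apply/eqP; ring.
Qed.

Let cavg_gU0 j z : ~~ ncell L x z -> cavg (l j) gU z = 0.
Proof.
move=> xz; apply/eqP; rewrite eq_le cavg_ge0// andbT.
have ln0 : 0 < l j ^+ n by rewrite exprn_gt0.
rewrite -(ler_pM2l ln0) mulr0 -lee_fin -integral_cellE//.
rewrite integral0_eq// => y _; rewrite /gU.
case zy: (cell (l j) z y); last by rewrite mul0r.
rewrite (_ : ncell L x y = false) ?mul0r ?mulr0//; apply: contraNF xz => xy.
have := cell_scale L0 (leq0n j) zy; rewrite scale0 cell_sym => yz.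
by rewrite ncell_sym -(ncell_eql _ yz) ncell_sym.
Qed.

Let cavg_gU j z : ncell L x z -> cavg (l j) g z = cavg (l j) gU z.
Proof.
move=> xz; rewrite /cavg /kavg; congr (fine (_ * _)%E).
apply: eq_integral => y _; congr EFin; rewrite /gU.
case zy: (cell (l j) z y); last by rewrite !mul0r.
have := cell_scale L0 (leq0n j) zy; rewrite scale0 => zy'.
by rewrite ncell_sym -(ncell_eql _ zy') ncell_sym xz !mul1r.
Qed.

Variable J : nat.
Local Notation M := (dyadic_max L gU J).

Let M0 z : 0 <= M z. Proof. exact: dyadic_max_ge0. Qed.
Let mM : measurable_fun setT M. Proof. exact: measurable_dyadic_max. Qed.

Let M_out z : ~~ ncell L x z -> M z = 0.
Proof.
move=> xz; elim: J => [|j IH] /=; first exact: cavg_gU0.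
by rewrite IH cavg_gU0// maxxx.
Qed.

Let mMp p : measurable_fun setT (fun z => M z `^ p).
Proof. exact: (measurableT_comp (measurable_powR _)). Qed.

Let Moo : (\int[leb]_z (M z `^ q)%:E < +oo)%E.
Proof.
apply: (@le_lt_trans _ _ (\int[leb]_z (G `^ q * (ncell L x z)%:R)%:E)%E).
  apply: nn_integral_le => z; first exact: powR_ge0.
  case: (boolP (ncell L x z)) => xz; last by rewrite M_out// powR0 ?gt_eqF// mulr0.
  rewrite mulr1; apply: ge0_ler_powR; rewrite ?nnegrE ?(ltW q0)//.
  exact: dyadic_max_le.
rewrite nn_integralZl ?powR_ge0//; last exact: measurable_bool_natr.
apply: (@le_lt_trans _ _ ((G `^ q)%:E * (3 ^+ n * L ^+ n)%:E)%E).
  by rewrite lee_wpmul2l ?lee_fin ?powR_ge0// integral_ncell_le.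
by rewrite -EFinM ltry.
Qed.

Definition doob_const : R := 2 * (q / (q - 1) * (2 * (q / (q - 1))) `^ (q - 1)).

Let q10 : 0 < q - 1. Proof. by rewrite subr_gt0. Qed.

Let doob_const_ge0 : 0 <= doob_const.
Proof. by rewrite mulr_ge0// mulr_ge0 ?powR_ge0// divr_ge0 ?ltW. Qed.

Let intM : (\int[leb]_z (M z `^ q)%:E <= (doob_const * X `^ q)%:E)%E.
Proof.
have qq' : q / (q - 1) * (q - 1) = q by rewrite divfK// gt_eqF.
apply: le_trans (doob_maximal L0 bgU q1 qq' Moo) _.
rewrite [leRHS]EFinM lee_wpmul2l ?lee_fin//.
apply: le_trans gX; apply: nn_integral_le => y; first exact: powR_ge0.
by rewrite gU_pow.
Qed.

(** The power of the maximal function that Hedberg's inequality produces; by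
    [theta_r] its [r]-th power is a multiple of the [q]-th power of [M]. *)
Let pM z : R := M z `^ theta * X `^ (1 - theta).

Let one_theta : 1 / (1 + beta) = 1 - theta.
Proof. by rewrite /theta; field; rewrite gt_eqF. Qed.

Definition sum_const : R := hedberg_const beta * 2 `^ (1 - theta).

Let sum_le_pM z : \sum_(j < J) l j * cavg (l j) gU z <= sum_const * pM z.
Proof.
have X20 : 0 < 2 * X by rewrite mulr_gt0.
have := @hedberg_sum R L (M z) (2 * X) beta (fun j => cavg (l j) gU z) L0 (M0 z) X20
  beta0 J.
rewrite one_theta powRM ?(ltW X0)// -/theta => H.
rewrite /sum_const /pM; apply: le_trans (H _ _) _.
- by move=> j jJ; rewrite ler_pM2l// le_dyadic_max// ltnW.
- move=> j jJ; apply: le_trans (ler_wpM2l (ltW (l0 j)) (cavg_gU_le z (l0 j))) _.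
  rewrite /level q_r -/beta (_ : - (beta + 1) = - beta - 1); last by ring.
  rewrite powRD ?(gt_eqF (l0 j)) ?implybT// powR_inv1 ?(ltW (l0 j))//.
  by rewrite le_eqVlt; apply/orP; left; apply/eqP; field; rewrite gt_eqF.
- by rewrite le_eqVlt; apply/orP; left; apply/eqP; ring.
Qed.

Let pM0 z : 0 <= pM z. Proof. by rewrite mulr_ge0// powR_ge0. Qed.
Let mpM : measurable_fun setT pM. Proof. by apply: measurable_funM. Qed.

Let int_pM : (\int[leb]_z ((ncell L x z)%:R * pM z `^ r)%:E <=
  (doob_const * X `^ r)%:E)%E.
Proof.
have E z : pM z `^ r = X `^ (r - q) * M z `^ q.
  rewrite /pM powRM ?powR_ge0// -!powRrM theta_r mulrBl mul1r theta_r mulrC//.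
under eq_integral do rewrite E.
apply: (@le_trans _ _ (\int[leb]_z (X `^ (r - q) * M z `^ q)%:E)%E).
  apply: nn_integral_le => z; first by rewrite !mulr_ge0 ?powR_ge0.
  by case: ncell; rewrite ?mul1r// mul0r mulr_ge0 ?powR_ge0.
rewrite nn_integralZl ?powR_ge0//; last by move=> z; exact: powR_ge0.
apply: (@le_trans _ _ ((X `^ (r - q))%:E * (doob_const * X `^ q)%:E)%E).
  by rewrite lee_wpmul2l ?lee_fin ?powR_ge0.
rewrite -EFinM lee_fin mulrCA -powRD ?subrK//.
by rewrite (gt_eqF X0) implybT.
Qed.

Let A : R := 4 ^+ n * n%:R * sum_const.
Let kappa : R := 6 ^+ n * (3 * n%:R) * (3 ^+ n + 1).

Definition sobolev_const : R := A * (1 + doob_const) + kappa * (1 + 3 ^+ n).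

Let A0 : 0 <= A.
Proof.
have h0 := hedberg_const_ge0 beta0.
have s0 : 0 <= sum_const by rewrite mulr_ge0 ?powR_ge0.
by rewrite /A mulr_ge0// mulr_ge0// exprn_ge0.
Qed.

Let kappa0 : 0 <= kappa.
Proof.
rewrite /kappa; apply: mulr_ge0; last by rewrite addr_ge0// exprn_ge0.
by rewrite mulr_ge0 ?exprn_ge0// mulr_ge0.
Qed.

Lemma sobolev_const_ge0 : 0 <= sobolev_const.
Proof.
by apply: addr_ge0; apply: mulr_ge0 => //; apply: addr_ge0 => //; rewrite exprn_ge0.
Qed.

Let K0 := L * level L.
Let K00 : 0 <= K0. Proof. by rewrite mulr_ge0 ?ltW// level0. Qed.

Let K0r : K0 `^ r = (L ^+ n)^-1 * X `^ r.
Proof.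
have -> : K0 = L `^ (- beta) * X.
  rewrite /K0 /level q_r -/beta (_ : - (beta + 1) = - beta - 1); last by ring.
  rewrite powRD ?(gt_eqF L0) ?implybT// powR_inv1 ?(ltW L0)//.
  by field; rewrite gt_eqF.
rewrite powRM ?powR_ge0 ?(ltW X0)//; congr (_ * _).
rewrite -powRrM (_ : - beta * r = - n%:R); last by rewrite /beta; field; rewrite gt_eqF.
by rewrite powRN powR_mulrn// ltW.
Qed.

Let oscillation_le z : ncell L x z ->
  `|f z - cavg L f x| <= n%:R * l J * G + (A * pM z + kappa * K0).
Proof.
move=> xz; apply: le_trans (oscillation_telescope bf fg mg gG J L0 xz) _.
rewrite lerD2l; apply: lerD.
  rewrite -mulr_sumr /A -[leRHS]mulrA ler_wpM2l ?mulr_ge0 ?exprn_ge0//.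
  under eq_bigr => j _ do rewrite cavg_gU//.
  exact: sum_le_pM.
rewrite /kappa -[leRHS]mulrA ler_wpM2l//.
rewrite /K0 mulrCA ler_wpM2l ?(ltW L0)//; exact: navg_g_le.
Qed.

(** The term with [W] is the error of stopping at the scale [J]. *)
Lemma sobolev_pairing_scale (w : 'rV[R]_n -> R) N W : 0 < N ->
  measurable_fun setT w -> (forall z, 0 <= w z) ->
  (\int[leb]_z ((ncell L x z)%:R * w z `^ rho)%:E <= (N `^ rho)%:E)%E ->
  (\int[leb]_z ((ncell L x z)%:R * w z)%:E <= W%:E)%E ->
  (\int[leb]_z ((ncell L x z)%:R * (w z * `|f z - cavg L f x|))%:E <=
   (n%:R * l J * G * W + sobolev_const * (N * X))%:E)%E.
Proof.
move=> N0 mw w0 wN wW.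
have mk : measurable_fun setT (fun z => (ncell L x z)%:R : R).
  exact: measurable_bool_natr.
pose e := n%:R * l J * G; have e0 : 0 <= e by rewrite !mulr_ge0// ltW.
have m1 : measurable_fun setT (fun z => (ncell L x z)%:R * w z).
  exact: measurable_funM.
have m2 : measurable_fun setT (fun z => (ncell L x z)%:R * (w z * pM z)).
  by apply: measurable_funM => //; exact: measurable_funM.
have m3 : measurable_fun setT (fun z => (ncell L x z)%:R * (w z * K0)).
  by apply: measurable_funM => //; exact: measurable_funM.
have p1 z : 0 <= (ncell L x z)%:R * w z by exact: mulr_ge0.
have p2 z : 0 <= (ncell L x z)%:R * (w z * pM z) by apply: mulr_ge0 => //; exact: mulr_ge0.
have p3 z : 0 <= (ncell L x z)%:R * (w z * K0) by apply: mulr_ge0 => //; exact: mulr_ge0.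
apply: (@le_trans _ _ (\int[leb]_z (e * ((ncell L x z)%:R * w z) +
    (A * ((ncell L x z)%:R * (w z * pM z)) +
     kappa * ((ncell L x z)%:R * (w z * K0))))%:E)%E).
  apply: nn_integral_le => z; first by rewrite mulr_ge0// mulr_ge0.
  case: (boolP (ncell L x z)) => xz; last by rewrite !mul0r !mulr0 !addr0.
  rewrite !mul1r; have := ler_wpM2l (w0 z) (oscillation_le xz).
  move=> /le_trans; apply.
  by rewrite le_eqVlt; apply/orP; left; apply/eqP; rewrite /e; ring.
rewrite nn_integralD//; last 4 first.
- exact: measurable_funM.
- by apply: measurable_funD; exact: measurable_funM.
- by move=> z; exact: mulr_ge0.
- by move=> z; apply: addr_ge0; exact: mulr_ge0.
rewrite nn_integralD//; last 4 first.
- exact: measurable_funM.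
- exact: measurable_funM.
- by move=> z; exact: mulr_ge0.
- by move=> z; exact: mulr_ge0.
rewrite !nn_integralZl// -/e.
have -> : ((e * W + sobolev_const * (N * X))%:E =
  e%:E * W%:E + (sobolev_const * (N * X))%:E)%E by rewrite EFinD EFinM.
apply: leeD.
  by rewrite lee_wpmul2l ?lee_fin.
have -> : sobolev_const * (N * X) =
    A * (N * X * (1 + doob_const)) + kappa * (N * X * (1 + 3 ^+ n)).
  by rewrite /sobolev_const; ring.
rewrite EFinD ![(_ * (N * X * _))%:E]EFinM.
apply: leeD; rewrite lee_wpmul2l ?lee_fin//.
  exact: (@conjugate_pairing _ _ _ leb (ncell L x) mncellx w pM rho r N X doob_const).
apply: (@conjugate_pairing _ _ _ leb (ncell L x) mncellx w (fun=> K0) rho r N X (3 ^+ n)) => //.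
under eq_integral do rewrite mulrC.
rewrite nn_integralZl ?powR_ge0// K0r.
apply: (@le_trans _ _ (((L ^+ n)^-1 * X `^ r)%:E * (3 ^+ n * L ^+ n)%:E)%E).
  rewrite lee_wpmul2l ?lee_fin ?mulr_ge0 ?invr_ge0 ?exprn_ge0 ?powR_ge0 ?(ltW L0)//.
  exact: integral_ncell_le.
rewrite -EFinM lee_fin le_eqVlt; apply/orP; left; apply/eqP; field.
by rewrite expf_neq0// gt_eqF.
Qed.

End sobolev_poincare.

Section sobolev_pairing.
Context (R : realType) (n : nat).
Local Notation leb := (lebesgue_rV n).

Lemma scale_cvg0 (L e : R) : 0 < e -> exists J, scale L J < e.
Proof.
move=> e0; have [J LJ] : exists J : nat, L / e < 2 ^+ J.
  exists (Num.truncn (L / e)).+1; apply: lt_le_trans (truncnS_gt _) _.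
  by rewrite -natrX ler_nat ltnW// ltn_expl.
exists J; rewrite /scale ltr_pdivrMr ?exprn_gt0// mulrC.
by move: LJ; rewrite ltr_pdivrMr.
Qed.

(** The constant [cavg L f x] is independent of the pairing, and the estimate is
    invariant under dilations. *)
Lemma sobolev_pairing (f g : 'rV[R]_n -> R) (G q r rho L X N : R)
    (x : 'rV[R]_n) (w : 'rV[R]_n -> R) :
  (0 < n)%N -> bounded_nonneg f -> gradient_bound f g ->
  measurable_fun setT g -> (forall x, 0 <= g x <= G) ->
  1 < q -> 1 < r -> 1 < rho -> rho^-1 + r^-1 = 1 -> n%:R / q = n%:R / r + 1 ->
  0 < L -> 0 < X -> 0 < N ->
  (\int[leb]_y ((ncell L x y)%:R * g y `^ q)%:E <= (X `^ q)%:E)%E ->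
  measurable_fun setT w -> (forall z, 0 <= w z) ->
  (\int[leb]_z ((ncell L x z)%:R * w z `^ rho)%:E <= (N `^ rho)%:E)%E ->
  (\int[leb]_z ((ncell L x z)%:R * (w z * `|f z - cavg L f x|))%:E <=
   (sobolev_const n q r * (N * X))%:E)%E.
Proof.
move=> n0 bf fg mg gG q1 r1 rho1 rho_r q_r L0 X0 N0 gX mw w0 wN.
have mk : measurable_fun setT (ncell L x).
  exact: (@measurable_ncell _ _ L _ _ (fun=> x) id).
have wW := power_mean mk (ltW rho1) ltr01 mw w0 (integral_ncell_le x L0) wN.
set W := (X in (_ <= X%:E)%E) in wW.
have H J := sobolev_pairing_scale n0 bf fg mg gG q1 r1 rho1 rho_r q_r L0 X0 gX J N0 mw w0 wN wW.
have I0 : (0 <= \int[leb]_z ((ncell L x z)%:R * (w z * `|f z - cavg L f x|))%:E)%E.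
  by apply: nn_integral_ge0 => z; rewrite mulr_ge0// mulr_ge0.
move: I0 H; case: (\int[leb]_z _)%E => [i| |]// i0 H; last by have := H 0%N; rewrite leye_eq.
rewrite lee_fin; apply/ler_addgt0Pr => e e0.
have G0 : 0 <= G by have /andP[/le_trans] := gG x; apply.
pose D := n%:R * G * `|W|.
have D0 : 0 <= D by rewrite !mulr_ge0.
have [J LJ] := scale_cvg0 L (divr_gt0 e0 (ltr_wpDl D0 ltr01)).
have := H J; rewrite lee_fin => /le_trans; apply; rewrite addrC lerD2l.
apply: (@le_trans _ _ (scale L J * D)).
  rewrite /D (_ : n%:R * scale L J * G * W = scale L J * (n%:R * G * W)); last by ring.
  rewrite ler_wpM2l ?(ltW (scale_gt0 _ L0))//.
  by rewrite ler_wpM2l ?mulr_ge0// ler_norm.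
apply: (@le_trans _ _ (e / (D + 1) * D)); first by rewrite ler_wpM2r// ltW.
rewrite mulrAC ler_pdivrMr ?ltr_wpDl// ler_pM2l//.
by rewrite lerDl.
Qed.

End sobolev_pairing.

(** * Homogeneous functions of degree zero *)

Lemma integral_interval (R : realType) (c m : R) : 0 <= c -> 0 <= m ->
  (\int[lebesgue_measure]_s (c * (0 < s <= m)%R%:R)%:E = (c * m)%:E)%E.
Proof.
move=> c0 m0; rewrite nn_integralZl//; last first.
  apply: measurable_bool_natr.
  by apply: measurable_and; [exact: measurable_fun_ltr|exact: measurable_fun_ler].
rewrite EFinM; congr (_ * _)%E.
transitivity (\int[@lebesgue_measure R]_s (\1_(`]0, m]%classic) s)%:E)%E.
  apply: eq_integral => s _; rewrite indicE; congr (nat_of_bool _)%:R%:E.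
  by apply/idP/idP => [h|/set_mem//]; apply/mem_set.
rewrite integral_indic// setIT [LHS](lebesgue_measure_itv `]_, _])/= lte_fin.
case: ltP => [_|m0']; first by rewrite -EFinB subr0.
by congr EFin; apply/eqP; rewrite eq_le m0 m0'.
Qed.

Section homogeneous.
Context (R : realType) (n : nat).
Local Notation leb := (lebesgue_rV n).
Implicit Types (y : 'rV[R]_n) (t a b : R).

Lemma enorm_ge0 y : 0 <= enorm y. Proof. exact: sqrtr_ge0. Qed.

Lemma enormZ t y : 0 <= t -> enorm (t *: y) = t * enorm y.
Proof.
move=> t0; rewrite /enorm.
under eq_bigr do rewrite mxE exprMn.
by rewrite -mulr_sumr sqrtrM ?sqr_ge0// sqrtr_sqr ger0_norm.
Qed.

Lemma directionZ t y : 0 < t -> direction (t *: y) = direction y.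
Proof.
move=> t0; rewrite /direction enormZ ?(ltW t0)// scalerA; congr (_ *: _).
by rewrite invfM mulrAC mulVf ?mul1r// gt_eqF.
Qed.

Lemma coord_le_enorm y i : `|y 0 i| <= enorm y.
Proof.
rewrite /enorm -sqrtr_sqr ler_wsqrtr// (bigD1 i)//= lerDl.
by apply: sumr_ge0 => j _; exact: sqr_ge0.
Qed.

Definition annulus a b y : bool := a < enorm y <= b.

Lemma measurable_annulus a b d (T : measurableType d) (f : T -> 'rV[R]_n) :
  measurable_fun setT f -> measurable_fun setT (fun u : T => annulus a b (f u)).
Proof.
move=> mf; have me : measurable_fun setT (fun u : T => enorm (f u)).
  exact: (measurableT_comp measurable_enorm).
by apply: measurable_and; [exact: measurable_fun_ltr|exact: measurable_fun_ler].
Qed.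

Section radial.
Context (G : 'rV[R]_n -> R).
Hypotheses (mG : measurable_fun setT G) (G0 : forall y, 0 <= G y).

Let mGd : measurable_fun setT (fun y => G (direction y)).
Proof. exact: (measurableT_comp mG measurable_direction). Qed.

Let mGa a b : measurable_fun setT (fun y => (annulus a b y)%:R * G (direction y)).
Proof.
by apply: measurable_funM => //; apply: measurable_bool_natr; exact: measurable_annulus.
Qed.

Let Ga0 a b y : 0 <= (annulus a b y)%:R * G (direction y).
Proof. exact: mulr_ge0. Qed.

Lemma integral_sphere :
  (\int[@sphere_measure R n]_u (G u)%:E =
   n%:R%:E * \int[leb]_y ((annulus 0 1 y)%:R * G (direction y))%:E)%E.
Proof.
have mGE : measurable_fun setT (EFin \o G) by exact/measurable_EFinP.
rewrite (@ge0_integral_pushforward _ _ _ _ R _ (@measurable_direction R n)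
  (mscale n%:R%:nng (mrestr leb (@measurable_punctured_ball R n))))//; last first.
  by move=> y _; rewrite lee_fin.
rewrite preimage_setT ge0_integral_mscale//; last 2 first.
- exact/measurable_EFinP.
- by move=> y _ /=; rewrite lee_fin.
congr (_ * _)%E; rewrite ge0_integral_mrestr//; last 2 first.
- exact/measurable_EFinP.
- by move=> y /=; rewrite lee_fin.
rewrite integral_mkcond; apply: eq_integral => y _.
rewrite /patch/=; case: ifPn => [/set_mem|].
  by rewrite /punctured_ball/= /annulus => ->; rewrite mul1r.
move=> /negP; case E: (annulus 0 1 y); last by rewrite mul0r.
by move=> []; apply/mem_set.
Qed.

Lemma integral_ball t : 0 < t ->
  (\int[leb]_y ((annulus 0 t y)%:R * G (direction y))%:E =
   (t ^+ n)%:E * \int[leb]_y ((annulus 0 1 y)%:R * G (direction y))%:E)%E.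
Proof.
move=> t0; have ti0 : 0 < t^-1 by rewrite invr_gt0.
have := @integral_dilate R n t^-1
  (fun y => ((annulus 0 1 y)%:R * G (direction y))%:E) ti0.
rewrite exprVn invrK => <-.
- apply: eq_integral => y _; rewrite directionZ//; congr ((nat_of_bool _)%:R * _)%:E.
  rewrite /annulus enormZ ?(ltW ti0)//.
  by rewrite pmulr_rgt0// ler_pdivrMl// mulr1.
- exact/measurable_EFinP.
- by move=> y; rewrite lee_fin.
Qed.

Hypothesis Goo : (\int[leb]_y ((annulus 0 1 y)%:R * G (direction y))%:E < +oo)%E.
Let I := fine (\int[leb]_y ((annulus 0 1 y)%:R * G (direction y))%:E)%E.

Lemma integral_annulus a b : 0 < a -> a <= b ->
  (\int[leb]_y ((annulus a b y)%:R * G (direction y))%:E =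
   ((b ^+ n - a ^+ n) * I)%:E)%E.
Proof.
move=> a0 ab; have b0 := lt_le_trans a0 ab.
have IE : (\int[leb]_y ((annulus 0 1 y)%:R * G (direction y))%:E = I%:E)%E.
  by rewrite /I fineK// ge0_fin_numE//; apply: nn_integral_ge0 => y.
have := integral_ball b0; rewrite IE.
have -> : (\int[leb]_y ((annulus 0 b y)%:R * G (direction y))%:E =
    \int[leb]_y ((annulus 0 a y)%:R * G (direction y))%:E +
    \int[leb]_y ((annulus a b y)%:R * G (direction y))%:E)%E.
  rewrite -nn_integralD//.
  apply: eq_integral => y _; rewrite -mulrDl.
  congr (_ * _)%:E; rewrite /annulus.
  have [ya|ya] := leP (enorm y) a.
    by rewrite (le_trans ya ab) !andbT addr0.
  by rewrite (lt_trans a0 ya) /= add0r.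
rewrite integral_ball// IE; set Z := (\int[leb]_y _)%E.
case: Z => [z| |]//; rewrite -!EFinM//.
by rewrite -EFinD => -[] H; congr EFin; rewrite mulrBl -H; ring.
Qed.

End radial.

(** The power [|y|^-n] is written as the length of an interval. For each point
    [s] of that interval the condition [s <= |y|^-n] cuts out a smaller annulus,
    on which the integral of a homogeneous function is a multiple of its
    integral over the unit ball. *)
Lemma balanced_annulus (G1 G2 : 'rV[R]_n -> R) a b :
  measurable_fun setT G1 -> measurable_fun setT G2 ->
  (forall y, 0 <= G1 y) -> (forall y, 0 <= G2 y) -> (0 < n)%N -> 0 < a ->
  (\int[leb]_y ((annulus 0 1 y)%:R * G1 (direction y))%:E < +oo)%E ->
  (\int[leb]_y ((annulus 0 1 y)%:R * G1 (direction y))%:E =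
   \int[leb]_y ((annulus 0 1 y)%:R * G2 (direction y))%:E)%E ->
  (\int[leb]_y ((annulus a b y)%:R * (G1 (direction y) / enorm y ^+ n))%:E =
   \int[leb]_y ((annulus a b y)%:R * (G2 (direction y) / enorm y ^+ n))%:E)%E.
Proof.
move=> mG1 mG2 G10 G20 n0 a0 G1oo G12.
pose cut s y : bool := (0 < s) && (s * enorm y ^+ n <= 1).
have mcut : measurable_fun setT (fun p : 'rV[R]_n * R => cut p.2 p.1).
  apply: measurable_and; first exact: measurable_fun_ltr.
  apply: measurable_fun_ler => //; apply: measurable_funM => //.
  by apply: measurable_funX; exact: (measurableT_comp measurable_enorm).
have layer (G : 'rV[R]_n -> R) : measurable_fun setT G -> (forall y, 0 <= G y) ->
  (\int[leb]_y ((annulus a b y)%:R * (G (direction y) / enorm y ^+ n))%:E =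
   \int[lebesgue_measure]_s \int[leb]_y ((annulus a b y)%:R *
     (G (direction y) * (cut s y)%:R))%:E)%E.
  move=> mG G0.
  have mGd : measurable_fun setT (fun y => G (direction y)).
    exact: (measurableT_comp mG measurable_direction).
  have mF : measurable_fun setT (fun p : 'rV[R]_n * R =>
      ((annulus a b p.1)%:R * (G (direction p.1) * (cut p.2 p.1)%:R))%:E).
    apply/measurable_EFinP; apply: measurable_funM.
      by apply: measurable_bool_natr; exact: measurable_annulus.
    apply: measurable_funM; first exact: (measurableT_comp mGd).
    exact: measurable_bool_natr.
  rewrite -(@fubini_tonelli _ _ 'rV[R]_n (measurableTypeR R) R leb lebesgue_measure
    (fun p => ((annulus a b p.1)%:R * (G (direction p.1) * (cut p.2 p.1)%:R))%:E) mF).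
    apply: eq_integral => y _ /=; case: (boolP (annulus a b y)); last first.
      by rewrite mul0r => _; under eq_integral do rewrite mul0r; rewrite integral0.
    move=> /andP[ay _]; have y0 : 0 < enorm y ^+ n by rewrite exprn_gt0// (lt_trans a0).
    rewrite mul1r -integral_interval ?invr_ge0 ?(ltW y0)//.
    apply: eq_integral => s _; rewrite mul1r; congr (_ * (nat_of_bool _)%:R)%:E.
    by rewrite /cut -ler_pdivlMr// mul1r.
  by move=> p; rewrite lee_fin mulr_ge0// mulr_ge0.
rewrite (layer _ mG1 G10) (layer _ mG2 G20); apply: eq_integral => s _.
have [s0|s0] := leP s 0.
  by congr integral; apply/funext => y; rewrite /cut ltNge s0 /= !mulr0.
pose tau := s `^ (- n%:R^-1).
have tau0 : 0 < tau by exact: powR_gt0.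
have tauE : tau ^+ n = s^-1.
  rewrite -powR_mulrn ?(ltW tau0)// /tau -powRrM mulNr mulVf ?pnatr_eq0 -?lt0n//.
  by rewrite powR_inv1// ltW.
have cutE y : cut s y = (enorm y <= tau).
  rewrite /cut s0/= -[RHS](@ler_pXn2r _ n)// ?nnegrE ?enorm_ge0 ?(ltW tau0)//.
  by rewrite tauE -[s^-1]mulr1 ler_pdivlMl.
have inner (G : 'rV[R]_n -> R) :
  (\int[leb]_y ((annulus a b y)%:R * (G (direction y) * (cut s y)%:R))%:E =
   \int[leb]_y ((annulus a (Num.min b tau) y)%:R * G (direction y))%:E)%E.
  apply: eq_integral => y _; rewrite cutE /annulus le_min.
  by case: (_ < _); case: (_ <= b); case: (_ <= tau); rewrite /= ?mul0r ?mulr0 ?mulr1.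
rewrite !inner; have [ab|ba] := leP a (Num.min b tau).
  by rewrite (integral_annulus mG1)// (integral_annulus mG2) -?G12.
rewrite !integral0_eq// => y _.
  rewrite (_ : annulus _ _ _ = false) ?mul0r//; apply/negP => /andP[ay yb].
  by have := lt_le_trans ay yb; rewrite ltNge (ltW ba).
rewrite (_ : annulus _ _ _ = false) ?mul0r//; apply/negP => /andP[ay yb].
by have := lt_le_trans ay yb; rewrite ltNge (ltW ba).
Qed.

End homogeneous.

(** * Truncations of the singular integral *)

Section truncation.
Context (R : realType) (n : nat).
Local Notation leb := (lebesgue_rV n).
Implicit Types (x y z : 'rV[R]_n) (l a : R).

Context (Om : 'rV[R]_n -> R) (rho P : R).
Hypotheses (mOm : measurable_fun setT Om) (n0 : (0 < n)%N) (rho1 : 1 < rho) (P0 : 0 < P).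
Hypothesis OmP : (\int[leb]_y ((annulus 0 1 y)%:R * `|Om (direction y)| `^ rho)%:E
  <= (P `^ rho)%:E)%E.

Let mOmd : measurable_fun setT (fun y => Om (direction y)).
Proof. exact: (measurableT_comp mOm measurable_direction). Qed.

Let mOmn : measurable_fun setT (fun y => `|Om (direction y)|).
Proof. exact: measurableT_comp. Qed.

Let mOmr : measurable_fun setT (fun y => `|Om y| `^ rho).
Proof. by apply: (measurableT_comp (measurable_powR rho)); exact: measurableT_comp. Qed.

Let measurable_annulus_id a l : measurable_fun setT (annulus a l : 'rV[R]_n -> bool).
Proof. exact: (@measurable_annulus R n a l _ _ id). Qed.

Lemma integral_ball_rough l : 0 < l ->
  (\int[leb]_y ((annulus 0 l y)%:R * `|Om (direction y)| `^ rho)%:E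
   <= (l ^+ n * P `^ rho)%:E)%E.
Proof.
move=> l0; rewrite (@integral_ball R n (fun u => `|Om u| `^ rho))//.
by rewrite EFinM; apply: lee_wpmul2l => //; rewrite lee_fin exprn_ge0// ltW.
Qed.

Lemma annulus_ncell l x y : 0 < l -> annulus 0 l (x - y) -> ncell l x y.
Proof.
move=> l0 /andP[_ xyl]; apply: dist_ncell => // i.
by have := coord_le_enorm (x - y) i; rewrite !mxE => /le_trans; apply.
Qed.

Lemma integral_ball_rough_fin l : 0 < l ->
  (\int[leb]_y ((annulus 0 l y)%:R * `|Om (direction y)|)%:E < +oo)%E.
Proof.
move=> l0.
have m1 : (\int[leb]_y ((annulus 0 l y)%:R)%:E <= (3 ^+ n * l ^+ n)%:E)%E.
  rewrite -(@integral_reflect R n 0 (fun y => (annulus 0 l y)%:R%:E))//; last first.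
    by apply/measurable_EFinP; apply: measurable_bool_natr; exact: measurable_annulus_id.
  apply: le_trans (integral_ncell_le 0 l0); apply: nn_integral_le => // y.
  by rewrite ler_nat; case E: (annulus _ _ _) => //; rewrite (annulus_ncell l0 E).
have := @power_mean _ _ _ leb _ (@measurable_annulus_id 0 l) _ rho 1 _ _ (ltW rho1) ltr01
  mOmn (fun y => normr_ge0 _) m1 (integral_ball_rough l0).
by move=> /le_lt_trans; apply; exact: ltry.
Qed.

Section piece.
Context (f g : 'rV[R]_n -> R) (G q r p : R).
Hypotheses (bf : bounded_nonneg f) (fg : gradient_bound f g).
Hypotheses (mg : measurable_fun setT g) (gG : forall x, 0 <= g x <= G).
Hypotheses (q1 : 1 < q) (r1 : 1 < r) (rhor : rho^-1 + r^-1 = 1).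
Hypotheses (qr : n%:R / q = n%:R / r + 1) (qp : q <= p).

Definition truncation_const : R := 2 ^+ n * sobolev_const n q r * (3 ^+ n + 1) `^ q^-1.

(** The jump to a larger exponent: averages of [g ^ q] are at most those of
    [g ^ p] raised to the power [q / p]. The number [e] keeps the average
    positive. *)
Lemma integral_ncell_power l x e : 0 < l -> 0 < e ->
  bounded_nonneg (fun y => g y `^ p) ->
  (\int[leb]_y ((ncell l x y)%:R * g y `^ q)%:E <=
   ((((3 ^+ n + 1) * l ^+ n) `^ q^-1 *
     (navg l (fun y => g y `^ p) x `^ p^-1 + e)) `^ q)%:E)%E.
Proof.
move=> l0 e0 bgp; have q0 : 0 < q by exact: lt_trans q1.
have p0 : 0 < p by exact: lt_le_trans qp.
set v := navg _ _ _; have v0 : 0 <= v by exact: navg_ge0.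
set t := v `^ p^-1; have t0 : 0 <= t by exact: powR_ge0.
have te0 : 0 < t + e by rewrite ltr_wpDl.
have vt : v = t `^ p by rewrite /t -powRrM mulVf ?gt_eqF// powRr1.
have c0 : (0 : R) <= 3 ^+ n + 1 by rewrite addr_ge0// exprn_ge0.
have ln0 : 0 <= l ^+ n by rewrite exprn_ge0// ltW.
rewrite [X in (_ <= X%:E)%E]powRM ?powR_ge0 ?(ltW te0)//.
rewrite -powRrM mulVf ?gt_eqF// powRr1; last exact: mulr_ge0.
have mk : measurable_fun setT (fun y => ncell l x y) by exact: measurable_ncell.
have gqp y : (g y `^ q) `^ (p / q) = g y `^ p.
  by rewrite -powRrM mulrC divfK// gt_eqF.
have Y : (\int[leb]_y ((ncell l x y)%:R * (g y `^ q) `^ (p / q))%:E <= (l ^+ n * t `^ p)%:E)%E.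
  rewrite -vt -(integral_ncellE x l0 bgp) le_eqVlt; apply/orP; left; apply/eqP.
  by apply: eq_integral => y _; rewrite gqp.
have s0 : 0 < (t + e) `^ q by exact: powR_gt0.
have pq : 1 <= p / q by rewrite ler_pdivlMr// mul1r.
have mgq : measurable_fun setT (fun y => g y `^ q).
  by apply: (measurableT_comp (measurable_powR q)).
have := @power_mean _ _ _ leb _ mk _ (p / q) ((t + e) `^ q) _ _ pq s0 mgq
  (fun y => powR_ge0 _ _) (integral_ncell_le x l0) Y.
move=> /le_trans; apply; rewrite lee_fin.
rewrite mulrDl mul1r [leRHS]mulrDl; apply: lerD; first by rewrite mulrC.
rewrite mulrCA ler_wpM2l// -powRrM mulrBr mulr1 [q * (p / q)]mulrC divfK ?gt_eqF//.
apply: (@le_trans _ _ ((t + e) `^ (q - p) * (t + e) `^ p)).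
  apply: ler_wpM2l; first exact: powR_ge0.
  by apply: ge0_ler_powR; rewrite ?nnegrE ?(ltW p0) ?(ltW te0)// lerDl ltW.
by rewrite -powRD ?subrK//; apply/implyP => _; rewrite gt_eqF.
Qed.

Lemma annulus_difference_le l a x : 0 < l -> l / 2 <= a ->
  bounded_nonneg (fun y => g y `^ p) ->
  (\int[leb]_y ((annulus a l y)%:R * (`|Om (direction y)| / enorm y ^+ n
      * `|f (x - y) - cavg l f x|))%:E <=
   (truncation_const * P * scale_term (fun y => g y `^ p) p l x)%:E)%E.
Proof.
move=> l0 la bgp; have q0 : 0 < q by exact: lt_trans q1.
have rho0 : 0 < rho by exact: lt_trans rho1.
pose w z := (annulus 0 l (x - z))%:R * `|Om (direction (x - z))|.
have mw : measurable_fun setT w.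
  apply: measurable_funM.
    by apply: measurable_bool_natr; apply: measurable_annulus; exact: measurable_rVB.
  by apply: (measurableT_comp mOmn); exact: measurable_rVB.
have w0 z : 0 <= w z by exact: mulr_ge0.
have mf : measurable_fun setT f by case: bf.
have ln0 : 0 < l ^+ n by exact: exprn_gt0.
pose N := (l ^+ n) `^ rho^-1 * P.
have N0 : 0 < N by rewrite mulr_gt0// powR_gt0.
have wN : (\int[leb]_z ((ncell l x z)%:R * w z `^ rho)%:E <= (N `^ rho)%:E)%E.
  rewrite powRM ?powR_ge0 ?(ltW P0)// -powRrM mulVf ?gt_eqF// powRr1 ?(ltW ln0)//.
  apply: le_trans (integral_ball_rough l0).
  rewrite -(@integral_reflect R n x
    (fun y => ((annulus 0 l y)%:R * `|Om (direction y)| `^ rho)%:E)); last 2 first.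
  - apply/measurable_EFinP; apply: measurable_funM.
      by apply: measurable_bool_natr; exact: measurable_annulus_id.
    exact: (measurableT_comp (measurable_powR rho)).
  - by move=> y; rewrite lee_fin mulr_ge0// powR_ge0.
  apply: nn_integral_le => z; first by rewrite mulr_ge0// powR_ge0.
  rewrite /w; case: (annulus _ _ _); last first.
    by rewrite !mul0r powR0 ?gt_eqF// mulr0.
  rewrite !mul1r; case: (ncell _ _ _); rewrite ?mul1r// mul0r; exact: powR_ge0.
have first_step : (\int[leb]_y ((annulus a l y)%:R * (`|Om (direction y)| / enorm y ^+ n
      * `|f (x - y) - cavg l f x|))%:E <=
    ((2 / l) ^+ n)%:E * \int[leb]_z ((ncell l x z)%:R * (w z * `|f z - cavg l f x|))%:E)%E.
  rewrite -nn_integralZl; last 3 first.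
  - by rewrite exprn_ge0// divr_ge0// ltW.
  - apply: measurable_funM; first by apply: measurable_bool_natr; exact: measurable_ncell.
    by apply: measurable_funM => //; apply: measurableT_comp => //; exact: measurable_funB.
  - by move=> z; rewrite mulr_ge0// mulr_ge0.
  rewrite -(@integral_reflect R n x (fun z => ((2 / l) ^+ n *
    ((ncell l x z)%:R * (w z * `|f z - cavg l f x|)))%:E)); last 2 first.
  - apply/measurable_EFinP; apply: measurable_funM => //.
    apply: measurable_funM; first by apply: measurable_bool_natr; exact: measurable_ncell.
    by apply: measurable_funM => //; apply: measurableT_comp => //; exact: measurable_funB.
  - move=> z; rewrite lee_fin mulr_ge0//; first by rewrite exprn_ge0// divr_ge0// ltW.
    by rewrite mulr_ge0// mulr_ge0.
  apply: nn_integral_le => y.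
    by rewrite mulr_ge0// mulr_ge0// divr_ge0// exprn_ge0// enorm_ge0.
  case: (boolP (annulus a l y)); last first.
    move=> _; rewrite mul0r mulr_ge0//; first by rewrite exprn_ge0// divr_ge0// ltW.
    by rewrite mulr_ge0// mulr_ge0.
  move=> /andP[ay yl]; have ly : l / 2 < enorm y by exact: le_lt_trans ay.
  have l20 : 0 < l / 2 by rewrite divr_gt0.
  have y0 : 0 < enorm y by exact: lt_trans ly.
  have E : annulus 0 l (x - (x - y)) by rewrite subKr /annulus y0.
  rewrite (annulus_ncell l0 E) /w E subKr !mul1r.
  rewrite [leRHS]mulrA; apply: ler_wpM2r => //.
  rewrite [leRHS]mulrC; apply: ler_wpM2l => //.
  rewrite -exprVn ler_pXn2r ?nnegrE ?invr_ge0 ?divr_ge0 ?(ltW y0) ?(ltW l0)//.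
  by rewrite -invf_div lef_pV2 ?posrE//; exact: ltW.
set v := scale_term _ _ _ _.
have K0 : 0 <= truncation_const * P.
  rewrite mulr_ge0 ?(ltW P0)//; apply: mulr_ge0; last exact: powR_ge0.
  by rewrite mulr_ge0 ?exprn_ge0// sobolev_const_ge0.
suff main e : 0 < e -> (\int[leb]_y ((annulus a l y)%:R * (`|Om (direction y)| / enorm y ^+ n
      * `|f (x - y) - cavg l f x|))%:E <= (truncation_const * P * (v + l * e))%:E)%E.
  apply/lee_addgt0Pr => e e0; pose d := e / (l * (truncation_const * P + 1)).
  have K10 : 0 < truncation_const * P + 1 by rewrite ltr_wpDl.
  have d0 : 0 < d by rewrite divr_gt0// mulr_gt0.
  apply: le_trans (main d d0) _; rewrite -EFinD lee_fin mulrDr lerD2l.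
  have -> : l * d = e / (truncation_const * P + 1).
    by rewrite /d invfM mulrCA mulVKf// gt_eqF.
  by rewrite mulrA ler_pdivrMr// mulrC ler_wpM2l ?(ltW e0)// lerDl.
move=> e0; pose X := ((3 ^+ n + 1) * l ^+ n) `^ q^-1 *
     (navg l (fun y => g y `^ p) x `^ p^-1 + e).
have c0 : (0 : R) < 3 ^+ n + 1 by rewrite ltr_pwDr// exprn_ge0.
have X0 : 0 < X by rewrite mulr_gt0 ?powR_gt0 ?mulr_gt0// ltr_wpDl// powR_ge0.
have sobX := integral_ncell_power x l0 e0 bgp.
have sob := @sobolev_pairing R n f g G q r rho l X N x w n0 bf fg mg gG q1 r1 rho1 rhor qr
  l0 X0 N0 sobX mw w0 wN.
have l2n : (0 <= ((2 / l) ^+ n)%:E)%E by rewrite lee_fin exprn_ge0// divr_ge0// ltW.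
apply: le_trans first_step _; apply: le_trans (lee_wpmul2l l2n sob) _.
rewrite -EFinM lee_fin le_eqVlt; apply/orP; left; apply/eqP.
rewrite /X /N /truncation_const /v /scale_term.
set T := navg _ _ _ `^ _.
have lE : (l ^+ n) `^ rho^-1 * (l ^+ n) `^ q^-1 = l ^+ n * l.
  have lD u v' : l `^ (u + v') = l `^ u * l `^ v'.
    by rewrite powRD//; apply/implyP => _; rewrite gt_eqF.
  rewrite -!powR_mulrn ?(ltW l0)// -!powRrM -lD.
  by rewrite qr addrA -mulrDr rhor mulr1 lD powRr1// ltW.
have lnV : (2 / l) ^+ n * l ^+ n = 2 ^+ n by rewrite -exprMn divfK// gt_eqF.
rewrite powRM ?(ltW c0) ?(ltW ln0)//.
transitivity ((2 / l) ^+ n * ((l ^+ n) `^ rho^-1 * (l ^+ n) `^ q^-1) * sobolev_const n q r *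
  (3 ^+ n + 1) `^ q^-1 * P * (T + e)); first by ring.
by rewrite lE mulrA lnV; ring.
Qed.

End piece.
End truncation.

Section cancellation.
Context (R : realType) (n : nat).
Local Notation leb := (lebesgue_rV n).
Implicit Types (x y z : 'rV[R]_n) (l a : R).

Context (Om : 'rV[R]_n -> R) (rho P : R).
Hypotheses (mOm : measurable_fun setT Om) (n0 : (0 < n)%N) (rho1 : 1 < rho) (P0 : 0 < P).
Hypothesis OmP : (\int[leb]_y ((annulus 0 1 y)%:R * `|Om (direction y)| `^ rho)%:E
  <= (P `^ rho)%:E)%E.
Hypothesis balanced :
  (\int[leb]_y ((annulus 0 1 y)%:R * Num.max (Om (direction y)) 0)%:E =
   \int[leb]_y ((annulus 0 1 y)%:R * Num.max (- Om (direction y)) 0)%:E)%E.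

Let mOmd : measurable_fun setT (fun y => Om (direction y)).
Proof. exact: (measurableT_comp mOm measurable_direction). Qed.

Let mker a l : measurable_fun setT (fun y =>
  (annulus a l y)%:R * (Om (direction y) / enorm y ^+ n)).
Proof.
apply: measurable_funM.
  by apply: measurable_bool_natr; exact: (@measurable_annulus R n a l _ _ id).
apply: measurable_funM => //.
under eq_fun do rewrite -powR_inv1 ?exprn_ge0 ?enorm_ge0//.
apply: (measurableT_comp (measurable_powR (-1))).
by apply: measurable_funX; exact: measurable_enorm.
Qed.

Lemma kernel_integrable a l (h : 'rV[R]_n -> R) (B : R) : 0 < a -> 
  measurable_fun setT h -> (forall y, `|h y| <= B) ->
  leb.-integrable setT (fun y =>
    ((annulus a l y)%:R * (Om (direction y) / enorm y ^+ n) * h y)%:E).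
Proof.
move=> a0 mh hB; have B0 : 0 <= B by apply: le_trans (hB 0).
apply/integrableP; split.
  by apply/measurable_EFinP; exact: measurable_funM.
have [al|la] := ltP a l; last first.
  rewrite integral0_eq// => y _; rewrite (_ : annulus a l y = false).
    by rewrite !mul0r abse0.
  by apply/negP => /andP[ay yl]; have := lt_le_trans ay yl; rewrite ltNge la.
have l0 : 0 < l by exact: lt_trans al.
have fin := integral_ball_rough_fin mOm rho1 OmP l0.
apply: (@le_lt_trans _ _ (((a ^+ n)^-1 * B)%:E *
    \int[leb]_y ((annulus 0 l y)%:R * `|Om (direction y)|)%:E)%E); last first.
  by rewrite lte_mul_pinfty// lee_fin mulr_ge0// invr_ge0 exprn_ge0// ltW.
rewrite -nn_integralZl; last 3 first.
- by rewrite mulr_ge0// invr_ge0 exprn_ge0// ltW.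
- apply: measurable_funM; last exact: measurableT_comp.
  by apply: measurable_bool_natr; exact: (@measurable_annulus R n 0 l _ _ id).
- by move=> y; rewrite mulr_ge0.
apply: nn_integral_le => // y.
case: (boolP (annulus a l y)) => [/andP[ay yl]|_]; last first.
  by rewrite !mul0r normr0 mulr_ge0// mulr_ge0// invr_ge0 exprn_ge0// ltW.
have y0 : 0 < enorm y by exact: lt_trans ay.
rewrite /annulus y0 yl !mul1r !normrM.
rewrite [leRHS]mulrC -mulrA; apply: ler_wpM2l => //.
apply: ler_pM => //.
rewrite normfV ger0_norm ?exprn_ge0 ?enorm_ge0// lef_pV2 ?posrE ?exprn_gt0//.
by rewrite ler_pXn2r ?nnegrE ?(ltW a0) ?(ltW y0)// ltW.
Qed.

(** The positive and the negative part of the kernel are homogeneous with the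
    same integral over the unit ball. *)
Lemma kernel_mean_zero a l : 0 < a ->
  (\int[leb]_y ((annulus a l y)%:R * (Om (direction y) / enorm y ^+ n))%:E = 0)%E.
Proof.
move=> a0.
have mp : measurable_fun setT (fun u => Num.max (Om u) 0).
  exact: measurable_maxr.
have mn : measurable_fun setT (fun u => Num.max (- Om u) 0).
  by apply: measurable_maxr => //; exact: measurableT_comp.
have pos0 (t : R) : 0 <= Num.max t 0 by rewrite le_max lexx orbT.
have fin1 : (\int[leb]_y ((annulus 0 1 y)%:R * Num.max (Om (direction y)) 0)%:E < +oo)%E.
  apply: le_lt_trans (integral_ball_rough_fin mOm rho1 OmP ltr01).
  apply: nn_integral_le => y; first exact: mulr_ge0.
  by rewrite ler_wpM2l// ge_max ler_norm normr_ge0.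
have bal := balanced_annulus l mp mn (fun y => pos0 _) (fun y => pos0 _) n0 a0 fin1 balanced.
have int1 : leb.-integrable setT (fun y =>
    ((annulus a l y)%:R * (Om (direction y) / enorm y ^+ n))%:E).
  have H : leb.-integrable setT (fun y =>
      ((annulus a l y)%:R * (Om (direction y) / enorm y ^+ n) * cst 1 y)%:E).
    by apply: (@kernel_integrable a l (cst 1) 1) => // y; rewrite normr1.
  by apply: eq_integrable H => //= y _; rewrite mulr1.
have part (s : R -> R) y : (forall c t, 0 <= c -> s (c * t) = c * s t) ->
    s ((annulus a l y)%:R * (Om (direction y) / enorm y ^+ n)) =
    (annulus a l y)%:R * (s (Om (direction y)) / enorm y ^+ n).
  move=> sM; rewrite sM// [_ / _]mulrC sM ?invr_ge0 ?exprn_ge0 ?enorm_ge0//.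
  by congr (_ * _); rewrite mulrC.
have maxM (c t : R) : 0 <= c -> Num.max (c * t) 0 = c * Num.max t 0.
  by move=> c0; rewrite maxr_pMr// mulr0.
pose K y := ((annulus a l y)%:R * (Om (direction y) / enorm y ^+ n))%:E.
have posE : (\int[leb]_y K^\+ y =
    \int[leb]_y ((annulus a l y)%:R * (Num.max (Om (direction y)) 0 / enorm y ^+ n))%:E)%E.
  apply: eq_integral => y _; rewrite funeposE -EFin_max.
  by rewrite (part (fun t => Num.max t 0)).
have negE : (\int[leb]_y K^\- y =
    \int[leb]_y ((annulus a l y)%:R * (Num.max (- Om (direction y)) 0 / enorm y ^+ n))%:E)%E.
  apply: eq_integral => y _; rewrite funenegE -EFinN -EFin_max.
  rewrite (part (fun t => Num.max (- t) 0))// => c t c0.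
  by rewrite -mulrN maxM.
rewrite -/(K _) [LHS]integralE posE negE -bal subee//.
by rewrite -posE (integrable_pos_fin_num measurableT int1).
Qed.

Section truncation_le.
Context (f g : 'rV[R]_n -> R) (B G q r p : R).
Hypotheses (bf : bounded_nonneg f) (fg : gradient_bound f g).
Hypotheses (mg : measurable_fun setT g) (gG : forall x, 0 <= g x <= G).
Hypotheses (q1 : 1 < q) (r1 : 1 < r) (rhor : rho^-1 + r^-1 = 1).
Hypotheses (qr : n%:R / q = n%:R / r + 1) (qp : q <= p).
Hypothesis bgp : bounded_nonneg (fun y => g y `^ p).

Let reflected_bounded x c : exists D : R,
  measurable_fun setT (fun y => f (x - y) - c) /\ forall y, `|f (x - y) - c| <= D.
Proof.
have [mf [D fD]] := bf; exists (D + `|c|); split.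
  by apply: measurable_funB => //; apply: (measurableT_comp mf); exact: measurable_rVB.
move=> y; apply: le_trans (ler_normB _ _) _; rewrite lerD2r.
by have /andP[f0 fD'] := fD (x - y); rewrite ger0_norm.
Qed.

Let piece a l x y : R :=
  (annulus a l y)%:R * (Om (direction y) / enorm y ^+ n) * (f (x - y) - B).

Let piece_integrable a l x : 0 < a ->
  leb.-integrable setT (fun y => (piece a l x y)%:E).
Proof.
move=> a0; have [D [mD fD]] := reflected_bounded x B.
exact: (kernel_integrable l a0 mD fD).
Qed.

(** As the kernel has mean zero on the annulus, the constant [B] can be replaced
    by the average of [f] over the dyadic cube of [x]. *)
Lemma annulus_signed_le l a x : 0 < l -> 0 < a -> l / 2 <= a ->
  (`|\int[leb]_y (piece a l x y)%:E| <=
   (truncation_const n q r * P * scale_term (fun y => g y `^ p) p l x)%:E)%E.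
Proof.
move=> l0 a0 la; set c := cavg l f x.
apply: le_trans (annulus_difference_le mOm n0 rho1 P0 OmP bf fg mg gG q1 r1 rhor qr qp
  x l0 la bgp).
have [D [mD fD]] := reflected_bounded x c.
have i1 := kernel_integrable l a0 mD fD.
have i2 : leb.-integrable setT (EFin \o (fun y => (annulus a l y)%:R *
    (Om (direction y) / enorm y ^+ n) * (cst (c - B) y))).
  by apply: (@kernel_integrable a l (cst (c - B)) `|c - B|).
have i3 : leb.-integrable setT (fun y =>
    ((annulus a l y)%:R * (Om (direction y) / enorm y ^+ n))%:E).
  have H : leb.-integrable setT (fun y =>
      ((annulus a l y)%:R * (Om (direction y) / enorm y ^+ n) * cst 1 y)%:E).
    by apply: (@kernel_integrable a l (cst 1) 1) => // y; rewrite normr1.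
  by apply: eq_integrable H => //= y _; rewrite mulr1.
have -> : (\int[leb]_y (piece a l x y)%:E = \int[leb]_y ((annulus a l y)%:R *
    (Om (direction y) / enorm y ^+ n) * (f (x - y) - c))%:E)%E.
  transitivity (\int[leb]_y (((fun y => (annulus a l y)%:R *
    (Om (direction y) / enorm y ^+ n) * (f (x - y) - c)) \+ (fun y => (annulus a l y)%:R *
    (Om (direction y) / enorm y ^+ n) * (cst (c - B) y))) y)%:E)%E.
    by apply: eq_integral => y _ /=; congr EFin; rewrite /piece; ring.
  rewrite (@integralD_EFin _ _ _ leb setT _ _ _ i1 i2)//.
  rewrite -[RHS]adde0; congr (_ + _)%E.
  transitivity (\int[leb]_y ((c - B)%:E *
    ((annulus a l y)%:R * (Om (direction y) / enorm y ^+ n))%:E))%E.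
    by apply: eq_integral => y _ /=; rewrite -EFinM mulrC.
  by rewrite (@integralZl _ _ _ leb setT _ _ i3)// kernel_mean_zero// mule0.
apply: le_trans (le_abse_integral _ _ _) _ => //.
  by case/integrableP: i1.
apply: nn_integral_le => // y; rewrite !normrM normr_nat -!mulrA ler_wpM2l//.
by rewrite normfV [X in X^-1]ger0_norm// exprn_ge0// enorm_ge0.
Qed.

(** The truncated kernel is cut into dyadic annuli, down to the first one that
    the truncation removes. *)
Lemma truncation_le eps L J x : 0 < eps -> 0 < L -> scale L J.+1 <= eps ->
  (forall y, L < enorm y -> f (x - y) = B) ->
  (`|\int[leb]_(y in [set y | (eps < enorm y)%R])
      (Om (direction y) / enorm y ^+ n * (f (x - y) - B))%:E| <=
   (truncation_const n q r * P * scale_sum L (fun y => g y `^ p) p J x)%:E)%E.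
Proof.
move=> eps0 L0 LJ fL.
pose a j := Num.max eps (scale L j.+1).
have a0 j : 0 < a j by rewrite lt_max eps0.
have count k y : \sum_(j < k) (annulus (a j) (scale L j) y)%:R =
    (annulus eps L y)%:R - (annulus eps (scale L k) y)%:R :> R.
  elim: k => [|k IH]; first by rewrite big_ord0 scale0 subrr.
  rewrite big_ord_recr/= IH /annulus /a gt_max.
  case: (eps < enorm y) => /=; last by rewrite subrr addr0.
  have ss : scale L k.+1 <= scale L k.
    by rewrite -[leRHS]scaleS ler_peMl ?(ltW (scale_gt0 _ L0))// ler1n.
  have [yk|yk] := leP (enorm y) (scale L k.+1); last by rewrite /=; lra.
  by rewrite (le_trans yk ss) /=; lra.
have -> : (\int[leb]_(y in [set y | (eps < enorm y)%R])
      (Om (direction y) / enorm y ^+ n * (f (x - y) - B))%:E =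
   \int[leb]_y (\sum_(j < J.+1) (piece (a j) (scale L j) x y)%:E))%E.
  rewrite integral_mkcond; apply: eq_integral => y _.
  rewrite sumEFin /piece /patch.
  under eq_bigr do rewrite -mulrA; rewrite -mulr_suml count.
  case: ifPn => [/set_mem/= ey|/negP ey].
    have [Ly|yL] := ltP L (enorm y); first by rewrite fL// subrr !mulr0.
    rewrite /annulus ey yL leNgt (le_lt_trans LJ ey) /= subr0 mul1r.
    by [].
  rewrite /annulus; case: ltP => [ey'|_]; last by rewrite /= subrr mul0r.
  by case: ey; apply/mem_set.
rewrite integral_sum//; last by move=> j; exact: piece_integrable.
apply: le_trans (lee_abs_sum _ _ _) _.
rewrite /scale_sum mulr_sumr -sumEFin; apply: lee_sum => j _.
apply: annulus_signed_le; rewrite ?scale_gt0//.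
by rewrite -[scale L j]scaleS mulrC mulKf// le_max lexx orbT.
Qed.

End truncation_le.
End cancellation.

(** * Test functions and rough kernels *)

Section test_functions.
Context (R : realType) (n : nat) (f : 'rV[R]_n -> R).
Hypothesis tf : test_function f.
Implicit Types x y : 'rV[R]_n.

Let K := closure [set x | f x != 0].
Let cK : compact K. Proof. by case: tf. Qed.

Lemma test_continuous : continuous f.
Proof. by case: tf => + _ => /(_ [::])[]. Qed.

Lemma test_partial_continuous i : continuous (partial i f).
Proof. by case: tf => + _ => /(_ [:: i])[]. Qed.

Lemma test_derivable i x : derivable f x (unit_vector R i).
Proof. by case: tf => + _ => /(_ [::])[_ /(_ i x)]. Qed.

Let outK x : ~ K x -> f x = 0.
Proof.
by move=> xK; apply/eqP; apply: contraPT isT => fx _; apply: xK; exact: subset_closure.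
Qed.

Let partial_outK i x : ~ K x -> partial i f x = 0.
Proof.
move=> xK; rewrite /partial (@near_eq_derive _ _ _ f (cst 0)) ?derive_cst//.
have : open (~` K) by exact/closed_openC/closed_closure.
rewrite openE => /(_ x xK) /=; apply: filterS => y; exact: outK.
Qed.

Let bounded_outK (h : 'rV[R]_n -> R) : continuous h -> (forall x, ~ K x -> h x = 0) ->
  exists2 D, 0 <= D & forall x, `|h x| <= D.
Proof.
move=> ch hK; have /compact_bounded [D [_ HD]] : compact (h @` K).
  by apply: continuous_compact => //; exact: continuous_subspaceT.
have D0 : 0 <= `|D| + 1 by rewrite addr_ge0.
exists (`|D| + 1) => // x; have [Kx|/hK->] := pselect (K x); last by rewrite normr0.
by apply: (HD (`|D| + 1)); [rewrite (le_lt_trans (ler_norm _))// ltrDl|exists x].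
Qed.

Lemma test_bounded : exists2 D, 0 <= D & forall x, `|f x| <= D.
Proof. by apply: bounded_outK => //; exact: test_continuous. Qed.

Lemma enorm_le_coord (u : 'rV[R]_n) (D : R) : 0 <= D -> (forall i, `|u 0 i| <= D) ->
  enorm u <= n%:R * D.
Proof.
move=> D0 uD; rewrite /enorm.
have nD : 0 <= n%:R * D by rewrite mulr_ge0.
rewrite -[leRHS](ger0_norm nD) -sqrtr_sqr ler_wsqrtr//.
apply: (@le_trans _ _ (\sum_(i < n) D ^+ 2)).
  by apply: ler_sum => i _; rewrite -real_normK ?num_real// ler_pXn2r ?nnegrE.
rewrite sumr_const card_ord -[leLHS]mulr_natl exprMn; apply: ler_wpM2r; first exact: sqr_ge0.
by rewrite -natrX ler_nat -[leqLHS]expn1; case: (n) => // m; exact: leq_pexp2l.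
Qed.

Lemma grad_norm_bounded : exists G, forall x, 0 <= grad_norm f x <= G.
Proof.
have H i : {D | 0 <= D /\ forall x, `|partial i f x| <= D}.
  have := bounded_outK (@test_partial_continuous i) (@partial_outK i).
  by move=> /cid2[D D0 fD]; exists D.
pose D := \sum_i sval (H i).
have D0 : 0 <= D by apply: sumr_ge0 => i _; case: (H i) => ? [].
exists (n%:R * D) => x; rewrite enorm_ge0/=; apply: enorm_le_coord => // i.
have [_ Hi] := svalP (H i); rewrite mxE; apply: le_trans (Hi x) _; rewrite /D (bigD1 i)//= lerDl.
by apply: sumr_ge0 => j _; case: (H j) => ? [].
Qed.

Lemma measurable_grad_norm : measurable_fun setT (grad_norm f).
Proof.
apply: (measurableT_comp (@measurable_enorm R n)); apply: measurable_fun_rVP => i.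
under eq_fun do rewrite mxE.
by apply: continuous_measurable_rV; exact: test_partial_continuous.
Qed.

Lemma gradient_bound_shift B : gradient_bound (fun x => f x + B) (grad_norm f).
Proof.
move=> i; have pE : partial i (fun x => f x + B) = partial i f.
  apply/funext => x; rewrite /partial (_ : (fun y => _) = f + cst B)//.
  by rewrite deriveD ?derive_cst ?addr0//; exact: test_derivable.
split.
- by rewrite pE; exact: test_partial_continuous.
- move=> x; rewrite (_ : (fun y => _) = f + cst B)//.
  by apply: derivableD; [exact: test_derivable|exact: derivable_cst].
- move=> x; rewrite pE /grad_norm.
  by have := coord_le_enorm (\row_i partial i f x) i; rewrite mxE.
Qed.

Lemma test_support : exists2 D, 0 <= D & forall x, D < `|x| -> f x = 0 /\ grad_norm f x = 0.
Proof.
have [D [_ HD]] := compact_bounded cK; exists (`|D| + 1); first by rewrite addr_ge0.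
move=> x Dx; have xK : ~ K x.
  move=> Kx; have D1 : D < `|D| + 1 by rewrite (le_lt_trans (ler_norm _))// ltrDl.
  by have /= := HD _ D1 x Kx; rewrite leNgt Dx.
split; first exact: outK.
rewrite /grad_norm /enorm big1 ?sqrtr0// => i _; rewrite mxE partial_outK//.
by rewrite expr0n.
Qed.

Lemma test_translate_support x : exists2 D, 0 <= D &
  forall y, D < enorm y -> f (x - y) = 0.
Proof.
have [D D0 fD] := test_support; exists (n%:R * (`|x| + D)).
  by rewrite mulr_ge0// addr_ge0.
move=> y Dy; apply: (fD _ _).1; rewrite ltNge; apply: contraTN Dy => xyD.
rewrite -leNgt; apply: enorm_le_coord; first by rewrite addr_ge0.
move=> i; apply: (@le_trans _ _ `|y|); last first.
  have -> : y = x - (x - y) by rewrite subKr.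
  by apply: le_trans (ler_normB _ _) _; rewrite lerD2l.
by rewrite [leRHS]mx_normrE; exact: (le_bigmax _ (fun ij => `|y ij.1 ij.2|) (0, i)).
Qed.

End test_functions.

Section rough_kernel.
Context (R : realType) (n : nat) (rho : R) (Omega : 'rV[R]_n -> R).
Local Notation leb := (lebesgue_rV n).
Local Notation sigma := (@sphere_measure R n).
Hypotheses (n0 : (0 < n)%N) (rho1 : 1 < rho) (LO : Lsphere rho Omega).
Hypothesis O0 : (\int[sigma]_x (Omega x)%:E = 0)%E.
Hypothesis Onz : ~ {ae sigma, forall x, Omega x = 0}.
Local Notation P := (sphere_norm rho Omega).

Let rho0 : 0 < rho. Proof. exact: lt_trans rho1. Qed.

(** The cone over [N] is a countable union of truncated cones, which are dilates
    of the one whose volume defines the measure of [N]. *)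
Lemma null_cone (N : set 'rV[R]_n) : measurable N -> sigma N = 0%E ->
  exists M : set 'rV[R]_n, [/\ measurable M, leb M = 0%E &
    forall y, 0 < enorm y -> N (direction y) -> M y].
Proof.
move=> mN N0; pose G u : R := \1_N u.
have mG : measurable_fun setT G by exact: measurable_indic.
have G0 u : 0 <= G u by rewrite /G indicE.
pose M := [set y : 'rV[R]_n | 0 < enorm y /\ N (direction y)].
pose Mk k := [set y : 'rV[R]_n | annulus 0 k.+1%:R y] `&` [set y | N (direction y)].
have mdN : measurable [set y : 'rV[R]_n | N (direction y)].
  by rewrite -[X in measurable X]setTI; exact: measurable_direction.
have mann k : measurable [set y : 'rV[R]_n | annulus 0 k.+1%:R y].
  by apply: measurable_bool_set; exact: (@measurable_annulus R n 0 _ _ _ id).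
have mMk k : measurable (Mk k) by exact: measurableI.
have mk0 k : leb (Mk k) = 0%E.
  have := integral_ball mG G0 (ltr0Sn R k).
  have I0 : (\int[leb]_y ((annulus 0 1 y)%:R * G (direction y))%:E = 0)%E.
    have : (\int[sigma]_u (G u)%:E = 0)%E by rewrite integral_indic// setIT.
    rewrite integral_sphere// => /eqP; rewrite mule_eq0 eqe pnatr_eq0.
    by rewrite (gtn_eqF n0) => /eqP.
  rewrite I0 mule0 => <-.
  transitivity (\int[leb]_y (\1_(Mk k) y)%:E)%E; first by rewrite integral_indic// setIT.
  apply: eq_integral => y _; rewrite /G !indicE -natrM mulnb; congr (nat_of_bool _)%:R%:E.
  apply/idP/idP => [/set_mem[-> yN]|/andP[ya /set_mem yN]]; first by rewrite /= mem_set.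
  exact/mem_set.
have ME : M = \bigcup_k Mk k.
  apply/seteqP; split => [y [y0 yN]|y [k _ [/andP[y0 _] yN]]]//.
  exists (Num.truncn (enorm y)) => //; split => //.
  by rewrite /= /annulus y0 ltW// truncnS_gt.
exists M; split => //.
  by rewrite ME; exact: bigcup_measurable.
apply: measure_negligible; rewrite ME; first exact: bigcup_measurable.
by apply: negligible_bigcup => k; exact: (iffRL (negligibleP _ (mMk k)) (mk0 k)).
Qed.

(** A Borel representative of [Omega], with the normalisations used above. It
    defines the same truncated integrals, against any function. *)
Lemma rough_kernel : exists Om : 'rV[R]_n -> R,
  [/\ measurable_fun setT Om, 0 < P,
     (\int[leb]_y ((annulus 0 1 y)%:R * `|Om (direction y)| `^ rho)%:E <= (P `^ rho)%:E)%E,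
     (\int[leb]_y ((annulus 0 1 y)%:R * Num.max (Om (direction y)) 0)%:E =
      \int[leb]_y ((annulus 0 1 y)%:R * Num.max (- Om (direction y)) 0)%:E)%E &
     forall eps (F : 'rV[R]_n -> R), 0 < eps ->
      (\int[leb]_(y in [set y | (eps < enorm y)%R])
        (Omega (direction y) / enorm y ^+ n * F y)%:E =
       \int[leb]_(y in [set y | (eps < enorm y)%R])
        (Om (direction y) / enorm y ^+ n * F y)%:E)%E].
Proof.
have [cO fO] := LO; have [Om [N [mOm mN N0 ON OmN]]] := completed_measurable_fun_borel cO.
have Fint (h : R -> \bar R) : (\int[sigma]_x h (Omega x) = \int[sigma]_x h (Om x))%E.
  by apply: (eq_lower_integral_off_null mN N0) => x _ xN; rewrite ON.
have mOmr : measurable_fun setT (fun u => `|Om u| `^ rho).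
  by apply: (measurableT_comp (measurable_powR rho)); exact: measurableT_comp.
have NormE : (\int[sigma]_x (`|Om x| `^ rho)%:E = (P `^ rho)%:E)%E.
  have PE : ('N[sigma]_(rho%:E)[EFin \o Omega] = P%:E)%E.
    by rewrite /sphere_norm fineK// ge0_fin_numE; [exact: fO|exact: Lnorm_ge0].
  have rn0 : rho != 0 by rewrite gt_eqF.
  have := @poweR_Lnorm _ _ _ sigma (EFin \o Omega) rho rn0.
  rewrite PE poweR_EFin => ->.
  rewrite -(Fint (fun t => (`|t| `^ rho)%:E)).
  by apply: eq_integral.
have P0 : 0 < P.
  rewrite lt_neqAle; apply/andP; split; last by apply: fine_ge0; exact: Lnorm_ge0.
  apply/eqP => PE; apply: Onz.
  have : (\int[sigma]_x `|(`|Om x| `^ rho)%:E| = 0)%E.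
    transitivity ((P `^ rho)%:E); last by rewrite -PE powR0// gt_eqF.
    rewrite -NormE; apply: eq_integral => x _.
    by rewrite gee0_abs// lee_fin powR_ge0.
  move=> H; have /(ae_eq_integral_abs _ measurableT) : 
      measurable_fun setT (fun x => (`|Om x| `^ rho)%:E) by exact/measurable_EFinP.
  move=> /(_ sigma)[+ _] => /(_ H) [Z [mZ Z0 HZ]].
  exists (Z `|` N); split; first exact: measurableU.
    by apply: null_set_setU.
  move=> x /= Ox; have [Nx|xN] := pselect (N x); [by right|left].
  apply: HZ => /= H0; apply: Ox; rewrite -ON//.
  by have [/powR_eq0_eq0/normr0P/eqP] := H0 I.
have ballE (G : 'rV[R]_n -> R) : measurable_fun setT G -> (forall u, 0 <= G u) ->
    (\int[leb]_y ((annulus 0 1 y)%:R * G (direction y))%:E =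
     (n%:R^-1)%:E * \int[sigma]_u (G u)%:E)%E.
  move=> mG G0; rewrite integral_sphere// muleA -EFinM mulVf ?mul1e//.
  by rewrite pnatr_eq0 -lt0n.
have ballP : (\int[leb]_y ((annulus 0 1 y)%:R * `|Om (direction y)| `^ rho)%:E <=
    (P `^ rho)%:E)%E.
  rewrite (ballE (fun u => `|Om u| `^ rho))//.
  rewrite NormE -EFinM lee_fin ler_piMl ?powR_ge0// invf_le1 ?ltr0n//.
  by rewrite ler1n.
exists Om; split => //.
- have pos0 (t : R) : 0 <= Num.max t 0 by rewrite le_max lexx orbT.
  have mp : measurable_fun setT (fun u => Num.max (Om u) 0).
    exact: measurable_maxr.
  have mn : measurable_fun setT (fun u => Num.max (- Om u) 0).
    by apply: measurable_maxr => //; exact: measurableT_comp.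
  have finp : (\int[leb]_y ((annulus 0 1 y)%:R * Num.max (Om (direction y)) 0)%:E < +oo)%E.
    apply: le_lt_trans (integral_ball_rough_fin mOm rho1 ballP ltr01).
    apply: nn_integral_le => y; first exact: mulr_ge0.
    by rewrite ler_wpM2l// ge_max ler_norm normr_ge0.
  rewrite (ballE (fun u => Num.max (Om u) 0))// (ballE (fun u => Num.max (- Om u) 0))//.
  have finsp : (\int[sigma]_u (Num.max (Om u) 0)%:E \is a fin_num)%E.
    rewrite ge0_fin_numE; last by apply: nn_integral_ge0.
    rewrite integral_sphere// lte_mul_pinfty//.
  have := O0; rewrite (Fint (fun t => t%:E)) [LHS]integralE => H.
  have H' : (\int[sigma]_u (Num.max (Om u) 0)%:E - \int[sigma]_u (Num.max (- Om u) 0)%:E = 0)%E.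
    rewrite -[RHS]H; congr (_ - _)%E; apply: eq_integral => u _.
      by rewrite funeposE -EFin_max.
    by rewrite funenegE -EFinN -EFin_max.
  congr (_ * _)%E; move: finsp H'; case: (\int[sigma]_u (Num.max (Om u) 0)%:E)%E => // s _.
  case: (\int[sigma]_u (Num.max (- Om u) 0)%:E)%E => // t.
  by rewrite -EFinB => -[] /eqP; rewrite subr_eq0 => /eqP ->.
- move=> eps F eps0; have [M [mM M0 MN]] := null_cone mN N0.
  apply: (eq_lower_integral_off_null mM M0) => y /= ey yM; rewrite ON// => yN.
  by apply: yM; apply: MN => //; exact: lt_trans ey.
Qed.

End rough_kernel.

Section two_sided_sum.
Context (R : realType) (n : nat).
Implicit Types (x y : 'rV[R]_n) (p : R).

(** The scales run from [2 ^ N] down to [2 ^ - N], so that all dyadic scales are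
    exhausted as [N] grows. *)
Definition two_sided_sum (h : 'rV[R]_n -> R) p N x : R :=
  scale_sum (2 ^+ N) h p (2 * N) x.

Lemma two_sided_scale N i : scale (2 ^+ N.+1 : R) i.+1 = scale (2 ^+ N) i.
Proof. by rewrite /scale !exprS invfM mulrACA divff ?mul1r// pnatr_eq0. Qed.

Lemma two_sided_scale_last N : scale (2 ^+ N : R) (2 * N).+1 <= (2 ^+ N)^-1.
Proof.
have p0 : 0 < 2 ^+ N :> R by exact: exprn_gt0.
have -> : scale (2 ^+ N : R) (2 * N).+1 = (2 ^+ N)^-1 / 2.
  by rewrite /scale exprS mul2n -addnn exprD; field; rewrite gt_eqF.
by rewrite ler_piMr ?invr_ge0 ?(ltW p0)// invf_le1// ler1n.
Qed.

Lemma scale_term_ge0 (h : 'rV[R]_n -> R) p l x : 0 < l -> 0 <= scale_term h p l x.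
Proof. by move=> l0; rewrite mulr_ge0 ?powR_ge0 ?ltW. Qed.

Lemma two_sided_sum_ge0 (h : 'rV[R]_n -> R) p N x : 0 <= two_sided_sum h p N x.
Proof.
by apply: sumr_ge0 => i _; apply: scale_term_ge0; rewrite scale_gt0// exprn_gt0.
Qed.

Lemma two_sided_sum_mono (h : 'rV[R]_n -> R) p x :
  {homo (fun N => two_sided_sum h p N x) : N M / (N <= M)%N >-> N <= M}.
Proof.
apply: homo_leq; [exact: lexx|exact: le_trans|] => N.
rewrite /two_sided_sum /scale_sum (_ : (2 * N.+1).+1 = (2 * N).+3)%N; last by lia.
rewrite [leRHS]big_ord_recl [X in _ <= _ + X]big_ord_recr /=.
under [X in _ <= _ + (X + _)]eq_bigr do rewrite two_sided_scale.
have s0 i : 0 < scale (2 ^+ N.+1 : R) i by rewrite scale_gt0// exprn_gt0.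
by rewrite addrCA lerDl addr_ge0// scale_term_ge0.
Qed.

End two_sided_sum.

Section pointwise.
Context (R : realType) (n : nat) (rho p : R) (Omega : 'rV[R]_n -> R).
Local Notation leb := (lebesgue_rV n).
Local Notation sigma := (@sphere_measure R n).

(** The exponent whose Sobolev exponent is [rho / (rho - 1)], the conjugate of
    [rho]. *)
Definition dual_sobolev_exponent : R := rho * n%:R / (rho * n%:R + rho - n%:R).

Definition pointwise_const : R :=
  truncation_const n dual_sobolev_exponent (rho / (rho - 1)).

Hypotheses (n2 : (2 <= n)%N) (rho1 : 1 < rho) (rhon : rho < n%:R).
Hypothesis LO : Lsphere rho Omega.
Hypothesis O0 : (\int[sigma]_x (Omega x)%:E = 0)%E.
Hypothesis Onz : ~ {ae sigma, forall x, Omega x = 0}.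
Hypotheses (qp : dual_sobolev_exponent <= p).
Local Notation P := (sphere_norm rho Omega).
Local Notation q := dual_sobolev_exponent.
Local Notation r := (rho / (rho - 1)).

Let rho0 : 0 < rho. Proof. exact: lt_trans rho1. Qed.
Let n0 : (0 < n)%N. Proof. exact: ltn_trans n2. Qed.
Let nR0 : 0 < n%:R :> R. Proof. by rewrite ltr0n. Qed.
Let rho10 : 0 < rho - 1. Proof. by rewrite subr_gt0. Qed.

Let den0 : 0 < rho * n%:R + rho - n%:R.
Proof. have := mulr_gt0 rho10 nR0; have := rho0; lra. Qed.

Lemma dual_sobolev_exponent_gt1 : 1 < q.
Proof. by rewrite /q ltr_pdivlMr// mul1r; have := rhon; lra. Qed.

Let r1 : 1 < r. Proof. by rewrite ltr_pdivlMr// mul1r gtrBl. Qed.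

Let rhor : rho^-1 + r^-1 = 1.
Proof. by field; rewrite !gt_eqF. Qed.

Let qr : n%:R / q = n%:R / r + 1.
Proof. by rewrite /q; field; rewrite !gt_eqF. Qed.

Section test.
Variable f : 'rV[R]_n -> R.
Hypothesis tf : test_function f.
Local Notation h := (fun y => grad_norm f y `^ p).

Lemma bounded_nonneg_grad : bounded_nonneg h.
Proof.
have [G fG] := grad_norm_bounded tf.
have p0 : 0 < p by apply: lt_le_trans qp; exact: lt_trans dual_sobolev_exponent_gt1.
split; first exact: (measurableT_comp (measurable_powR p) (measurable_grad_norm tf)).
exists (G `^ p) => x; rewrite powR_ge0/=; have /andP[g0 gG] := fG x.
by apply: ge0_ler_powR; rewrite ?nnegrE ?(ltW p0)// (le_trans g0).
Qed.

(** The sum must start above the support of [f] and go below the truncation. The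
    test function is shifted by a constant to become nonnegative. *)
Lemma truncated_singular_le x eps : 0 < eps -> exists N,
  (`|\int[leb]_(y in [set y | (eps < enorm y)%R])
      (Omega (direction y) / enorm y ^+ n * f (x - y))%:E| <=
   (pointwise_const * P * two_sided_sum h p N x)%:E)%E.
Proof.
move=> eps0; have [Om [mOm P0 OmP bal OmE]] := rough_kernel n0 rho1 LO O0 Onz.
have [D D0 fD] := test_bounded tf; have [G fG] := grad_norm_bounded tf.
have [L L0 fL] := test_translate_support tf x.
have bf : bounded_nonneg (fun y => f y + D).
  split; first by apply: measurable_funD => //; exact: continuous_measurable_rV (test_continuous tf).
  exists (D + D) => y; have := fD y; rewrite ler_norml => /andP[h1 h2].
  by rewrite lerD2r h2 andbT; lra.
pose N := (maxn (Num.truncn L) (Num.truncn eps^-1)).+1.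
have twoN a : (Num.truncn a < N)%N -> a < 2 ^+ N :> R.
  move=> aN; apply: (@lt_le_trans _ _ (N%:R)).
    by apply: lt_le_trans (truncnS_gt _) _; rewrite ler_nat.
  by rewrite -natrX ler_nat ltnW// ltn_expl.
have LN : L < 2 ^+ N by apply: twoN; rewrite ltnS leq_maxl.
have eN : eps^-1 < 2 ^+ N by apply: twoN; rewrite ltnS leq_maxr.
exists N; rewrite OmE//.
under eq_integral do rewrite -[f _](addrK D).
apply: (truncation_le mOm n0 rho1 P0 OmP bal bf (gradient_bound_shift tf D)
  (measurable_grad_norm tf) fG dual_sobolev_exponent_gt1 r1 rhor qr qp bounded_nonneg_grad) => //.
- apply: le_trans (two_sided_scale_last _ _) _.
  by rewrite -[eps]invrK lef_pV2 ?posrE ?invr_gt0 ?exprn_gt0// ltW.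
- by move=> y yL; rewrite fL ?add0r// (lt_trans LN).
Qed.

End test.
End pointwise.

(** * Young functions and Muckenhoupt weights *)

Section young_functions.
Context (R : realType) (Phi : R -> R).
Hypothesis yPhi : young_function Phi.

(** Constant to the left of the origin, hence monotone and Borel on the whole line. *)
Definition extend_left (t : R) : R := Phi (Num.max t 0).

Let Phi_lt s t : 0 <= s -> s < t -> Phi s < Phi t.
Proof.
case: yPhi => _ [_ [H _]] s0 st.
by apply: H; rewrite // in_itv/= andbT // ltW// (le_lt_trans s0).
Qed.

Let Phi_le s t : 0 <= s -> s <= t -> Phi s <= Phi t.
Proof. by move=> s0; rewrite le_eqVlt => /orP[/eqP->//|/(Phi_lt s0)/ltW]. Qed.

Lemma young0 : Phi 0 = 0. Proof. by case: yPhi => _ [_ [_ [_ [H _]]]]. Qed.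

Lemma young_gt0 t : 0 < t -> 0 < Phi t.
Proof. by move=> t0; rewrite -young0 Phi_lt. Qed.

Lemma extend_leftE t : 0 <= t -> extend_left t = Phi t.
Proof. by move=> t0; rewrite /extend_left max_l. Qed.

Lemma extend_left_nd : {homo extend_left : s t / s <= t}.
Proof.
move=> s t st; apply: Phi_le; first by rewrite le_max lexx orbT.
by rewrite ge_max !le_max st lexx !orbT.
Qed.

Lemma measurable_extend_left : measurable_fun setT extend_left.
Proof. by apply: nondecreasing_measurable => // s t /= st; exact: extend_left_nd. Qed.

Let Phi_convex x y c : 0 <= x -> 0 <= y -> 0 <= c <= 1 ->
  Phi (c * x + (1 - c) * y) <= c * Phi x + (1 - c) * Phi y.
Proof.
move=> x0 y0 /andP[c0 c1]; case: yPhi => _ [H _].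
have ci : Itv.spec (@Itv.num_sem R) (Itv.Real `[0%Z, 1%Z]) c.
  by rewrite /= /Itv.num_sem/= num_real /= in_itv/= c0 c1.
have xin (z : R) : 0 <= z -> z \in (`[0, +oo[%classic : set R).
  by move=> z0; apply/mem_set; rewrite /= in_itv/= z0.
by have := H (Itv.mk ci) x y (xin _ x0) (xin _ y0).
Qed.

Lemma young_unbounded M : exists2 t, 0 <= t & M < Phi t.
Proof.
have P1 : 0 < Phi 1 by exact: young_gt0.
pose t := Num.max 1 (M / Phi 1 + 1); have t1 : 1 <= t by rewrite le_max lexx.
have t0 : 0 < t by exact: lt_le_trans t1.
exists t; first exact: ltW.
have := @Phi_convex t 0 t^-1 (ltW t0) (lexx _).
rewrite invr_ge0 (ltW t0) invf_le1// t1 => /(_ isT).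
rewrite young0 !mulr0 !addr0 mulVf ?gt_eqF// mulrC ler_pdivlMr//.
apply: lt_le_trans.
have : M / Phi 1 < t by rewrite lt_max ltrDl ltr01 orbT.
by rewrite ltr_pdivrMr// mulrC.
Qed.

(** A finite upper index bounds the dilation at one [lam > 1], and iteration
    reaches the dilation at 2. *)
Lemma young_convex_doubling : (upper_index Phi < +oo)%E ->
  exists D, convex_doubling extend_left D.
Proof.
move=> /ereal_inf_lt[_ [lam lam1 <-] dl].
have l1 : 1 < lam by [].
have l0 : 0 < lam by exact: lt_trans l1.
have dfin : (dilation Phi lam < +oo)%E.
  rewrite ltey; apply/eqP => dE; move: dl; rewrite dE /= inver gt_eqF ?ln_gt0//.
  by rewrite gt0_mulye ?ltxx// lte_fin invr_gt0 ln_gt0.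
have [d dE] : exists d : R, dilation Phi lam = d%:E.
  have : ((Phi (lam * 1) / Phi 1)%:E <= dilation Phi lam)%E.
    by apply: ereal_sup_ubound; exists 1 => //=.
  by move: dfin; case: (dilation Phi lam) => // d _ _; exists d.
have Pd t : 0 <= t -> Phi (lam * t) <= Num.max d 1 * Phi t.
  rewrite le_eqVlt => /orP[/eqP<-|t0]; first by rewrite mulr0 young0 mulr0.
  rewrite -ler_pdivrMr ?young_gt0// le_max; apply/orP; left.
  by rewrite -lee_fin -dE; apply: ereal_sup_ubound; exists t.
have P1 : 1 <= Num.max d 1 by rewrite le_max lexx orbT.
have Pm m t : 0 <= t -> Phi (lam ^+ m * t) <= Num.max d 1 ^+ m * Phi t.
  move=> t0; elim: m => [|m IH]; first by rewrite !expr0 !mul1r.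
  rewrite !exprS -!mulrA; apply: le_trans (Pd _ _) _.
    by rewrite mulr_ge0// exprn_ge0// ltW.
  by rewrite ler_wpM2l// (le_trans ler01).
have [m lm] : exists m : nat, 2 <= lam ^+ m.
  have bern k : 1 + k%:R * (lam - 1) <= lam ^+ k.
    elim: k => [|k IH]; first by rewrite mul0r addr0 expr0.
    rewrite exprS; have := ler_wpM2l (ltW l0) IH; apply: le_trans.
    have k0 : 0 <= k%:R :> R by [].
    have := mulr_ge0 k0 (sqr_ge0 (lam - 1)); rewrite -natr1; nra.
  have lm0 : 0 < lam - 1 by rewrite subr_gt0.
  exists (Num.truncn (lam - 1)^-1).+1; apply: le_trans (bern _).
  by rewrite -[leLHS]/(1 + 1) lerD2l -ler_pdivrMr// mul1r ltW// truncnS_gt.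
exists (Num.max d 1 ^+ m); split.
- by rewrite extend_leftE ?young0.
- by move=> s t _; exact: extend_left_nd.
- move=> x y c x0 y0 c01; rewrite !extend_leftE//; first exact: Phi_convex.
  by case/andP: c01 => c0 c1; rewrite addr_ge0// mulr_ge0// subr_ge0.
- split; first exact: exprn_ege1.
  move=> t t0; rewrite !extend_leftE ?mulr_ge0//; apply: le_trans (Pm m t t0).
  by apply: Phi_le; [exact: mulr_ge0|exact: ler_wpM2r].
Qed.

End young_functions.

Section weights.
Context (R : realType) (n : nat).
Local Notation leb := (lebesgue_rV n).
Implicit Types (w W h : 'rV[R]_n -> R).

Definition locally_finite W :=
  forall (a : 'rV[R]_n) l, (\int[leb]_(y in cube a l) (W y)%:E < +oo)%E.

Lemma compact_cube (a : 'rV[R]_n) l : compact (cube a l).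
Proof.
have := @rV_compact R n (fun i => `[a 0 i, a 0 i + l]%classic)
  (fun i => @segment_compact R _ _).
congr compact; apply/seteqP; split => y ya i; have := ya i; rewrite /= in_itv//.
Qed.

Lemma weight_borel w : weight w -> exists W (N : set 'rV[R]_n),
  [/\ measurable_fun setT W, forall x, 0 <= W x, measurable N, leb N = 0%E &
      forall x, ~ N x -> w x = W x] /\ locally_finite W.
Proof.
move=> [cw w0 wK]; have [W [N [mW mN N0 WN WN0]]] := completed_measurable_fun_borel cw.
exists W, N; split.
  split => // x; last by move=> /WN.
  by have [/WN0->|/WN->] := pselect (N x).
move=> a l; have -> : (\int[leb]_(y in cube a l) (W y)%:E = \int[leb]_(y in cube a l) (w y)%:E)%E.
  by apply: (eq_lower_integral_off_null mN N0) => y _ /WN ->.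
exact/wK/compact_cube.
Qed.

Lemma eq_muckenhoupt_constant r w W (N : set 'rV[R]_n) :
  measurable N -> leb N = 0%E -> (forall x, ~ N x -> w x = W x) ->
  muckenhoupt_constant r w = muckenhoupt_constant r W.
Proof.
move=> mN N0 wW.
have avgE (F : R -> \bar R) a l : average (cube a l) (F \o w) = average (cube a l) (F \o W).
  by congr (_ / _)%E; apply: (eq_lower_integral_off_null mN N0) => x _ /wW /= ->.
have avg2 a l : average (cube a l) (fun x => ((w x `^ (r / (r - 1) - 1))%:E)^-1)%E =
    average (cube a l) (fun x => ((W x `^ (r / (r - 1) - 1))%:E)^-1)%E.
  exact: (avgE (fun t => ((t `^ (r / (r - 1) - 1))%:E)^-1%E)).
have avg1 a l : average (cube a l) (EFin \o w) = average (cube a l) (EFin \o W).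
  exact: (avgE EFin).
rewrite /muckenhoupt_constant; apply: (congr1 (@ereal_sup R)); apply/funext => A; apply/propext.
pose G (u v : \bar R) := (u * v `^ (r - 1))%E.
split => -[a [l [l0 AE]]]; exists a, l; split; [exact: l0| |exact: l0|].
  exact: (etrans AE (f_equal2 G (avg1 a l) (avg2 a l))).
exact: (etrans AE (f_equal2 G (esym (avg1 a l)) (esym (avg2 a l)))).
Qed.

Lemma muckenhoupt_charges_halves r W A : 1 < r -> measurable_fun setT W ->
  (forall x, 0 <= W x) -> (muckenhoupt_constant r W <= A%:E)%E -> locally_finite W ->
  charges_halves W (4 `^ r * `|A| + 1).
Proof.
move=> r1 mW W0 WA Wfin l x0 E l0 mE Ecell Ehalf.
pose a : 'rV[R]_n := \row_j (l * (grid l (x0 0 j))%:~R).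
apply: (@le_trans _ _ (\int[leb]_(y in cube a l) (W y)%:E)%E).
  rewrite [leRHS]integral_mkcond; apply: le_lower_integral => y.
    by rewrite lee_fin mulr_ge0.
  rewrite /patch; case: (boolP (cell l x0 y)) => [xy|_]; last first.
    by rewrite mul0r; case: ifP => // _; rewrite lee_fin.
  by rewrite mul1r mem_set//; exact: cell_cube.
apply: le_trans (muckenhoupt_doubling r1 mW W0 WA l0 mE Ecell Ehalf (Wfin _ _)) _.
apply: lee_wpmul2r; first by apply: nn_integral_ge0 => y; exact: mulr_ge0.
rewrite lee_fin; apply: (@le_trans _ _ (4 `^ r * `|A|)); last by rewrite lerDl.
by rewrite ler_wpM2l ?powR_ge0// ler_norm.
Qed.

End weights.

Section fractional.
Context (R : realType) (n : nat) (p : R).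
Local Notation leb := (lebesgue_rV n).
Implicit Types (g : 'rV[R]_n -> R) (x : 'rV[R]_n).

(** The threefold cube is contained in a closed cube of side [3 * l]. *)
Lemma scale_term_le_fractional g l x : 0 < l -> 1 <= p -> 
  bounded_nonneg (fun y => g y `^ p) -> (forall y, 0 <= g y) ->
  ((scale_term (fun y => g y `^ p) p l x)%:E <= (3 ^+ n)%:E * fractional_maximal p g x)%E.
Proof.
move=> l0 p1 bg g0; have p0 : 0 < p by exact: lt_le_trans p1.
pose a : 'rV[R]_n := \row_j (l * (grid l (x 0 j) - 1)%:~R).
have l30 : 0 < 3 * l by rewrite mulr_gt0.
have Vn : 0 < (3 * l) ^+ n by exact: exprn_gt0.
have xa : cube a (3 * l) x by apply: ncell_cube => //; exact: ncell_refl.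
set v := navg l (fun y => g y `^ p) x; have v0 : 0 <= v by exact: navg_ge0.
have avg_ge : (((3 ^+ n)^-1 * v)%:E <=
    average (cube a (3 * l)) (fun y => (`|g y| `^ p)%:E))%E.
  rewrite /average lebesgue_cube ?(ltW l30)// inver gt_eqF//.
  have -> : (3 ^+ n)^-1 * v = l ^+ n * v / (3 * l) ^+ n.
    rewrite exprMn; have := exprn_gt0 n l0; have : 0 < (3 : R) ^+ n by exact: exprn_gt0.
    by move: (3 ^+ n) (l ^+ n) => b c b0 c0; field; rewrite !gt_eqF.
  rewrite EFinM; apply: lee_wpmul2r; first by rewrite lee_fin invr_ge0 ltW.
  rewrite -integral_ncellE// [leRHS]integral_mkcond; apply: le_lower_integral => y.
    by rewrite lee_fin mulr_ge0// powR_ge0.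
  rewrite /patch ger0_norm//; case: (boolP (ncell l x y)) => [xy|_]; last first.
    by rewrite mul0r; case: ifP => // _; rewrite lee_fin powR_ge0.
  by rewrite mul1r mem_set//; exact: ncell_cube.
apply: (@le_trans _ _ ((3 ^+ n)%:E * ((3 * l)%:E *
    average (cube a (3 * l)) (fun y => (`|g y| `^ p)%:E) `^ p^-1))%E); last first.
  apply: lee_wpmul2l; first by rewrite lee_fin exprn_ge0.
  by apply: ereal_sup_ubound; exists a, (3 * l).
have c0 : 0 <= (3 ^+ n)^-1 :> R by rewrite invr_ge0 exprn_ge0.
have cv0 : 0 <= (3 ^+ n)^-1 * v by exact: mulr_ge0.
apply: (@le_trans _ _ ((3 ^+ n)%:E * ((3 * l)%:E * (((3 ^+ n)^-1 * v)%:E `^ p^-1)))%E); last first.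
  apply: lee_wpmul2l; first by rewrite lee_fin exprn_ge0.
  apply: lee_wpmul2l; first by rewrite lee_fin ltW.
  apply: gt0_ler_poweR => //.
  - by rewrite invr_ge0 ltW.
  - by rewrite in_itv/= leey lee_fin cv0.
  - by rewrite in_itv/= leey andbT (le_trans _ avg_ge)// lee_fin.
rewrite poweR_EFin -!EFinM lee_fin /scale_term -/v powRM//.
have c1 : (3 ^+ n)^-1 <= 1 :> R by rewrite invf_le1 ?exprn_gt0// exprn_ege1// ler1n.
have cp : (3 ^+ n)^-1 <= ((3 ^+ n)^-1) `^ p^-1 :> R.
  rewrite -[leLHS]powRr1//; apply: ger_powR; last by rewrite invf_le1.
  by rewrite c1 invr_gt0 exprn_gt0.
set t := v `^ p^-1; have t0 : 0 <= t by exact: powR_ge0.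
have -> : l * t = (3 ^+ n) * (l * ((3 ^+ n)^-1 * t)).
  by rewrite [l * (_ * _)]mulrCA mulVKf// expf_neq0.
apply: ler_wpM2l; first exact: exprn_ge0.
apply: ler_pM; rewrite ?(ltW l0) ?mulr_ge0//.
  by rewrite ler_peMl ?(ltW l0)// ler1n.
exact: ler_wpM2r.
Qed.

End fractional.

(** * Sums over all scales are controlled by the fractional maximal function *)

Section sums_and_maxima.
Context (R : realType) (n : nat) (p : R).
Local Notation leb := (lebesgue_rV n).

(** This makes the integrals of the sums finite, so that they can be absorbed. *)
Lemma two_sided_sum_outside (g : 'rV[R]_n -> R) D N (x : 'rV[R]_n) : 0 < p ->
  (forall y, D < `|y| -> g y = 0) ->
  ~ cube (const_mx (- (D + 2 * 2 ^+ N))) (2 * (D + 2 * 2 ^+ N)) x ->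
  two_sided_sum (fun y => g y `^ p) p N x = 0.
Proof.
move=> p0 gD xout; rewrite /two_sided_sum /scale_sum big1// => i _.
have L0 : 0 < 2 ^+ N :> R by exact: exprn_gt0.
have l0 := scale_gt0 i L0.
rewrite /scale_term (_ : navg _ _ _ = 0); first by rewrite powR0 ?mulr0// invr_eq0 gt_eqF.
rewrite /navg /kavg integral0_eq ?mule0// => y _.
case: (boolP (ncell _ _ _)) => [xy|]; last by rewrite mul0r.
rewrite gD; first by rewrite powR0 ?mulr0// gt_eqF.
rewrite ltNge; apply/negP => yD; apply: xout => j.
have := ncell_dist j l0 xy; have lL : scale (2 ^+ N) i <= 2 ^+ N :> R.
  by rewrite /scale ler_pdivrMr ?exprn_gt0// ler_peMr ?(ltW L0)// exprn_ege1// ler1n.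
have yj : `|y 0 j| <= D.
  by apply: le_trans yD; rewrite [leRHS]mx_normrE; exact: (le_bigmax _ (fun ij => `|y ij.1 ij.2|) (0, j)).
rewrite mxE; move: lL yj; move: (2 ^+ N) (scale _ _) => L s sL.
by rewrite ler_norml ltr_norml => /andP[y1 y2] /andP[x1 x2]; apply/andP; split; lra.
Qed.

Context (Phi : R -> R) (D Cw : R).
Hypotheses (yPhi : young_function Phi) (PhiD : convex_doubling (extend_left Phi) D).
Hypotheses (Cw0 : 0 < Cw) (p1 : 1 <= p).
Let p0 : 0 < p. Proof. exact: lt_le_trans p1. Qed.
Let Psi := extend_left Phi.

Lemma sum_le_maximal : exists2 C, 0 < C & forall (g W : 'rV[R]_n -> R) T N,
  (forall y, 0 <= g y) -> bounded_nonneg (fun y => g y `^ p) ->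
  (forall y, T < `|y| -> g y = 0) ->
  measurable_fun setT W -> (forall x, 0 <= W x) -> locally_finite W ->
  charges_halves W Cw ->
  (\int[leb]_x (Psi (two_sided_sum (fun y => g y `^ p) p N x) * W x)%:E <=
   C%:E * \int[leb]_x (young_ext Phi (fractional_maximal p g x) * (W x)%:E))%E.
Proof.
have D1 : 1 <= D by have [_ _ _ []] := PhiD.
pose c : R := 4 * (2 * 9 ^+ n) `^ p^-1 * Cw.
have c0 : 0 < c by rewrite !mulr_gt0// powR_gt0 mulr_gt0// exprn_gt0.
have cD0 : 0 < c * D by rewrite mulr_gt0// (lt_le_trans ltr01).
pose delta := (c * D)^-1; have delta0 : 0 < delta by rewrite invr_gt0.
have [E1 E10 PE1] := doubling_scale PhiD delta^-1.
have [E2 E20 PE2] := doubling_scale PhiD (3 ^+ n).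
exists (E1 * E2); first exact: mulr_gt0.
move=> g W T N g0 bg gT mW W0 Wfin WC.
have L0 : 0 < 2 ^+ N :> R by exact: exprn_gt0.
have mPsi : measurable_fun setT Psi by exact: measurable_extend_left.
have Psi0 t : 0 <= t -> 0 <= Psi t by exact: (convex_doubling_ge0 PhiD).
set h := fun y => g y `^ p.
have mS : measurable_fun setT (fun x => Psi (two_sided_sum h p N x) * W x).
  by apply: measurable_funM => //; apply: (measurableT_comp mPsi); exact: measurable_scale_sum.
have Soo : (\int[leb]_x (Psi (two_sided_sum h p N x) * W x)%:E < +oo)%E.
  have [mh [B hB]] := bg.
  pose K : R := \sum_(i < (2 * N).+1) scale (2 ^+ N) i * (3 ^+ n * B) `^ p^-1.
  have SK x : two_sided_sum h p N x <= K.
    apply: ler_sum => i _; have l0 := scale_gt0 i L0.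
    apply: ler_wpM2l; first exact: ltW.
    have nB := navg_le x l0 mh hB; have n0 := navg_ge0 x l0 bg.
    by apply: ge0_ler_powR; rewrite ?nnegrE ?invr_ge0 ?(ltW p0)// (le_trans n0).
  set Q := cube (const_mx (- (T + 2 * 2 ^+ N))) (2 * (T + 2 * 2 ^+ N)) : set 'rV[R]_n.
  have K0 : 0 <= K by apply: le_trans (SK 0); exact: two_sided_sum_ge0.
  apply: (@le_lt_trans _ _ (\int[leb]_x (Psi K * (\1_Q x * W x))%:E)%E).
    apply: nn_integral_le => x; first by rewrite mulr_ge0// Psi0// two_sided_sum_ge0.
    have [xQ|xQ] := pselect (Q x).
      rewrite indicE mem_set// mul1r; apply: ler_wpM2r => //.
      by apply: extend_left_nd.
    rewrite (two_sided_sum_outside p0 gT xQ) (_ : Psi 0 = 0) ?mul0r.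
      by rewrite mulr_ge0 ?Psi0// mulr_ge0// indicE.
    by rewrite /Psi extend_leftE// young0.
  rewrite nn_integralZl ?Psi0//; last 2 first.
  - by apply: measurable_funM => //; apply: measurable_indic; exact: measurable_cube.
  - by move=> x; rewrite mulr_ge0// indicE.
  apply: lte_mul_pinfty; rewrite ?lee_fin ?Psi0//.
  apply: le_lt_trans (Wfin (const_mx (- (T + 2 * 2 ^+ N))) (2 * (T + 2 * 2 ^+ N))).
  rewrite [leRHS]integral_mkcond le_eqVlt; apply/orP; left; apply/eqP.
  by apply: eq_integral => x _; rewrite /patch indicE; case: ifP; rewrite ?mul1r ?mul0r.
have dE : 4 * (2 * 9 ^+ n) `^ p^-1 * Cw * (delta * D) = 1.
  by rewrite -/c /delta invfM divfK ?divff ?gt_eqF// (lt_le_trans ltr01).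
have PE1' t : 0 <= t -> Psi (delta^-1 * t) <= E1 * Psi t.
  by move=> t0; apply: PE1 => //; rewrite invr_ge0 ltW.
apply: le_trans (finite_sum_le_max L0 bg mW W0 PhiD mPsi WC Cw0 p1 delta0 E10 dE PE1' Soo) _.
rewrite EFinM -muleA; apply: lee_wpmul2l; first by rewrite lee_fin ltW.
set A := fun x => running_max (fun j => scale_term h p (scale (2 ^+ N) j) x) (2 * N).
have mA : measurable_fun setT A.
  rewrite /A; elim: (2 * N)%N => [|j IH] /=; first exact: (measurable_scale_term p bg (scale_gt0 _ L0)).
  by apply: measurable_maxr => //; exact: (measurable_scale_term p bg (scale_gt0 _ L0)).
have A0 x : 0 <= A x.
  have [i _ AE] := running_max_attained (fun j => scale_term h p (scale (2 ^+ N) j) x) (2 * N).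
  by rewrite /A AE; apply: scale_term_ge0; exact: scale_gt0.
have AM x : ((A x)%:E <= (3 ^+ n)%:E * fractional_maximal p g x)%E.
  have [i _ AE] := running_max_attained (fun j => scale_term h p (scale (2 ^+ N) j) x) (2 * N).
  by rewrite /A AE; apply: scale_term_le_fractional => //; exact: scale_gt0.
have -> : (\int[leb]_x (Psi (A x) * W x)%:E =
    E2%:E * \int[leb]_x (E2^-1 * (Psi (A x) * W x))%:E)%E.
  rewrite nn_integralZl ?invr_ge0 ?(ltW E20)//; last 2 first.
  - by apply: measurable_funM => //; exact: (measurableT_comp mPsi).
  - by move=> x; rewrite mulr_ge0// Psi0.
  by rewrite muleA -EFinM divff ?mul1e// gt_eqF.
apply: lee_wpmul2l; first by rewrite lee_fin ltW.
apply: le_lower_integral => x.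
  by rewrite lee_fin mulr_ge0 ?invr_ge0 ?(ltW E20)// mulr_ge0// Psi0.
rewrite mulrA EFinM; apply: lee_wpmul2r; first by rewrite lee_fin.
have := AM x; case: (fractional_maximal p g x) => [m| |] AMx /=; last 2 first.
- by rewrite leey.
- by move: AMx; rewrite gt0_muleNy ?lte_fin ?exprn_gt0// leeNy_eq.
move: AMx; rewrite -EFinM !lee_fin => AMx.
have m0 : 0 <= m.
  by have := le_trans (A0 x) AMx; rewrite pmulr_rge0// exprn_gt0.
rewrite ler_pdivrMl// -(extend_leftE Phi m0); apply: le_trans (PE2 m m0 _); last exact: exprn_ge0.
exact: extend_left_nd.
Qed.

End sums_and_maxima.

(** * The maximal singular integral *)

Section domination.
Context (R : realType) (n : nat) (rho p : R) (Omega : 'rV[R]_n -> R) (Phi : R -> R).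
Local Notation leb := (lebesgue_rV n).
Local Notation sigma := (@sphere_measure R n).
Hypotheses (n2 : (2 <= n)%N) (rho1 : 1 < rho) (rhon : rho < n%:R).
Hypothesis LO : Lsphere rho Omega.
Hypothesis O0 : (\int[sigma]_x (Omega x)%:E = 0)%E.
Hypothesis Onz : ~ {ae sigma, forall x, Omega x = 0}.
Hypothesis qp : dual_sobolev_exponent n rho <= p.
Hypothesis yPhi : young_function Phi.
Variable f : 'rV[R]_n -> R.
Hypothesis tf : test_function f.
Local Notation P := (sphere_norm rho Omega).
Local Notation S := (two_sided_sum (fun y => grad_norm f y `^ p) p).
Local Notation Psi := (extend_left Phi).

(** Twice the pointwise constant leaves room for the supremum in the maximal
    operator to be almost attained. *)
Definition singular_const : R := 2 * `|pointwise_const n rho| + 1.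

Lemma singular_const_gt0 : 0 < singular_const.
Proof. by rewrite ltr_pwDr// mulr_ge0. Qed.

Let cP := singular_const * P.

Let P0 : 0 < P.
Proof. by have [? []] := rough_kernel (ltnW n2) rho1 LO O0 Onz. Qed.

Let cP0 : 0 < cP. Proof. exact: mulr_gt0 singular_const_gt0 P0. Qed.

Let S0 N x : 0 <= S N x. Proof. exact: two_sided_sum_ge0. Qed.

Let below x t : 0 <= t -> (t%:E < maximal_singular Omega f x)%E ->
  exists N, 2 * (t / cP) <= S N x.
Proof.
move=> t0 /ereal_sup_gt[_ [eps eps0 <-] tI].
have [N IN] := truncated_singular_le n2 rho1 rhon LO O0 Onz qp tf x eps0.
exists N; have := lt_le_trans tI IN; rewrite lte_fin => tN.
rewrite mulrA ler_pdivrMr//; apply: (@le_trans _ _ (2 * (pointwise_const n rho * P * S N x))).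
  by rewrite ler_wpM2l// ltW.
have -> : 2 * (pointwise_const n rho * P * S N x) = S N x * (2 * pointwise_const n rho * P).
  by move: (S N x) => s; ring.
apply: ler_wpM2l; first exact: S0.
rewrite /cP; apply: ler_wpM2r; first exact: ltW.
by rewrite /singular_const ler_wpDr// ler_wpM2l// ler_norm.
Qed.

Lemma maximal_singular_ge0 x : (0 <= maximal_singular Omega f x)%E.
Proof.
by apply: (le_trans (abse_ge0 _)); apply: ereal_sup_ubound; exists 1 => //=.
Qed.

(** If the maximal operator is positive and finite, half of its value is exceeded
    by one truncation, hence by one of the sums; if it is infinite, the sums are
    unbounded. *)
Lemma young_singular_le (W : 'rV[R]_n -> R) x : 0 <= W x ->
  (young_ext Phi (maximal_singular Omega f x / cP%:E) * (W x)%:E <=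
   limn (fun N => (Psi (S N x) * W x)%:E))%E.
Proof.
move=> W0; pose u N := (Psi (S N x) * W x)%:E.
have Psi0 t : 0 <= t -> 0 <= Psi t.
  by move=> t0; rewrite extend_leftE// -(young0 yPhi) -(extend_leftE Phi (lexx 0))
    -(extend_leftE Phi t0); exact: extend_left_nd.
have und : {homo u : N M / (N <= M)%N >-> (N <= M)%E}.
  move=> N M NM; rewrite lee_fin ler_wpM2r//; apply: extend_left_nd => //.
  exact: two_sided_sum_mono.
rewrite (cvg_lim _ (ereal_nondecreasing_cvgn und))//.
have u_le N : (u N <= ereal_sup (range u))%E by apply: ereal_sup_ubound; exists N.
have u0 : (0 <= ereal_sup (range u))%E.
  by apply: le_trans (u_le 0%N); rewrite lee_fin mulr_ge0// Psi0.
rewrite inver gt_eqF//.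
have := maximal_singular_ge0 x; have := @below x.
case: (maximal_singular Omega f x) => [s| |]//= sN s0.
- have {}s0 : 0 <= s by [].
  move: (s0); rewrite le_eqVlt => /orP[/eqP<-|sp].
    by rewrite mul0r (young0 yPhi) mul0e.
  have [|N SN] := sN (s / 2) (divr_ge0 s0 (ler0n _ _)).
    by rewrite lte_fin ltr_pdivrMr// ltr_pMr// ltr1n.
  apply: le_trans (u_le N); rewrite -EFinM lee_fin ler_wpM2r//.
  have sc0 : 0 <= s / cP by rewrite divr_ge0// ltW.
  rewrite -(extend_leftE Phi sc0); apply: extend_left_nd => //.
  apply: le_trans SN; rewrite mulrAC mulrCA divff ?mulr1//.
- rewrite gt0_mulye ?lte_fin ?invr_gt0//=.
  move: W0; rewrite le_eqVlt => /orP[/eqP<-|Wp]; first by rewrite mule0.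
  rewrite gt0_mulye ?lte_fin//.
  suff -> : ereal_sup (range u) = +oo%E by [].
  apply: eq_infty => M.
  have [t t0 Mt] := young_unbounded yPhi (M / W x).
  have [||N SN] := sN (t * cP / 2).
  + by rewrite divr_ge0// mulr_ge0// ltW.
  + exact: ltry.
  apply: le_trans (u_le N); rewrite lee_fin -ler_pdivrMr//.
  apply: (le_trans (ltW Mt)); rewrite -(extend_leftE Phi t0); apply: extend_left_nd => //.
  apply: le_trans SN; rewrite le_eqVlt; apply/orP; left; apply/eqP.
  by field; rewrite gt_eqF.
Qed.

End domination.

Section constant.
Context (R : realType) (n : nat) (p : R) (Phi : R -> R) (A : R).
Local Notation leb := (lebesgue_rV n).

(** The constant is chosen before the weight, from a bound for its Muckenhoupt
    constant. *)
Lemma uniform_const : exists C : R, 0 < C /\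
  (1 <= p -> young_function Phi -> (upper_index Phi < +oo)%E ->
   1 < fine (lower_index Phi) ->
   forall (g W : 'rV[R]_n -> R) T N,
   (forall y, 0 <= g y) -> bounded_nonneg (fun y => g y `^ p) ->
   (forall y, T < `|y| -> g y = 0) ->
   measurable_fun setT W -> (forall x, 0 <= W x) -> locally_finite W ->
   (muckenhoupt_constant (fine (lower_index Phi)) W <= A%:E)%E ->
  (\int[leb]_x (extend_left Phi (two_sided_sum (fun y => g y `^ p) p N x) * W x)%:E <=
   C%:E * \int[leb]_x (young_ext Phi (fractional_maximal p g x) * (W x)%:E))%E).
Proof.
have [[p1 [yPhi [uoo r1]]]|H] := pselect (1 <= p /\ young_function Phi /\
  (upper_index Phi < +oo)%E /\ 1 < fine (lower_index Phi)); last first.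
  by exists 1; split => // p1 yPhi uoo r1; exfalso; apply: H.
have [D PhiD] := young_convex_doubling yPhi uoo.
have Cw0 : 0 < 4 `^ fine (lower_index Phi) * `|A| + 1.
  by rewrite ltr_pwDr// mulr_ge0// powR_ge0.
have [C C0 HC] := sum_le_maximal n yPhi PhiD Cw0 p1.
exists C; split => // _ _ _ _ g W T N g0 bg gT mW W0 Wfin WA.
have WC := muckenhoupt_charges_halves r1 mW W0 WA Wfin.
exact: (HC g W T N g0 bg gT mW W0 Wfin WC).
Qed.

End constant.

Lemma young_ext_ge0 (R : realType) (Phi : R -> R) x : young_function Phi ->
  (0 <= x)%E -> (0 <= young_ext Phi x)%E.
Proof.
move=> yPhi; case: x => [t| |]//=; rewrite !lee_fin le_eqVlt => /orP[/eqP<-|t0].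
  by rewrite young0.
by rewrite ltW// young_gt0.
Qed.

Unset Implicit Arguments.

Theorem theorem5p1 (R : realType) :
  exists (c0 : nat -> R -> R -> R) (C : nat -> R -> (R -> R) -> R -> R),
    (forall n p rho, 0 < c0 n p rho) /\
    (forall n p Phi A, 0 < C n p Phi A) /\
    forall (n : nat) (rho p : R) (Omega : 'rV[R]_n -> R) (Phi : R -> R)
           (w : 'rV[R]_n -> R),
      (2 <= n)%N ->
      1 < rho -> rho < n%:R ->
      Lsphere rho Omega ->
      (\int[sphere_measure]_x (Omega x)%:E = 0)%E ->
      ~ {ae sphere_measure, forall x, Omega x = 0} ->
      rho * n%:R / (rho * n%:R + rho - n%:R) <= p -> p < n%:R ->
      young_function Phi ->
      (1 < lower_index Phi)%E ->
      (lower_index Phi <= upper_index Phi)%E ->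
      (upper_index Phi < +oo)%E ->
      muckenhoupt (fine (lower_index Phi)) w ->
      forall f : 'rV[R]_n -> R, test_function f ->
        (\int[lebesgue_rV n]_x
           (young_ext Phi (maximal_singular Omega f x
                           / (c0 n p rho * sphere_norm rho Omega)%:E)
            * (w x)%:E)
         <= (C n p Phi (fine (muckenhoupt_constant (fine (lower_index Phi)) w)))%:E
            * \int[lebesgue_rV n]_x
                (young_ext Phi (fractional_maximal p (grad_norm f) x)
                 * (w x)%:E))%E.
Proof.
exists (fun n p rho => singular_const n rho).
exists (fun n p Phi A => sval (cid (uniform_const n p Phi A))).
split; first by move=> n p rho; exact: singular_const_gt0.
split; first by move=> n p Phi A; case: cid => C [].
move=> n rho p Omega Phi w n2 rho1 rhon LO O0 Onz qp pn yPhi lo1 loup upoo [ww mw] f tf.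
have q1 := dual_sobolev_exponent_gt1 n2 rho1 rhon.
have p1 : 1 <= p by apply: le_trans qp; exact: ltW.
have p0 : 0 < p by exact: lt_le_trans p1.
have r1 : 1 < fine (lower_index Phi).
  by move: lo1 (le_lt_trans loup upoo); case: (lower_index Phi).
set r := fine (lower_index Phi) in r1 mw *.
set A := fine (muckenhoupt_constant r w).
have [W [N [[mW W0 mN N0 wW] Wfin]]] := weight_borel ww.
have WA : (muckenhoupt_constant r W <= A%:E)%E.
  rewrite /A (eq_muckenhoupt_constant r mN N0 wW).
  move: mw; rewrite (eq_muckenhoupt_constant r mN N0 wW).
  by case: (muckenhoupt_constant r W) => [a _|//|_] /=; rewrite ?leNye ?lexx.
case: cid => C [C0 HC] /=.
have [T T0 suppT] := test_support tf.
have g0 y : 0 <= grad_norm f y by exact: enorm_ge0.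
have bg : bounded_nonneg (fun y => grad_norm f y `^ p).
  exact: (bounded_nonneg_grad n2 rho1 rhon qp tf).
have gT y : T < `|y| -> grad_norm f y = 0 by move=> /suppT[].
have bound k := HC p1 yPhi upoo r1 (grad_norm f) W T k g0 bg gT mW W0 Wfin WA.
have swap (F : 'rV[R]_n -> \bar R) : (\int[lebesgue_rV n]_x (F x * (w x)%:E) =
    \int[lebesgue_rV n]_x (F x * (W x)%:E))%E.
  by apply: (eq_lower_integral_off_null mN N0) => x _ /wW ->.
rewrite !swap.
pose u k (x : 'rV[R]_n) := (extend_left Phi (two_sided_sum (fun y => grad_norm f y `^ p) p k x) * W x)%:E.
have sc0 : 0 < singular_const n rho * sphere_norm rho Omega.
  have [? [_ P0 _ _ _]] := rough_kernel (ltnW n2) rho1 LO O0 Onz.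
  by apply: mulr_gt0 => //; exact: singular_const_gt0.
apply: (@le_trans _ _ (\int[lebesgue_rV n]_x limn (u ^~ x))%E).
  apply: le_lower_integral => x.
    apply: mule_ge0; last by rewrite lee_fin.
    apply: young_ext_ge0 => //; apply: mule_ge0; first exact: maximal_singular_ge0.
    by rewrite inve_ge0 lee_fin ltW.
  exact: (young_singular_le n2 rho1 rhon LO O0 Onz qp yPhi tf (W0 x)).
have S0 k x : 0 <= two_sided_sum (fun y => grad_norm f y `^ p) p k x.
  exact: two_sided_sum_ge0.
have mu' k : measurable_fun setT (u k).
  apply/measurable_EFinP; apply: measurable_funM => //.
  apply: (measurableT_comp (measurable_extend_left yPhi)).
  by apply: measurable_scale_sum => //; exact: exprn_gt0.
have u0 k x : setT x -> (0 <= u k x)%E.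
  move=> _; rewrite lee_fin mulr_ge0// extend_leftE//.
  have := S0 k x; rewrite le_eqVlt => /orP[/eqP<-|/(young_gt0 yPhi)/ltW//].
  by rewrite young0.
have und x : setT x -> {homo u ^~ x : k j / (k <= j)%N >-> (k <= j)%E}.
  move=> _ k j kj; rewrite lee_fin ler_wpM2r//; apply: extend_left_nd => //.
  exact: two_sided_sum_mono.
have cvgu := cvg_monotone_convergence (mu := lebesgue_rV n) measurableT mu' u0 und.
rewrite -(cvg_lim _ cvgu)//.
apply: lime_le; first by apply/cvg_ex; eexists; exact: cvgu.
by apply: nearW => k; exact: bound.
Qed.
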